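(* Let $\Phi:\mathbb R\to\mathbb R$ be a $2\pi$-periodic bounded function of the class $\mathcal{CBV}(\mathbb R)$. Then $\mathbb V_{\Phi}(z)$ has a finite angular limit $\varphi(\zeta)$ as $z\to\zeta$ for a.e. $\zeta\in\partial\mathbb D$.
   Context: $\mathbb D=\{z\in\mathbb C:|z|<1\}$. A function $\Phi:\mathbb R\to\mathbb C$ is of countably bounded variation, written $\Phi\in\mathcal{CBV}(\mathbb R)$, if there is a countable collection of mutually disjoint intervals $(a_n,b_n)$, $n=1,2,\dots$, on each of which the restriction of $\Phi$ is of bounded variation and such that the set $\mathbb R\setminus\bigcup_{n=1}^\infty(a_n,b_n)$ is countable. For arbitrary functions $g,f$ on a compact interval $[a,b]$, the Riemann--Stieltjes integral $\int_a^b g\,df$ is the limit, as $\delta:=\max_k|t_k-t_{k-1}|\to0$, of the sums $\sum_{k=1}^p g(\tau_k)\,(f(t_k)-f(t_{k-1}))$ over partitions $a=t_0\le t_1\le\dots\le t_p=b$ and points $\tau_k\in[t_{k-1},t_k]$, provided a finite limit exists, uniform with respect to the partitions and the intermediate points (no monotonicity or bounded variation is assumed). The conjugate Poisson kernel is $Q_r(\Theta)=\dfrac{2r\sin\Theta}{1-2r\cos\Theta+r^2}$, $0\le r<1$. For a $2\pi$-periodic bounded $\Phi:\mathbb R\to\mathbb R$ whose set of discontinuities has measure zero, the conjugate Poisson--Stieltjes integral is the Riemann--Stieltjes integral $$\mathbb V_\Phi(z):=\frac1{2\pi}\int_{-\pi}^{\pi}Q_r(\vartheta-t)\,d\Phi(t),\qquad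 z=re^{i\vartheta},\ r<1 .$$ A path in $\mathbb D$ terminating at $\zeta\in\partial\mathbb D$ is nontangential if its part in a neighborhood of $\zeta$ lies inside an angle in $\mathbb D$ with vertex at $\zeta$; the angular limit at $\zeta$ is the limit along all nontangential paths to $\zeta$. *)

(* Defs.v *)
From HB Require Import structures.
From mathcomp Require Import all_boot all_order all_algebra.
From mathcomp Require Import complex.
From mathcomp Require Import all_classical all_reals all_analysis.
Import Order.TTheory GRing.Theory Num.Theory.
Import numFieldNormedType.Exports.
Set Implicit Arguments.
Unset Strict Implicit.
Unset Printing Implicit Defensive.
Local Open Scope classical_set_scope.
Local Open Scope ring_scope.

Section defs.
Variable R : realType.
Implicit Types (a b r s t : R) (z zeta : R[i]).

(* The library norm [`|z|] of [z : R[i]] is [R[i]]-valued. *)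
Definition cabs z : R := complex.Re `|z|.

Definition expi t : R[i] := Complex (cos t) (sin t).

Definition disc : set R[i] := [set z | cabs z < 1].

(* One choice of argument: [z = cabs z * expi (arg z)], with [arg 0] arbitrary.
   It only ever occurs in [conj_poisson_kernel (cabs z) (arg z - t)], whose
   value does not depend on the choice (the kernel is 2pi-periodic and vanishes
   for [cabs z = 0]). *)
Definition arg z : R := xget 0 [set t | z = (cabs z)%:C%C * expi t].

(* Bounded variation of the restriction of [Phi] to the open interval (a, b):
   the variations over all finite partitions inside (a, b), whatever their end
   points, have a common bound. *)
Definition bounded_variation_oo a b (Phi : R -> R) :=
  exists M : R, forall c d (s : seq R),
    a < c -> d < b -> itv_partition c d s -> variation c d Phi s <= M.

Definition countably_bounded_variation (Phi : R -> R) :=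
  exists a b : nat -> R,
    [/\ forall n, a n < b n,
        trivIset setT (fun n => `]a n, b n[%classic),
        forall n, bounded_variation_oo (a n) (b n) Phi &
        countable (~` \bigcup_n `]a n, b n[%classic)].

Definition is_RS_integral (g f : R -> R) a b (l : R) :=
  forall eps : R, 0 < eps -> exists2 delta : R, 0 < delta &
    forall (p : nat) (t tau : nat -> R),
      t 0%N = a -> t p = b ->
      (forall k, (k < p)%N -> t k <= tau k <= t k.+1) ->
      (forall k, (k < p)%N -> t k.+1 - t k < delta) ->
      `|\sum_(k < p) g (tau k) * (f (t k.+1) - f (t k)) - l| < eps.

Definition RS_integrable (g f : R -> R) a b :=
  exists l, is_RS_integral g f a b l.

(* The value is 0 when the integral does not exist. *)
Definition RS_integral (g f : R -> R) a b : R :=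
  xget 0 (is_RS_integral g f a b).

Definition conj_poisson_kernel r Theta : R :=
  2 * r * sin Theta / (1 - 2 * r * cos Theta + r ^+ 2).

Definition conj_poisson_stieltjes_exists (Phi : R -> R) z :=
  RS_integrable (fun t => conj_poisson_kernel (cabs z) (arg z - t))
    Phi (- pi) pi.

Definition conj_poisson_stieltjes (Phi : R -> R) z : R :=
  (2 * pi)^-1 *
  RS_integral (fun t => conj_poisson_kernel (cabs z) (arg z - t))
    Phi (- pi) pi.

(* [R[i]^o] is [R[i]] with its norm topology. *)
Definition disc_path_to zeta (gamma : R -> R[i]^o) :=
  [/\ {within `[0, 1], continuous gamma},
      forall t, 0 <= t < 1 -> disc (gamma t) &
      gamma 1 = zeta].

Definition angle zeta (alpha beta : R) : set R[i] :=
  [set z | exists s t,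
     [/\ 0 < s, alpha < t < beta & z = zeta + s%:C%C * expi t]].

(* An angle is unbounded, so that only its part near the vertex [zeta] can be
   contained in the disc. *)
Definition nontangential zeta (gamma : R -> R[i]) :=
  exists alpha beta delta : R,
    [/\ 0 < delta,
        forall z, angle zeta alpha beta z -> cabs (z - zeta) < delta -> disc z &
        forall t, 0 <= t < 1 -> cabs (gamma t - zeta) < delta ->
          angle zeta alpha beta (gamma t)].

Definition angular_limit (F : R[i] -> R) zeta (l : R) :=
  forall gamma : R -> R[i]^o,
    disc_path_to zeta gamma -> nontangential zeta gamma ->
    F (gamma t) @[t --> 1^'-] --> l.

(* Almost everywhere on the unit circle with respect to arc length, transported
   to the line by the parametrization [expi]; ranging over all of [R] instead of
   one period does not change the meaning. *)
Definition ae_circle (P : R[i] -> Prop) :=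
  {ae (@lebesgue_measure R), forall t, P (expi t)}.

End defs.

(* Main.v *)
Require Import Defs.
From HB Require Import structures.
From mathcomp Require Import all_boot all_order all_algebra.
From mathcomp Require Import complex ring lra.
From mathcomp Require Import all_classical all_reals all_analysis measurable_realfun.
Import Order.TTheory GRing.Theory Num.Theory.
Import numFieldNormedType.Exports.
Set Implicit Arguments.
Unset Strict Implicit.
Unset Printing Implicit Defensive.
Local Open Scope classical_set_scope.
Local Open Scope ring_scope.

(** In the coordinates [z = exp (- y + i x)], [y > 0], integration by parts turns
the conjugate Poisson-Stieltjes integral into the Riemann integral of [Phi]
against the derivative of the conjugate kernel.  Near a compact subinterval
[c, d] of one of the intervals (a_n, b_n), [Phi] is a difference of two
nondecreasing functions, and the rest of the circle contributes a function that
is continuous up to the boundary, so it is enough to treat the conjugate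
potential [v] of a finite measure [mu].  Let [u >= 0] be its Poisson potential.
The function exp (- (u + i v)) is analytic and bounded, hence has limits in
almost all cones (Fatou): the boundary function of its primitive is Lipschitz,
hence a.e. differentiable by Radon-Nikodym, and at a point of differentiability
the maximum principle with an explicit barrier transfers the difference quotients
to the interior.  By Vitali's covering lemma [mu] has finite upper density a.e.;
there [u] is bounded in every cone, so the limit of exp (- (u + i v)) is nonzero,
and its continuous argument [- v] converges as well, by the intermediate value
theorem.  A Stolz angle lies in a cone of the half-plane. *)

(** * Kernels in strip coordinates *)

(** [Phi] may have infinite variation on the circle, so [dPhi] need not be a measure and no
    potential can be formed globally. Integration by parts removes [dPhi]: it only needs boundedness
    and countably many discontinuities, and the resulting integral can be cut at arbitrary points,
    each piece being treated by its own means. The conjugate potential is unbounded and of no fixed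
    sign; the only one-sided bound at hand is [u >= 0], which is why monotone pieces and the
    exponential come in. Difference quotients of the primitive are means over windows. A mean over a
    window of length [eta * y] at height [y] is close to the value there because the gradient is O(1
    / y); the exponential has this property since the gradient of u + i v is O(u / y) and u exp (-
    u) is bounded. A zero limit of the exponential must be excluded a.e.; bounding u through the
    density of the measure does so without a uniqueness theorem for bounded analytic functions.
    [cone_limit] covers all apertures at once, so one null set serves all angles. *)

Section kernels.
Context {R : realType}.
Implicit Types (x y T : R).

Lemma le_norm_MVT (f df : R -> R) (a b k : R) : a <= b ->
  (forall x, a <= x <= b -> is_derive x (1 : R) f (df x)) ->
  (forall x, a <= x <= b -> `|df x| <= k) ->
  `|f b - f a| <= k * (b - a).
Proof.
move=> ab fdf dfk.
have cf : {within `[a, b], continuous f}.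
  apply: derivable_within_continuous => x; rewrite in_itv/= => xab.
  by have := fdf _ xab => ?; exact: ex_derive.
have [x|c] := MVT_segment (df := df) ab _ cf.
  by rewrite in_itv/= => /andP[ax xb]; apply: fdf; rewrite !ltW.
rewrite in_itv/= => cab ->.
by rewrite normrM [`|b - a|]ger0_norm ?subr_ge0// ler_wpM2r ?subr_ge0 ?dfk.
Qed.

Lemma le_norm_lip (f df : R -> R) (a b k : R) :
  (forall x, is_derive x (1 : R) f (df x)) -> (forall x, `|df x| <= k) ->
  `|f b - f a| <= k * `|b - a|.
Proof.
move=> fdf dfk; have [ab|/ltW ba] := leP a b.
  by rewrite [`|b - a|]ger0_norm ?subr_ge0//; apply: (le_norm_MVT ab).
by rewrite distrC [`|b - a|]distrC [`|a - b|]ger0_norm ?subr_ge0//;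
  apply: (le_norm_MVT ba).
Qed.

Lemma dist_sin x y : `|sin x - sin y| <= `|x - y|.
Proof.
rewrite -[leRHS]mul1r; apply: (le_norm_lip (df := cos)) => t.
exact: cos_max.
Qed.

Lemma dist_cos x y : `|cos x - cos y| <= `|x - y|.
Proof.
rewrite -[leRHS]mul1r; apply: (le_norm_lip (df := fun t => - sin t)) => t.
rewrite normrN; exact: sin_max.
Qed.

(** The derivative of sin is at least 1/2 on [0, 1]: by the half-angle formula cos t = 1 - 2 sin^2
    (t / 2), and |sin (t / 2)| <= 1/2 there. *)
Lemma half_le_sin x : 0 <= x <= 1 -> x / 2 <= sin x.
Proof.
move=> /andP[x0 x1].
have sx (t : R) : `|sin t| <= `|t| by have := dist_sin t 0; rewrite sin0 !subr0.
have c2 (t : R) : 0 <= t <= 1 -> 2^-1 <= cos t.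
  move=> /andP[t0 t1].
  have := cos2Dsin2 (t / 2).
  have -> : cos t = cos (t / 2) ^+ 2 *+ 2 - 1.
    by rewrite -cos_mulr2n; congr cos; rewrite -mulr_natr; field.
  have : sin (t / 2) ^+ 2 <= 4^-1.
    rewrite -real_normK ?num_real//.
    have h : `|sin (t / 2)| <= 2^-1.
      by apply: (le_trans (sx _)); rewrite ger0_norm ?divr_ge0//; lra.
    have h0 := normr_ge0 (sin (t / 2)); nra.
  lra.
pose f t : R := sin t - t / 2.
suff : f 0 <= f x by rewrite /f sin0 mul0r subr0 subr_ge0.
have fd t : is_derive t (1 : R) f (cos t - 2^-1).
  rewrite /f; apply: is_deriveB.
  have -> : (fun x : R => x / 2) = (2^-1 \*: id)%R.
    by apply/funext => u; rewrite /= mulrC.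
  by rewrite -[X in is_derive _ _ _ X]mulr1; apply: is_deriveZ.
have cf : {within `[0, x], continuous f}.
  by apply: derivable_within_continuous => t _; exact: ex_derive.
have [c cx fE] := MVT_segment x0 (fun t _ => fd t) cf.
rewrite -subr_ge0 fE mulr_ge0 ?subr_ge0// ?c2//.
move: cx; rewrite in_itv/= => /andP[-> cx]; lra.
Qed.

Lemma half_norm_le_sin x : `|x| <= 1 -> `|x| / 2 <= `|sin x|.
Proof.
move=> x1; have [x0|x0] := leP 0 x.
  rewrite ger0_norm//; apply: (le_trans _ (ler_norm _)).
  by apply: half_le_sin; rewrite x0/= -(ger0_norm x0).
rewrite ltr0_norm// -normrN -sinN; apply: (le_trans _ (ler_norm _)).
by apply: half_le_sin; rewrite oppr_ge0 ltW//= -(ltr0_norm x0).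
Qed.

(** From 1 - cos x = 2 sin^2 (x / 2) and the linear lower bound for the sine at x / 2, whence the
    range |x| <= 2. *)
Lemma sqr_le_1Bcos x : `|x| <= 2 -> x ^+ 2 / 8 <= 1 - cos x.
Proof.
move=> x2.
have -> : 1 - cos x = 2 * sin (x / 2) ^+ 2.
  have -> : cos x = cos (x / 2) ^+ 2 *+ 2 - 1.
    by rewrite -cos_mulr2n; congr cos; rewrite -mulr_natr; field.
  have := cos2Dsin2 (x / 2); lra.
have := @half_norm_le_sin (x / 2).
rewrite normrM (@ger0_norm _ 2^-1)// => /(_ ltac:(lra)) h.
rewrite -(real_normK (num_real x)) -(real_normK (num_real (sin (x / 2)))).
have := normr_ge0 x; nra.
Qed.

(** Hyperbolic cosine and sine. With r = exp (- y), dividing 1 - 2 r cos x + r^2 by 2 r gives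
    [ch y - cos x], and dividing 1 - r^2 by 2 r gives [sh y]. *)
Definition ch y : R := (expR y + expR (- y)) / 2.
Definition sh y : R := (expR y - expR (- y)) / 2.

Lemma is_derive_ch y : is_derive y (1 : R) ch (sh y).
Proof.
rewrite /ch; apply: is_derive_eq.
by rewrite /GRing.scale/= /sh; field.
Qed.

Lemma is_derive_sh y : is_derive y (1 : R) sh (ch y).
Proof.
rewrite /sh; apply: is_derive_eq.
by rewrite /GRing.scale/= /ch; field.
Qed.

Lemma ch2Bsh2 y : ch y ^+ 2 - sh y ^+ 2 = 1.
Proof. by rewrite /ch /sh -[RHS](expRxMexpNx_1 y); field. Qed.

Lemma sh_ge y : 0 <= y -> y / 2 <= sh y.
Proof.
move=> y0; have e1 := expR_ge1Dx y; have e2 := expRxMexpNx_1 y.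
have e3 := expR_gt0 (- y).
rewrite /sh ler_pM2r ?invr_gt0//.
have : expR (- y) <= 1 by rewrite expR_le1 oppr_le0.
lra.
Qed.

Lemma sh_le y : 0 <= y <= 2^-1 -> sh y <= 2 * y.
Proof.
move=> /andP[y0 y1]; have e1 := expR_ge1Dx (- y).
have e2 := expRxMexpNx_1 y; have e3 := expR_gt0 y.
rewrite /sh; nra.
Qed.

Lemma ch_ge y : 0 <= y -> 1 + y ^+ 2 / 8 <= ch y.
Proof.
move=> y0; have := sh_ge (y := y / 2) ltac:(lra).
have -> : ch y = 1 + 2 * sh (y / 2) ^+ 2.
  have := ch2Bsh2 (y / 2).
  have -> : ch y = ch (y / 2) ^+ 2 + sh (y / 2) ^+ 2.
    have e z : expR z = expR (z / 2) * expR (z / 2) :> R.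
      by rewrite -expRD; congr expR; field.
    by rewrite /ch /sh (e y) (e (- y)) mulNr; field.
  lra.
nra.
Qed.

Lemma ch_ge1 y : 1 <= ch y.
Proof.
have := ch2Bsh2 y; have : 0 < ch y by rewrite /ch divr_gt0// addr_gt0 ?expR_gt0.
have := sqr_ge0 (sh y); nra.
Qed.

Lemma ch_gt1 y : 0 < y -> 1 < ch y.
Proof. move=> y0; have := ch_ge (ltW y0); nra. Qed.

(* With [r = exp (- y)], [poisK x y] is (1 - r^2) / (1 - 2 r cos x + r^2) and
   [conjK x y] is the kernel Q_r(x); [dpoisK] and [dconjK] are their x-derivatives.
   As [poisK + i conjK] is analytic in [x + i y], these also give the y-derivatives. *)
Definition den x y : R := ch y - cos x.
Definition poisK x y : R := sh y / den x y.
Definition conjK x y : R := sin x / den x y.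
Definition dconjK x y : R := (cos x * ch y - 1) / den x y ^+ 2.
Definition dpoisK x y : R := - (sin x * sh y) / den x y ^+ 2.

Lemma den_gt0 x y : 0 < y -> 0 < den x y.
Proof. by move=> y0; rewrite subr_gt0 (le_lt_trans (cos_le1 x))// ch_gt1. Qed.

Lemma den_ge x y : `|x| <= 2 -> 0 <= y -> (y ^+ 2 + x ^+ 2) / 8 <= den x y.
Proof. move=> x2 y0; have := ch_ge y0; have := sqr_le_1Bcos x2; rewrite /den; lra. Qed.

Lemma is_derive_denx x y : is_derive x (1 : R) (den ^~ y) (sin x).
Proof. by rewrite /den; apply: is_derive_eq; rewrite /GRing.scale/=; ring. Qed.

Lemma is_derive_deny x y : is_derive y (1 : R) (den x) (sh y).
Proof.
have ? := is_derive_ch y.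
by rewrite /den; apply: is_derive_eq; rewrite /GRing.scale/=; ring.
Qed.

Lemma is_derive_div (f g : R -> R) (t df dg c : R) : g t != 0 ->
  is_derive t (1 : R) f df -> is_derive t (1 : R) g dg ->
  c = (df * g t - f t * dg) / g t ^+ 2 ->
  is_derive t (1 : R) (fun s => f s / g s) c.
Proof.
move=> g0 hf hg ->.
have hgV := is_deriveV g0.
apply: is_derive_eq; rewrite /GRing.scale/=; field.
exact: g0.
Qed.

Lemma is_derive1_shift (f : R -> R) (t x c : R) :
  is_derive (x + t) (1 : R) f c -> is_derive x (1 : R) (fun s => f (s + t)) c.
Proof.
move=> hf; have hs : is_derive x (1 : R) (fun s : R => s + t) 1.
  by apply: is_derive_eq; rewrite addr0.
have := @is_derive1_comp R f (fun s => s + t) x c 1 hf hs.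
by rewrite mulr1.
Qed.

Lemma is_derive_poisKx x y : 0 < y ->
  is_derive x (1 : R) (poisK ^~ y) (dpoisK x y).
Proof.
move=> y0; have d0 : den x y != 0 by rewrite gt_eqF// den_gt0.
refine (is_derive_div (f := cst (sh y)) (g := den ^~ y) d0 (is_derive_cst _ _ _) (is_derive_denx x y) _).
by rewrite /dpoisK /=; congr (_ / _); ring.
Qed.

Lemma is_derive_conjKx x y : 0 < y ->
  is_derive x (1 : R) (conjK ^~ y) (dconjK x y).
Proof.
move=> y0; have d0 : den x y != 0 by rewrite gt_eqF// den_gt0.
refine (is_derive_div (g := den ^~ y) d0 (is_derive_sin x) (is_derive_denx x y) _).
rewrite /dconjK -expr2 sin2cos2; congr (_ / _).
by rewrite /den; ring.
Qed.

Lemma is_derive_poisKy x y : 0 < y ->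
  is_derive y (1 : R) (poisK x) (- dconjK x y).
Proof.
move=> y0; have d0 : den x y != 0 by rewrite gt_eqF// den_gt0.
refine (is_derive_div d0 (is_derive_sh y) (is_derive_deny x y) _).
rewrite /dconjK -mulNr; congr (_ / _).
by have := ch2Bsh2 y; rewrite /den; lra.
Qed.

Lemma is_derive_conjKy x y : 0 < y ->
  is_derive y (1 : R) (conjK x) (dpoisK x y).
Proof.
move=> y0; have d0 : den x y != 0 by rewrite gt_eqF// den_gt0.
refine (is_derive_div (f := cst (sin x)) d0 (is_derive_cst _ _ _) (is_derive_deny x y) _).
by rewrite /dpoisK /=; congr (_ / _); ring.
Qed.

Lemma sh_gt0 y : 0 < y -> 0 < sh y.
Proof. by move=> y0; rewrite (lt_le_trans _ (sh_ge (ltW y0)))// divr_gt0. Qed.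

Lemma poisK_ge0 x y : 0 < y -> 0 <= poisK x y.
Proof. by move=> y0; rewrite ltW// divr_gt0 ?den_gt0 ?sh_gt0. Qed.

(** The numerators of [dpoisK] and [dconjK] have squares adding up to [den x y ^+ 2], so each is at
    most [den x y] in absolute value. Here the bound comes directly from the factorizations (ch y -
    1)(1 + cos x) and (ch y + 1)(1 - cos x) of the sum and difference of [den x y] and the
    numerator. *)
Lemma norm_dconjK_le x y : 0 < y -> `|dconjK x y| <= (den x y)^-1.
Proof.
move=> y0; have d0 := den_gt0 x y0.
rewrite normrM [`|_ ^- 2|]gtr0_norm ?invr_gt0 ?exprn_gt0//.
rewrite ler_pdivrMr ?exprn_gt0// expr2 mulKf ?gt_eqF//.
have c1 := ch_ge1 y; have := cos_le1 x; have := cos_geN1 x.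
rewrite ler_norml /den => cN1 c2; apply/andP; split; nra.
Qed.

Lemma norm_dpoisK_le x y : 0 < y -> `|dpoisK x y| <= (den x y)^-1.
Proof.
move=> y0; have d0 := den_gt0 x y0.
rewrite normrM [`|_ ^- 2|]gtr0_norm ?invr_gt0 ?exprn_gt0//.
rewrite ler_pdivrMr ?exprn_gt0// expr2 mulKf ?gt_eqF//.
rewrite -(ler_pXn2r (n := 2)) ?nnegrE ?(ltW d0)//.
rewrite real_normK ?num_real// sqrrN exprMn sin2cos2.
have -> : sh y ^+ 2 = ch y ^+ 2 - 1 by have := ch2Bsh2 y; lra.
rewrite /den -subr_ge0.
have -> : (ch y - cos x) ^+ 2 - (1 - cos x ^+ 2) * (ch y ^+ 2 - 1) =
  (cos x * ch y - 1) ^+ 2 by ring.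
exact: sqr_ge0.
Qed.

(** Harnack's gradient bound at the level of kernels: integrated against a positive measure, it
    bounds the gradients of u and v by a multiple of u / y. *)
Lemma denV_le_poisK x y : 0 < y -> (den x y)^-1 <= 2 / y * poisK x y.
Proof.
move=> y0; rewrite /poisK mulrA ler_pMl ?invr_gt0 ?den_gt0//.
by rewrite mulrAC ler_pdivlMr// mul1r; have := sh_ge (ltW y0); lra.
Qed.

Lemma denV_le x y : 0 < y -> (den x y)^-1 <= (ch y - 1)^-1.
Proof.
move=> y0; rewrite lef_pV2 ?posrE ?den_gt0 ?subr_gt0 ?ch_gt1//.
by rewrite lerB// cos_le1.
Qed.

(** Comparison with the Poisson kernel y / (y^2 + x^2) of the half-plane; 16 = 2 * 8 joins the
    constants of [sh_le] and [den_ge]. *)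
Lemma poisK_le x y : `|x| <= 2 -> 0 < y <= 2^-1 ->
  poisK x y <= 16 * y / (y ^+ 2 + x ^+ 2).
Proof.
move=> x2 /andP[y0 y1].
have p : 0 < y ^+ 2 + x ^+ 2 by rewrite ltr_pwDl ?exprn_gt0 ?sqr_ge0.
rewrite /poisK ler_pdivrMr ?den_gt0// mulrAC ler_pdivlMr//.
have := den_ge x2 (ltW y0).
have := @sh_le y; rewrite (ltW y0) y1 => /(_ isT) h1 h2.
nra.
Qed.

Lemma continuous_denx y : continuous (den ^~ y).
Proof.
move=> x; apply: differentiable_continuous; apply/derivable1_diffP.
by have ? := is_derive_denx x y; exact: ex_derive.
Qed.

Lemma continuous_dconjK y : 0 < y -> continuous (dconjK ^~ y).
Proof.
move=> y0 x; apply: cvgM.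
  apply: cvgB; last exact: cvg_cst.
  by apply: cvgM; [exact: continuous_cos|exact: cvg_cst].
apply: cvgV; first by rewrite gt_eqF ?exprn_gt0 ?den_gt0.
by apply: cvgM; exact: continuous_denx.
Qed.

Lemma continuous_dpoisK y : 0 < y -> continuous (dpoisK ^~ y).
Proof.
move=> y0 x; apply: cvgM.
  by apply: cvgN; apply: cvgM; [exact: continuous_sin|exact: cvg_cst].
apply: cvgV; first by rewrite gt_eqF ?exprn_gt0 ?den_gt0.
by apply: cvgM; exact: continuous_denx.
Qed.

End kernels.

(** * Maximum principle *)

Section maximum_principle.
Context {R : realType}.
Implicit Types (x y : R).

Lemma is_derive_expansion (f : R -> R) (x c e : R) : is_derive x (1 : R) f c -> 0 < e ->
  exists2 d : R, 0 < d & forall h, `|h| < d -> `|f (x + h) - f x - c * h| <= e * `|h|.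
Proof.
move=> fc e0.
have : h^-1 *: (f (h *: (1 : R) + x) - f x) @[h --> 0^'] --> c.
  have /cvg_ex[l fl] := @ex_derive _ _ _ _ _ _ _ fc.
  have <- : 'D_1 f x = c by exact: derive_val.
  by rewrite /derive (cvg_lim _ fl).
move/cvgrPdist_le => /(_ _ e0); rewrite near_withinE => /nbhs_ballP[d /= d0 H].
exists d => // h hd; have [->|h0] := eqVneq h 0.
  by rewrite addr0 mulr0 normr0 mulr0 !subrr normr0.
have := H h; rewrite /ball/= sub0r normrN => /(_ hd h0).
rewrite /GRing.scale/= mulr1 [h + x]addrC => H1.
have -> : f (x + h) - f x - c * h = - (c - h^-1 * (f (x + h) - f x)) * h by field.
by rewrite normrM normrN ler_wpM2r.
Qed.

(** The second derivative is only assumed at [p]. Were it positive, [g1] would be positive just to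
    the right of [p], and the mean value theorem would produce a value of [g] above [g p]. *)
Lemma second_derivative_at_max (g g1 : R -> R) (a b p c : R) : a < p < b ->
  (forall t, a < t < b -> is_derive t (1 : R) g (g1 t)) ->
  is_derive p (1 : R) g1 c -> (forall t, a < t < b -> g t <= g p) -> c <= 0.
Proof.
move=> /andP[ap pb] gg1 g1c gp.
have g1p : g1 p = 0.
  have pab : p \in `]a, b[%R by rewrite in_itv/= ap.
  have ab : a <= b by rewrite (le_trans (ltW ap)) ?ltW.
  have h : is_derive p (1 : R) g 0.
    apply: (derive1_at_max ab _ pab) => t; rewrite in_itv/= => tab.
      by have ? := gg1 t tab; exact: ex_derive.
    exact: gp.
  have h1 := gg1 p ltac:(by rewrite ap).
  by rewrite -(@derive_val _ _ _ _ _ _ _ h1) (@derive_val _ _ _ _ _ _ _ h).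
rewrite leNgt; apply/negP => c0.
have [d d0 dP] := is_derive_expansion g1c (divr_gt0 c0 (ltr0Sn R 1)).
pose m := Num.min (d / 2) ((b - p) / 2).
have m0 : 0 < m by rewrite lt_min !divr_gt0// subr_gt0.
have md : m <= d / 2 by rewrite ge_min lexx.
have mb : m <= (b - p) / 2 by rewrite ge_min lexx orbT.
have gt (h : R) : 0 < h <= m -> 0 < g1 (p + h).
  move=> /andP[h0 hm]; have := dP h; rewrite gtr0_norm// => /(_ ltac:(lra)).
  by rewrite ler_norml g1p => /andP[+ _]; nra.
have pm : p <= p + m by lra.
have dg t : p <= t <= p + m -> is_derive t (1 : R) g (g1 t).
  by move=> /andP[pt tm]; apply: gg1; apply/andP; split; lra.
have cg : {within `[p, p + m], continuous g}.
  apply: derivable_within_continuous => t; rewrite in_itv/= => tm.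
  by have ? := dg t tm; exact: ex_derive.
have [|t|x] := @MVT R g g1 p (p + m) _ _ cg; first by lra.
  by rewrite in_itv/= => /andP[? ?]; apply: dg; rewrite !ltW.
rewrite in_itv/= => /andP[px xm] gE.
have : g (p + m) <= g p by apply: gp; apply/andP; split; lra.
have : 0 < g1 x by have := gt (x - p); rewrite [p + _]addrC subrK; apply; apply/andP; split; lra.
nra.
Qed.

Variables (a b p q : R) (W : R * R -> R) (W1 W2 W11 W22 : R -> R -> R) (m : R).
Hypothesis ab : a <= b.
Hypothesis pq : p <= q.
Hypothesis cW : {within `[a, b] `*` `[p, q], continuous W}.
Hypothesis dW1 : forall x y, a < x < b -> p < y < q ->
  is_derive x (1 : R) (fun t => W (t, y)) (W1 x y).
Hypothesis dW2 : forall x y, a < x < b -> p < y < q ->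
  is_derive y (1 : R) (fun t => W (x, t)) (W2 x y).
Hypothesis dW11 : forall x y, a < x < b -> p < y < q ->
  is_derive x (1 : R) (W1 ^~ y) (W11 x y).
Hypothesis dW22 : forall x y, a < x < b -> p < y < q ->
  is_derive y (1 : R) (W2 x) (W22 x y).
Hypothesis bottom : forall x, a <= x <= b -> W (x, p) <= m.
Hypothesis top : forall x, a <= x <= b -> W (x, q) <= m.
Hypothesis left : forall y, p <= y <= q -> W (a, y) <= m.
Hypothesis right : forall y, p <= y <= q -> W (b, y) <= m.

Lemma strict_subharmonic_le_boundary :
  (forall x y, a < x < b -> p < y < q -> 0 < W11 x y + W22 x y) ->
  forall x y, a <= x <= b -> p <= y <= q -> W (x, y) <= m.
Proof.
move=> lapl x y xab ypq.
have [||[u v]] := compact_EVT_max _ _ cW.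
- by exists (x, y); split; rewrite /= in_itv/=.
- by apply: compact_setX; exact: segment_compact.
rewrite inE/= => -[]; rewrite !in_itv/= => uab vpq Wmax.
have {}Wmax s t : a <= s <= b -> p <= t <= q -> W (s, t) <= W (u, v).
  by move=> sab tpq; apply: Wmax; rewrite inE; split; rewrite /= in_itv.
apply: (le_trans (Wmax _ _ xab ypq)).
have [->|ua] := eqVneq u a; first exact: left.
have [->|ub] := eqVneq u b; first exact: right.
have [->|vp] := eqVneq v p; first exact: bottom.
have [->|vq] := eqVneq v q; first exact: top.
have {}uab' : a < u < b.
  by rewrite !lt_neqAle [a == u]eq_sym ua ub.
have {}vpq' : p < v < q.
  by rewrite !lt_neqAle [p == v]eq_sym vp vq.
have h1 : W11 u v <= 0.
  apply: (@second_derivative_at_max (fun t => W (t, v)) (W1 ^~ v) a b u) => //.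
  - by move=> t tab; exact: dW1.
  - exact: dW11.
  - by move=> t /andP[ta tb]; apply: Wmax; rewrite // (ltW ta) (ltW tb).
have h2 : W22 u v <= 0.
  apply: (@second_derivative_at_max (fun t => W (u, t)) (W2 u) p q v) => //.
  - by move=> t tab; exact: dW2.
  - exact: dW22.
  - by move=> t /andP[ta tb]; apply: Wmax; rewrite // (ltW ta) (ltW tb).
by have := lapl u v uab' vpq'; rewrite ltNge => /negP[]; rewrite -(addr0 0) lerD.
Qed.

End maximum_principle.

(** Adding k (x - a)^2 makes the Laplacian strictly positive and costs at most [e] on the rectangle.
    The summand 1 in the denominator of [k] covers the case [a = b]. *)
Lemma subharmonic_le_boundary {R : realType} (a b p q : R) (W : R * R -> R)
  (W1 W2 W11 W22 : R -> R -> R) (m : R) : a <= b -> p <= q ->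
  {within `[a, b] `*` `[p, q], continuous W} ->
  (forall x y, a < x < b -> p < y < q ->
     is_derive x (1 : R) (fun t => W (t, y)) (W1 x y)) ->
  (forall x y, a < x < b -> p < y < q ->
     is_derive y (1 : R) (fun t => W (x, t)) (W2 x y)) ->
  (forall x y, a < x < b -> p < y < q -> is_derive x (1 : R) (W1 ^~ y) (W11 x y)) ->
  (forall x y, a < x < b -> p < y < q -> is_derive y (1 : R) (W2 x) (W22 x y)) ->
  (forall x, a <= x <= b -> W (x, p) <= m) ->
  (forall x, a <= x <= b -> W (x, q) <= m) ->
  (forall y, p <= y <= q -> W (a, y) <= m) ->
  (forall y, p <= y <= q -> W (b, y) <= m) ->
  (forall x y, a < x < b -> p < y < q -> 0 <= W11 x y + W22 x y) ->
  forall x y, a <= x <= b -> p <= y <= q -> W (x, y) <= m.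
Proof.
move=> ab pq cW dW1 dW2 dW11 dW22 hb ht hl hr lapl x y xab ypq.
apply/ler_addgt0Pr => e e0.
pose k := e / (1 + (b - a) ^+ 2).
have K0 : 0 < 1 + (b - a) ^+ 2 by rewrite ltr_pwDl// sqr_ge0.
have k0 : 0 < k by rewrite divr_gt0.
have ke : k * (b - a) ^+ 2 <= e.
  rewrite /k mulrAC ler_pdivrMr// mulrDr mulr1 lerDr; exact: ltW.
pose V (z : R * R) := W z + k * (z.1 - a) ^+ 2.
have kx s : a <= s <= b -> k * (s - a) ^+ 2 <= e.
  move=> /andP[sa sb]; apply: le_trans ke; rewrite ler_wpM2l ?(ltW k0)//.
  by rewrite ler_sqr ?nnegrE ?subr_ge0 ?lerB// (le_trans sa).
have dsq s : is_derive s (1 : R) (fun t : R => k * (t - a) ^+ 2) (2 * k * (s - a)).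
  by apply: is_derive_eq; rewrite /GRing.scale/=; ring.
have V0 z : 0 <= k * (z - a) ^+ 2 by rewrite mulr_ge0 ?(ltW k0)// sqr_ge0.
have ck : {within `[a, b] `*` `[p, q], continuous (fun z : R * R => k * (z.1 - a) ^+ 2)}.
  apply: continuous_subspaceT => z; apply: cvgM; first exact: cvg_cst.
  by apply: cvgM; apply: cvgB; [exact: cvg_fst|exact: cvg_cst|exact: cvg_fst|exact: cvg_cst].
apply: (@le_trans _ _ (V (x, y))).
  by rewrite /V lerDl V0.
apply: (@strict_subharmonic_le_boundary R a b p q V
  (fun s t => W1 s t + 2 * k * (s - a)) W2 (fun s t => W11 s t + 2 * k) W22) => //.
- by move=> z; apply: cvgD; [exact: cW|exact: ck].
- move=> s t sab tpq.
  exact: (@is_deriveD _ _ _ (fun s => W (s, t)) (fun s => k * (s - a) ^+ 2) _ _ _ _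
    (dW1 s t sab tpq) (dsq s)).
- move=> s t sab tpq; rewrite -[W2 s t]addr0.
  exact: (@is_deriveD _ _ _ (fun t => W (s, t)) (cst (k * (s - a) ^+ 2)) _ _ _ _
    (dW2 s t sab tpq) (is_derive_cst _ _ _)).
- move=> s t sab tpq; have := dW11 s t sab tpq => h.
  apply: (@is_deriveD _ _ _ (W1^~ t) (fun s => 2 * k * (s - a)) _ _ _ _ h).
  by apply: is_derive_eq; rewrite /GRing.scale/=; ring.
- by move=> s sab; rewrite /V lerD ?hb ?kx.
- by move=> s sab; rewrite /V lerD ?ht ?kx.
- by move=> s sab; rewrite /V lerD ?hl ?kx// lexx.
- by move=> s sab; rewrite /V lerD ?hr ?kx// lexx andbT.
- by move=> s t sab tpq; have := lapl s t sab tpq; lra.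
Qed.

(** * Stieltjes measures and almost everywhere differentiability of Lipschitz functions *)

Section stieltjes.
Context {R : realType}.
Local Notation lambda := (@lebesgue_measure R).

Lemma ae_mono (P Q : R -> Prop) : (forall x, P x -> Q x) ->
  {ae lambda, forall x, P x} -> {ae lambda, forall x, Q x}.
Proof. by move=> PQ; apply: filterS; first exact: (ae_filter_ringOfSetsType lambda). Qed.

Lemma ae_and (P Q : R -> Prop) : {ae lambda, forall x, P x} ->
  {ae lambda, forall x, Q x} -> {ae lambda, forall x, P x /\ Q x}.
Proof. by apply: filterS2; [exact: (ae_filter_ringOfSetsType lambda)|split]. Qed.

Lemma ae_countable_forall (P : nat -> R -> Prop) :
  (forall n, {ae lambda, forall x, P n x}) -> {ae lambda, forall x, forall n, P n x}.
Proof. by move=> H; exact/ae_foralln. Qed.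

Lemma right_continuous_of_lipschitz (f : R -> R) (k : R) :
  (forall x y, `|f x - f y| <= k * `|x - y|) -> continuous f.
Proof.
move=> fk x; apply/cvgrPdist_le => e e0.
have K0 : 0 < `|k| + 1 by rewrite ltr_pwDr.
near=> y; apply: (le_trans (fk _ _)).
apply: (@le_trans _ _ ((`|k| + 1) * `|x - y|)).
  by rewrite ler_wpM2r// (le_trans (ler_norm _))// lerDl.
rewrite -ler_pdivlMl// mulrC; near: y.
by apply: cvgr_dist_le; [exact: cvg_id|rewrite divr_gt0].
Unshelve. all: by end_near. Qed.

(** The comparison with Lebesgue measure holds for every set [A], measurable or not: both sides are
    infima over covers by half-open intervals, and there the Lipschitz bound applies interval by
    interval. *)
Lemma exists_stieltjes_measure (f : R -> R) :
  {homo f : x y / x <= y} -> right_continuous f ->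
  exists mu : {sigma_finite_measure set (measurableTypeR R) -> \bar R},
    (forall a b : R, a <= b -> mu `]a, b]%classic = (f b - f a)%:E) /\
    (forall k, 0 < k -> (forall a b, a <= b -> f b - f a <= k * (b - a)) ->
      forall A, (mu A <= k%:E * lambda A)%E).
Proof.
move=> ndf rcf.
pose F : cumulative R R := HB.pack f (isCumulative.Build R _ R f ndf rcf).
exists (lebesgue_stieltjes_measure F); split.
  move=> a b ab; transitivity (wlength F `]a, b]%classic); last by rewrite wlength_itv_bnd.
  apply: measurable_mu_extE; exact: is_ocitv.
move=> k k0 fk A.
rewrite -lee_pdivrMl//.
rewrite /lebesgue_measure /lebesgue_stieltjes_measure /measure_extension/=.
apply: le_ereal_inf_tmp => _ [X [mX AX] <-].
rewrite lee_pdivrMl//.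
apply: (@le_trans _ _ (\sum_(i <oo) wlength F (X i))%E).
  by apply: ereal_inf_lbound; exists X.
rewrite -nneseriesZl//.
apply: lee_nneseries => i _; first by rewrite wlength_ge0.
have [->|[[a b] /= ab ->]] := (ocitvP (X i)).1 (mX i).
  by rewrite !wlength0 mule0.
by rewrite !wlength_itv_bnd ?(ltW ab)// -EFinM lee_fin fk// ltW.
Qed.

(** The Lipschitz bound makes the Stieltjes measure of [f] absolutely continuous. Its Radon-Nikodym
    density is integrated back to [f] on [a, b], and Lebesgue's differentiation theorem applies to
    that integral. *)
Lemma monotone_lipschitz_ae_derivable (f : R -> R) (k a b : R) : a < b -> 0 < k ->
  (forall x y, x <= y -> 0 <= f y - f x <= k * (y - x)) ->
  {ae lambda, forall x, a < x < b -> derivable f x 1}.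
Proof.
move=> ab k0 fk.
have ndf : {homo f : x y / x <= y}.
  by move=> x y /fk /andP[+ _]; rewrite subr_ge0.
have cf : continuous f.
  apply: (@right_continuous_of_lipschitz _ k) => x y.
  wlog xy : x y / x <= y.
    move=> H; have [/H//|/ltW/H] := leP x y.
    by rewrite distrC [`|y - x|]distrC.
  by rewrite distrC [`|x - y|]distrC !ger0_norm ?subr_ge0 ?ndf//; case/andP: (fk _ _ xy).
have rcf : right_continuous f := right_continuousW cf.
have [mu [muE muk]] := exists_stieltjes_measure ndf rcf.
have {}muk A : (mu A <= k%:E * lambda A)%E.
  by apply: muk => // x y /fk /andP[].
(* Restricting the measure to []a, b]] makes it finite, so that the density is integrable on the
   whole line. *)
pose D := `]a, b]%classic : set (measurableTypeR R).
have mD : measurable D by exact: measurable_itv.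
have muD : (mu D < +oo)%E by rewrite muE ?(ltW ab)// ltry.
pose nu : {finite_measure set _ -> \bar R} := mfrestr mD muD.
have nul : nu `<< lambda.
  apply/null_content_dominatesP => S mS S0.
  apply/eqP; rewrite eq_le measure_ge0 andbT /nu /= /mfrestr /mrestr.
  apply: (le_trans (muk _)).
  rewrite -[leRHS](mule0 k%:E) lee_wpmul2l ?lee_fin ?(ltW k0)// -[leRHS]S0.
  by apply: le_measure; rewrite ?inE//; apply: measurableI.
have [g [g0 gfin gint nuE]] := radon_nikodym_sigma_finite nul.
pose h (x : R) : R := fine (g x).
have hg : EFin \o h = g by apply/funext => x; rewrite /h /= fineK.
have hint : lambda.-integrable [set: R] (EFin \o h) by rewrite hg.
have hF x : a <= x <= b -> (\int[lambda]_(t in `]a, x]) h t)%R = f x - f a.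
  move=> /andP[ax xb]; rewrite /Rintegral.
  rewrite (_ : (fun t => (h t)%:E) = g); last by rewrite -hg.
  rewrite -nuE; last exact: measurable_itv.
  rewrite /nu /= /mfrestr /mrestr.
  rewrite (_ : _ `&` D = `]a, x]%classic) ?muE//.
  apply/setIidl => t /=; rewrite /D/= !in_itv/= => /andP[-> tx].
  exact: le_trans tx xb.
have hloc : locally_integrable [set: R] h by apply: open_integrable_locally => //; exact: openT.
have := @FTC1 R h (BRight a) _ hloc.
move=> /(_ _)/wrap[].
  by move=> y; apply: integrableS hint => //; exact: measurable_itv.
apply: ae_mono => x /= H /andP[ax xb].
have [dF _] := H ax.
have dF' : derivable (fun x => f a + \int[lambda]_(t in `]a, x]) h t)%R x 1.
  exact: (derivableD (derivable_cst _ _ _) dF).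
apply: near_eq_derivable dF' => //.
near=> y.
rewrite hF; first by rewrite addrC subrK.
by apply/andP; split; apply: ltW; near: y; [exact: lt_nbhsr|exact: lt_nbhsl].
Unshelve. all: by end_near. Qed.

(** Adding a linear function of slope [m] makes [f] nondecreasing and [2 * m]-Lipschitz; [|k| + 1]
    is positive whatever the sign of [k]. *)
Lemma lipschitz_ae_derivable (f : R -> R) (k a b : R) : a < b ->
  (forall x y, `|f x - f y| <= k * `|x - y|) ->
  {ae lambda, forall x, a < x < b -> derivable f x 1}.
Proof.
move=> ab fk.
pose m := `|k| + 1; have m0 : 0 < m by rewrite /m ltr_pwDr.
pose g x := f x + m * x.
have := @monotone_lipschitz_ae_derivable g (2 * m) a b ab _ _.
move=> /(_ _ _)/wrap[||].
- by rewrite mulr_gt0.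
- move=> x y xy; have := fk y x; rewrite ler_norml (ger0_norm (_ : 0 <= y - x)) ?subr_ge0//.
  have : k * (y - x) <= m * (y - x).
    by rewrite ler_wpM2r ?subr_ge0// /m (le_trans (ler_norm _))// lerDl.
  rewrite /g; lra.
apply: ae_mono => x /= H xab.
have -> : f = g - (fun y : R => m * y) by apply/funext => y; rewrite /g !fctE addrK.
by apply: derivableB; [exact: H|].
Qed.

End stieltjes.

Section interval_integral.
Context {R : realType}.
Local Notation lambda := (@lebesgue_measure R).
Implicit Types (f F : R -> R) (a b c : R).

(** Not oriented: for [b < a] the interval is empty and the value is 0, not minus the integral over
    [b, a]. *)
Definition intv f a b : R := \int[lambda]_(t in `[a, b]) f t.

Lemma integrable_continuous f a b : continuous f ->
  lambda.-integrable `[a, b] (EFin \o f).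
Proof.
move=> cf; apply: continuous_compact_integrable; first exact: segment_compact.
exact: continuous_subspaceT.
Qed.

Lemma lebesgue_measure_segment a b : a <= b -> lambda `[a, b]%classic = (b - a)%:E.
Proof.
move=> ab; rewrite lebesgue_measure_itv/= lte_fin.
by case: ltgtP ab => // -> _; rewrite subrr.
Qed.

Lemma intv_empty f a b : b < a -> intv f a b = 0.
Proof. by move=> ba; rewrite /intv set_itv_ge ?Rintegral_set0// bnd_simp -ltNge. Qed.

Lemma intvB f a b c : lambda.-integrable `[a, c] (EFin \o f) -> a <= b -> b <= c ->
  intv f a c - intv f a b = intv f b c.
Proof.
move=> intf ab bc; rewrite /intv Rintegral_itvB ?bnd_simp//.
rewrite Rintegral_itv_obnd_cbnd//.
apply: integrableS intf => //.
by apply: subset_itv; rewrite bnd_simp.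
Qed.

Lemma intv_norm_le f a b k : a <= b -> lambda.-integrable `[a, b] (EFin \o f) ->
  (forall t, a <= t <= b -> `|f t| <= k) -> `|intv f a b| <= k * (b - a).
Proof.
move=> ab intf fk; rewrite /intv.
apply: (le_trans (le_normr_Rintegral _ intf)) => //.
have -> : k * (b - a) = \int[lambda]_(t in `[a, b]) k.
  by rewrite Rintegral_cst//= lebesgue_measure_segment.
apply: le_Rintegral => //.
- have /integrable_norm := intf; apply; exact: measurable_itv.
- by apply: integrable_continuous => ?; exact: cvg_cst.
Qed.

Lemma is_derive_continuous f df : (forall x : R, is_derive x (1 : R) f (df x)) -> continuous f.
Proof.
move=> fdf x; apply: differentiable_continuous; apply/derivable1_diffP.
by have ? := fdf x; exact: ex_derive.
Qed.

Lemma intv_FTC2 f F a b : a <= b -> continuous f ->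
  (forall x : R, is_derive x (1 : R) F (f x)) -> intv f a b = F b - F a.
Proof.
move=> ab cf Ff; have [->|neab] := eqVneq a b.
  by rewrite /intv set_itv1 Rintegral_set1 subrr.
have {neab}ab' : a < b by rewrite lt_neqAle neab.
have cF := is_derive_continuous Ff.
rewrite /intv /Rintegral (@continuous_FTC2 _ f F)//.
- exact: continuous_subspaceT.
- split.
  + by move=> x _; have ? := Ff x; exact: ex_derive.
  + exact: cvg_at_right_filter (cF a).
  + exact: cvg_at_left_filter (cF b).
- by move=> x _; have ? := Ff x; rewrite derive1E derive_val.
Qed.

Lemma is_derive_intv f a x : a < x -> continuous f ->
  is_derive x (1 : R) (intv f a) (f x).
Proof.
move=> ax cf.
have x1 : x < x + 1 by rewrite ltrDl.
have [dF FE] := continuous_FTC1_closed x1 (integrable_continuous a (x + 1) cf) ax (cf x).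
apply: DeriveDef; first exact: dF.
by rewrite -FE derive1E.
Qed.

End interval_integral.

(** Since |y - z| <= y + z, every lower bound j y - K y lies below every upper bound j z + K z; the
    supremum of the lower bounds is the limit, with an explicit rate. *)
Lemma one_sided_limit {R : realType} (j : R -> R) (K : R) :
  (forall y z, 0 < y -> 0 < z -> `|j y - j z| <= K * `|y - z|) ->
  exists l, forall y, 0 < y -> `|j y - l| <= K * y.
Proof.
move=> jK.
pose E := [set j y - K * y | y in [set y | 0 < y]].
have K0 : 0 <= K by have := jK 2 1 ltac:(by []) ltac:(by []); have := normr_ge0 (j 2 - j 1);
  rewrite (_ : 2 - 1 = 1 :> R) ?normr1; lra.
have ub y : 0 < y -> ubound E (j y + K * y).
  move=> y0 _ [z /= z0 <-]; have := jK _ _ z0 y0.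
  have : `|z - y| <= z + y by rewrite ler_norml; apply/andP; split; lra.
  move=> h /(fun h' => le_trans h' (ler_wpM2l K0 h)).
  rewrite ler_norml; lra.
exists (sup E) => y y0; rewrite ler_norml; apply/andP; split.
  suff : sup E <= j y + K * y by lra.
  by apply: ge_sup; [exists (j y - K * y); exists y|exact: ub].
suff : j y - K * y <= sup E by lra.
by apply: ub_le_sup; [exists (j y + K * y); exact: ub|exists y].
Qed.

(** Angular limit at the boundary point [x0] of the upper half-plane. The aperture [C] is quantified
    inside, so the limit is the same for all cones with vertex [x0]. *)
Definition cone_limit {R : realType} (f : R -> R -> R) (x0 L : R) :=
  forall C e : R, 0 < C -> 0 < e -> exists2 d : R, 0 < d &
    forall x y, 0 < y < d -> `|x - x0| <= C * y -> `|f x y - L| <= e.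

Lemma lipschitz_within_continuous {R : realType} (f : R * R -> R) (k : R) (D : set (R * R)) :
  (forall z w, D z -> D w -> `|f z - f w| <= k * (`|z.1 - w.1| + `|z.2 - w.2|)) ->
  {within D, continuous f}.
Proof.
move=> fk; apply/subspace_continuousP => z Dz; apply/cvgrPdist_le => e e0.
have K0 : 0 < `|k| + 1 by rewrite ltr_pwDr.
have h0 : 0 < e / (`|k| + 1) / 2 by rewrite !divr_gt0.
rewrite near_withinE; near=> w => Dw.
apply: (le_trans (fk _ _ Dz Dw)).
apply: (@le_trans _ _ ((`|k| + 1) * (`|z.1 - w.1| + `|z.2 - w.2|))).
  by rewrite ler_wpM2r ?addr_ge0// (le_trans (ler_norm _))// lerDl.
rewrite -ler_pdivlMl// mulrC [leRHS]splitr lerD//.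
  by near: w; apply: cvgr_dist_le h0; exact: cvg_fst.
by near: w; apply: cvgr_dist_le h0; exact: cvg_snd.
Unshelve. all: by end_near. Qed.

(** * Fatou's theorem for bounded conjugate pairs *)

Section bounded_conjugate_pair.
Context {R : realType}.
Local Notation lambda := (@lebesgue_measure R).
Variables (A B A1 B1 : R -> R -> R) (M : R).
Hypothesis M0 : 0 < M.
Hypothesis dAx : forall x y : R, 0 < y -> is_derive x (1 : R) (A ^~ y) (A1 x y).
Hypothesis dAy : forall x y : R, 0 < y -> is_derive y (1 : R) (A x) (- B1 x y).
Hypothesis dBx : forall x y : R, 0 < y -> is_derive x (1 : R) (B ^~ y) (B1 x y).
Hypothesis dBy : forall x y : R, 0 < y -> is_derive y (1 : R) (B x) (A1 x y).
Hypothesis A_le : forall x y : R, 0 < y -> `|A x y| <= M.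
Hypothesis B_le : forall x y : R, 0 < y -> `|B x y| <= M.
Hypothesis A1_le : forall x y : R, 0 < y -> `|A1 x y| <= M / y.
Hypothesis B1_le : forall x y : R, 0 < y -> `|B1 x y| <= M / y.
Hypothesis cB1 : forall y : R, 0 < y -> continuous (B1 ^~ y).

(** Horizontal primitive of [A]. By the Cauchy-Riemann equations its [y]-derivative is an increment
    of [B], hence bounded, so it extends to the boundary [y = 0] although [A] itself is not known
    to. *)
Let J a b y := intv (A ^~ y) a b.

Let cA y : 0 < y -> continuous (A ^~ y).
Proof. by move=> y0; apply: (@is_derive_continuous _ _ (A1 ^~ y)) => x; exact: dAx. Qed.

(** Differentiation under the integral sign takes place on []y / 2, y + 1[], where [B1] has the
    constant bound [2 * M / y]. *)
Let dJy (a b y : R) : a <= b -> 0 < y -> is_derive y (1 : R) (J a b) (- (B b y - B a y)).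
Proof.
move=> ab y0.
have I_y : [set` `]y / 2, y + 1[%R] y by rewrite /= in_itv/=; apply/andP; split; lra.
have Ipos z : [set` `]y / 2, y + 1[%R] z -> 0 < z.
  by rewrite /= in_itv/= => /andP[h _]; rewrite (lt_trans _ h)// divr_gt0.
have Ihalf z : [set` `]y / 2, y + 1[%R] z -> M / z <= 2 * M / y.
  move=> Iz; have z0 := Ipos z Iz; move: Iz; rewrite /= in_itv/= => /andP[h _].
  rewrite ler_pdivrMr// mulrAC ler_pdivlMr//.
  have : 0 < M * (z - y / 2) by rewrite mulr_gt0// subr_gt0.
  lra.
have mab : measurable (`[a, b]%classic : set (measurableTypeR R)) by exact: measurable_itv.
have intA z : [set` `]y / 2, y + 1[%R] z ->
    lambda.-integrable (`[a, b]%classic : set (measurableTypeR R)) (EFin \o (fun t => A t z)).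
  by move=> Iz; apply: integrable_continuous; exact/cA/Ipos.
have dA z (t : measurableTypeR R) : [set` `]y / 2, y + 1[%R] z -> `[a, b]%classic t ->
    derivable (fun z => A t z) z 1.
  by move=> /Ipos z0 _; have ? := dAy t z0; exact: ex_derive.
have d1 z t : 0 < z -> partial1of2 (fun z t => A t z) z t = - B1 t z.
  by move=> z0; have ? := dAy t z0; rewrite partial1of2E derive_val.
have G0 (t : measurableTypeR R) : 0 <= 2 * M / y by rewrite !mulr_ge0 ?invr_ge0// ltW.
have intG : lambda.-integrable (`[a, b]%classic : set (measurableTypeR R)) (EFin \o (fun=> 2 * M / y)).
  by apply: integrable_continuous => ?; exact: cvg_cst.
have dG z (t : measurableTypeR R) : [set` `]y / 2, y + 1[%R] z -> `[a, b]%classic t ->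
    `|partial1of2 (fun z t => A t z) z t| <= 2 * M / y.
  move=> Iz _; rewrite d1 ?Ipos// normrN (le_trans _ (Ihalf z Iz))// B1_le//; exact: Ipos.
have der := derivable_under_integral mab I_y intA dA G0 intG dG.
have val := differentiation_under_integral mab I_y intA dA G0 intG dG.
apply: DeriveDef; first exact: der.
rewrite -derive1E val.
transitivity (intv (fun t => - B1 t y) a b).
  by apply: eq_Rintegral => t _; rewrite d1.
have cNB1 : continuous (fun t => - B1 t y) by move=> t; apply: cvgN; exact: cB1.
have dNB (t : R) : is_derive t (1 : R) (fun t => - B t y) (- B1 t y).
  by have ? := dBx t y0; exact: is_deriveN.
by rewrite (intv_FTC2 ab cNB1 dNB) opprB opprK addrC.
Qed.

Let J_lip a b y z : a <= b -> 0 < y -> 0 < z ->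
  `|J a b y - J a b z| <= 2 * M * `|y - z|.
Proof.
move=> ab; wlog yz : y z / z <= y.
  move=> H y0 z0; have [/H|/ltW/H] := leP z y; first exact.
  by rewrite distrC [`|z - y|]distrC; exact.
move=> y0 z0; rewrite [`|y - z|]ger0_norm ?subr_ge0//.
have pos t : z <= t <= y -> 0 < t by move=> /andP[zt _]; exact: lt_le_trans zt.
apply: (@le_norm_MVT _ _ (fun t => - (B b t - B a t)) z y _ yz) => t /pos t0.
  exact: dJy.
rewrite normrN (le_trans (ler_normB _ _))//.
by have := B_le a t0; have := B_le b t0; lra.
Qed.

Let intA (a b y : R) : 0 < y -> lambda.-integrable `[a, b] (EFin \o (A ^~ y)).
Proof. by move=> y0; apply: integrable_continuous; exact: cA. Qed.

Let J_lipx a b b' y : 0 < y -> `|J a b y - J a b' y| <= M * `|b - b'|.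
Proof.
move=> y0; wlog bb' : b b' / b <= b'.
  move=> H; have [/H//|/ltW/H] := leP b b'.
  by rewrite distrC [`|b' - b|]distrC.
rewrite [`|b - b'|]distrC [`|b' - b|]ger0_norm ?subr_ge0//.
have [ab'|b'a] := leP a b'; last first.
  rewrite /J !intv_empty ?(le_lt_trans bb')// subrr normr0 mulr_ge0 ?(ltW M0)//.
  by rewrite subr_ge0.
have [ab|ba] := leP a b.
  rewrite distrC /J (intvB (intA _ _ y0))//; apply: intv_norm_le => //.
    exact: intA.
  by move=> t _; exact: A_le.
rewrite /J (intv_empty _ ba) sub0r normrN.
apply: (@le_trans _ _ (M * (b' - a))).
  apply: intv_norm_le => //; first exact: intA.
  by move=> t _; exact: A_le.
by rewrite ler_pM2l// lerB// ltW.
Qed.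

(** [F] is the boundary function of the primitive. It inherits the Lipschitz constant [M] of [J] in
    [b], as [J] tends to it at the uniform rate [2 * M * y]. *)
Let J_boundary a : exists2 F : R -> R,
  (forall b b', `|F b - F b'| <= M * `|b - b'|) &
  forall b y, 0 < y -> `|J a b y - F b| <= 2 * M * y.
Proof.
have ex b : exists l, forall y, 0 < y -> `|J a b y - l| <= 2 * M * y.
  apply: one_sided_limit => y z y0 z0; have [ab|ba] := leP a b; first exact: J_lip.
  by rewrite /J !intv_empty// subrr normr0 !mulr_ge0// ltW.
have [F FP] := choice ex; exists F; last by move=> b y; exact: FP.
move=> b b'; apply/ler_addgt0Pr => e e0.
pose y := e / (4 * M).
have y0 : 0 < y by rewrite divr_gt0// mulr_gt0.
have ye : 2 * M * y = e / 2 by rewrite /y; field; rewrite gt_eqF.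
have key := J_lipx a b b' y0.
have h1 := FP b y y0; have h2 := FP b' y y0.
rewrite (_ : F b - F b' = (J a b y - J a b' y) - (J a b y - F b) + (J a b' y - F b')); last by ring.
apply: (le_trans (ler_normD _ _)).
have := ler_normB (J a b y - J a b' y) (J a b y - F b).
lra.
Qed.

(** The gradient bound lets [A] vary by at most [s * M / y] on a window of length [s]; windows short
    relative to [y] thus recover the value of [A] from increments of [J]. *)
Let J_avg (a x y s : R) : a <= x -> 0 < s -> 0 < y ->
  `|J a (x + s) y - J a x y - s * A x y| <= s ^+ 2 * (M / y).
Proof.
move=> ax s0 y0; have xs : x <= x + s by rewrite lerDl ltW.
rewrite /J (intvB (intA _ _ y0))//.
have -> : intv (A^~ y) x (x + s) - s * A x y = intv (fun t => A t y - A x y) x (x + s).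
  rewrite /intv RintegralB//; first last.
  - by apply: integrable_continuous => ?; exact: cvg_cst.
  - exact: intA.
  rewrite Rintegral_cst//= lebesgue_measure_segment//= addrAC subrr add0r.
  by rewrite [s * _]mulrC.
apply: (@le_trans _ _ (s * (M / y) * (x + s - x))); last first.
  by rewrite [x + s]addrC addrK expr2 mulrAC.
apply: intv_norm_le => //.
  apply: integrable_continuous => t; apply: cvgB; [exact: cA|exact: cvg_cst].
move=> t /andP[xt ts].
apply: (@le_trans _ _ (M / y * `|t - x|)).
  exact: (le_norm_lip _ _ (fun u => dAx u y0) (fun u => A1_le u y0)).
by rewrite mulrC ler_wpM2r ?divr_ge0 ?(ltW M0) ?(ltW y0)// ger0_norm; lra.
Qed.

Let window_derivable (a s x y : R) : a < x -> 0 < s -> 0 < y ->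
  is_derive x (1 : R) (fun x => J a (x + s) y - J a x y) (A (x + s) y - A x y).
Proof.
move=> ax s0 y0.
have h1 : is_derive x (1 : R) (fun x => J a x y) (A x y).
  exact: is_derive_intv (cA y0).
have h2 : is_derive x (1 : R) (fun x => J a (x + s) y) (A (x + s) y).
  by apply: (is_derive1_shift (f := fun x => J a x y)); apply: is_derive_intv (cA y0); lra.
exact: is_deriveB.
Qed.

(** The base point [a] cancels. The gradient of the increment of [J] consists of the increments of
    [A] and [- B]; as A_x = B_y, the increment is harmonic. *)
Let window_derivabley (a s x y : R) : a <= x -> 0 < s -> 0 < y ->
  is_derive y (1 : R) (fun y => J a (x + s) y - J a x y) (- (B (x + s) y - B x y)).
Proof.
move=> ax s0 y0.
have h1 := dJy ax y0.
have h2 : is_derive y (1 : R) (J a (x + s)) (- (B (x + s) y - B a y)).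
  by apply: dJy => //; lra.
have := is_deriveB h2 h1.
by rewrite (_ : - (B (x + s) y - B a y) - - (B x y - B a y) = - (B (x + s) y - B x y)); last by ring.
Qed.

(* Maximum principle for the harmonic function [J a (x + s) y - J a x y - L * s]:
   the barrier ((x - x0)^2 - y^2 + 2 rho y) / rho^2 is harmonic, nonnegative on the
   box, and at least 1 on its lateral and top sides. *)
Lemma window_estimate (a s L x0 rho p e : R) : a < x0 - rho -> 0 < s -> 0 < p <= rho ->
  `|L| <= M -> 0 <= e ->
  (forall x, x0 - rho <= x <= x0 + rho -> `|J a (x + s) p - J a x p - L * s| <= e) ->
  forall x y, x0 - rho <= x <= x0 + rho -> p <= y <= rho ->
  `|J a (x + s) y - J a x y - L * s| <=
    e + 2 * M * s / rho ^+ 2 * ((x - x0) ^+ 2 - y ^+ 2 + 2 * rho * y).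
Proof.
move=> ax0 s0 /andP[p0 prho] LM e0 bot.
have rho0 : 0 < rho := lt_le_trans p0 prho.
(* Scaled so that the barrier reaches the crude bound [2 * M * s] of [ble] on the top and lateral
   sides; only the bottom side then needs the hypothesis with [e]. *)
pose k := 2 * M * s / rho ^+ 2.
have k0 : 0 < k by rewrite divr_gt0 ?exprn_gt0// !mulr_gt0.
have krho : k * rho ^+ 2 = 2 * M * s by rewrite /k divfK// gt_eqF// exprn_gt0.
have ble x y : x0 - rho <= x <= x0 + rho -> p <= y <= rho ->
    `|J a (x + s) y - J a x y - L * s| <= 2 * M * s.
  move=> /andP[xl xr] /andP[py yr]; have y0 : 0 < y := lt_le_trans p0 py.
  apply: (le_trans (ler_normB _ _)).
  have := J_lipx a (x + s) x y0; rewrite [x + s]addrC addrK (gtr0_norm s0).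
  have : `|L * s| <= M * s by rewrite normrM (gtr0_norm s0) ler_pM2r.
  lra.
(* [sg] is a sign: one run of the maximum principle yields both halves of the absolute value. *)
suff main sg : sg = 1 \/ sg = - 1 -> forall x y, x0 - rho <= x <= x0 + rho -> p <= y <= rho ->
    sg * (J a (x + s) y - J a x y - L * s) -
      k * ((x - x0) ^+ 2 - y ^+ 2 + 2 * rho * y) <= e.
  move=> x y xr yr; rewrite -/k.
  have h1 := main 1 (or_introl erefl) x y xr yr.
  have h2 := main (- 1) (or_intror erefl) x y xr yr.
  by rewrite ler_norml; apply/andP; split; lra.
move=> sgE.
have sgle u c : `|u| <= c -> sg * u <= c.
  by rewrite ler_norml => /andP[? ?]; case: sgE => ->; lra.
pose V (z : R * R) := sg * (J a (z.1 + s) z.2 - J a z.1 z.2 - L * s) -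
   k * ((z.1 - x0) ^+ 2 - z.2 ^+ 2 + 2 * rho * z.2).
have aux (x y : R) : 0 < y -> a < x ->
    is_derive x (1 : R) (fun t => V (t, y)) (sg * (A (x + s) y - A x y) - 2 * k * (x - x0)).
  move=> y0 ax; have h := window_derivable ax s0 y0.
  have h1 : is_derive x (1 : R) (fun t => sg * (J a (t + s) y - J a t y)) (sg * (A (x + s) y - A x y)).
    exact: is_deriveZ.
  have h2 : is_derive x (1 : R) (fun t => - (sg * (L * s)) - k * ((t - x0) ^+ 2 - y ^+ 2 + 2 * rho * y))
    (- (2 * k * (x - x0))).
    by apply: is_derive_eq; rewrite /GRing.scale/=; ring.
  have := is_deriveD h1 h2; congr (is_derive _ _ _ _).
  by apply/funext => t; rewrite /V !fctE/=; ring.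
have auy (x y : R) : 0 < y -> a <= x ->
    is_derive y (1 : R) (fun t => V (x, t)) (sg * - (B (x + s) y - B x y) - k * (2 * rho - 2 * y)).
  move=> y0 ax; have h := window_derivabley ax s0 y0.
  have h1 : is_derive y (1 : R) (fun t => sg * (J a (x + s) t - J a x t)) (sg * - (B (x + s) y - B x y)).
    exact: is_deriveZ.
  have h2 : is_derive y (1 : R) (fun t => - (sg * (L * s)) - k * ((x - x0) ^+ 2 - t ^+ 2 + 2 * rho * t))
    (- (k * (2 * rho - 2 * y))).
    by apply: is_derive_eq; rewrite /GRing.scale/=; ring.
  have := is_deriveD h1 h2; congr (is_derive _ _ _ _).
  by apply/funext => t; rewrite /V !fctE/=; ring.
suff : forall x y, x0 - rho <= x <= x0 + rho -> p <= y <= rho -> V (x, y) <= e by [].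
pose W1 x y := sg * (A (x + s) y - A x y) - 2 * k * (x - x0).
pose W2 x y := sg * - (B (x + s) y - B x y) - k * (2 * rho - 2 * y).
pose W11 x y := sg * (A1 (x + s) y - A1 x y) - 2 * k.
pose W22 x y := sg * - (A1 (x + s) y - A1 x y) + 2 * k.
have h0 : x0 - rho <= x0 + rho by lra.
have cV : {within `[x0 - rho, x0 + rho] `*` `[p, rho], continuous V}.
  have c1 : {within `[x0 - rho, x0 + rho] `*` `[p, rho],
    continuous (fun z : R * R => sg * (J a (z.1 + s) z.2 - J a z.1 z.2 - L * s))}.
    apply: (@lipschitz_within_continuous _ _ (4 * M)) => -[x y] [x' y'] /= [].
    rewrite /= !in_itv/= => /andP[xl xr] /andP[yl yr] [/andP[xl' xr'] /andP[yl' yr']].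
    have y0 : 0 < y := lt_le_trans p0 yl.
    have y0' : 0 < y' := lt_le_trans p0 yl'.
    have e2 : a <= x := ltW (lt_le_trans ax0 xl).
    have e1 : a <= x + s by rewrite (le_trans e2)// lerDl ltW.
    have f1 := J_lip e1 y0 y0'; have f2 := J_lip e2 y0 y0'.
    have f3 := J_lipx a (x + s) (x' + s) y0'; have f4 := J_lipx a x x' y0'.
    rewrite (_ : x + s - (x' + s) = x - x') in f3; last by ring.
    have t1 := le_trans (ler_distD _ _ _) (lerD f1 f3).
    have t2 := le_trans (ler_distD _ _ _) (lerD f2 f4).
    rewrite -mulrBr normrM; have -> : `|sg| = 1 by case: sgE => ->; rewrite ?normrN normr1.
    rewrite mul1r [X in `|X|](_ : _ = (J a (x + s) y - J a (x' + s) y') - (J a x y - J a x' y')); last by ring.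
    apply: (le_trans (ler_normB _ _)); apply: (le_trans (lerD t1 t2)).
    rewrite -subr_ge0 [leRHS](_ : _ = 2 * (M * `|x - x'|)); last by ring.
    by rewrite !mulr_ge0// ltW.
  have c2 : {within `[x0 - rho, x0 + rho] `*` `[p, rho],
    continuous (fun z : R * R => k * ((z.1 - x0) ^+ 2 - z.2 ^+ 2 + 2 * rho * z.2))}.
    apply: continuous_subspaceT => z; apply: cvgM; first exact: cvg_cst.
    apply: cvgD; last by apply: cvgM; [exact: cvg_cst|exact: cvg_snd].
    apply: cvgB; last by apply: cvgM; exact: cvg_snd.
    by apply: cvgM; apply: cvgB; [exact: cvg_fst|exact: cvg_cst|exact: cvg_fst|exact: cvg_cst].
  by move=> z; apply: cvgB; [exact: c1|exact: c2].
have hW1 (x y : R) : x0 - rho < x < x0 + rho -> p < y < rho ->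
    is_derive x (1 : R) (fun t => V (t, y)) (W1 x y).
  by move=> /andP[xl _] /andP[yl _]; apply: aux; [exact: lt_trans yl|exact: lt_trans xl].
have hW2 (x y : R) : x0 - rho < x < x0 + rho -> p < y < rho ->
    is_derive y (1 : R) (fun t => V (x, t)) (W2 x y).
  by move=> /andP[xl _] /andP[yl _]; apply: auy; [exact: lt_trans yl|exact/ltW/(lt_trans ax0)].
have hW11 (x y : R) : x0 - rho < x < x0 + rho -> p < y < rho ->
    is_derive x (1 : R) (W1 ^~ y) (W11 x y).
  move=> _ /andP[py _]; have y0 : 0 < y := lt_trans p0 py.
  have h1 := dAx x y0.
  have h2 : is_derive x (1 : R) (fun x => A (x + s) y) (A1 (x + s) y).
    by apply: (is_derive1_shift (f := A ^~ y)); exact: dAx.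
  have h3 : is_derive x (1 : R) (fun t => - (2 * k * (t - x0))) (- (2 * k)).
    by apply: is_derive_eq; rewrite /GRing.scale/=; ring.
  exact: (is_deriveD (is_deriveZ sg (is_deriveB h2 h1)) h3).
have hW22 (x y : R) : x0 - rho < x < x0 + rho -> p < y < rho ->
    is_derive y (1 : R) (W2 x) (W22 x y).
  move=> _ /andP[py _]; have y0 : 0 < y := lt_trans p0 py.
  have h1 := dBy x y0; have h2 := dBy (x + s) y0.
  have h3 : is_derive y (1 : R) (fun t => - (k * (2 * rho - 2 * t))) (2 * k).
    by apply: is_derive_eq; rewrite /GRing.scale/=; ring.
  exact: (is_deriveD (is_deriveZ sg (is_deriveN (is_deriveB h2 h1))) h3).
have Vbot x : x0 - rho <= x <= x0 + rho -> V (x, p) <= e.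
  move=> xr; rewrite /V/=; have /sgle := bot x xr.
  have : 0 <= k * ((x - x0) ^+ 2 - p ^+ 2 + 2 * rho * p).
    rewrite mulr_ge0 ?(ltW k0)// ; have := sqr_ge0 (x - x0); nra.
  lra.
have Vtop x : x0 - rho <= x <= x0 + rho -> V (x, rho) <= e.
  move=> xr; rewrite /V/=; have /sgle := @ble x rho xr ltac:(lra).
  have : k * rho ^+ 2 <= k * ((x - x0) ^+ 2 - rho ^+ 2 + 2 * rho * rho).
    rewrite ler_wpM2l ?(ltW k0)//; have := sqr_ge0 (x - x0); lra.
  lra.
have Vl y : p <= y <= rho -> V (x0 - rho, y) <= e.
  move=> yr; rewrite /V/=; have /sgle := @ble (x0 - rho) y ltac:(lra) yr.
  have : k * rho ^+ 2 <= k * ((x0 - rho - x0) ^+ 2 - y ^+ 2 + 2 * rho * y).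
    rewrite ler_wpM2l ?(ltW k0)//; move: yr => /andP[? ?]; nra.
  lra.
have Vr y : p <= y <= rho -> V (x0 + rho, y) <= e.
  move=> yr; rewrite /V/=; have /sgle := @ble (x0 + rho) y ltac:(lra) yr.
  have : k * rho ^+ 2 <= k * ((x0 + rho - x0) ^+ 2 - y ^+ 2 + 2 * rho * y).
    rewrite ler_wpM2l ?(ltW k0)//; move: yr => /andP[? ?]; nra.
  lra.
have lapl (x y : R) : x0 - rho < x < x0 + rho -> p < y < rho -> 0 <= W11 x y + W22 x y.
  by move=> _ _; rewrite /W11 /W22; lra.
exact (subharmonic_le_boundary h0 prho cV hW1 hW2 hW11 hW22 Vbot Vtop Vl Vr lapl).
Qed.

(** The value [A x y] is compared with a mean over a window of length [eta * y]. The mean is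
    controlled by the maximum principle from a height [p] so small that [J] is almost [F], whose
    increments near [x0] are almost [L * s]. Relative to [s], the errors are e / 2 for the
    averaging, e / 4 for the barrier and e / 4 for the bottom side. *)
Let cone_limit_at_derivative a F x0 L : a < x0 ->
  (forall b b', `|F b - F b'| <= M * `|b - b'|) ->
  (forall b y, 0 < y -> `|J a b y - F b| <= 2 * M * y) ->
  is_derive x0 (1 : R) F L -> cone_limit A x0 L.
Proof.
move=> ax0 FM JF dF C e C0 e0.
have LM : `|L| <= M.
  apply/ler_addgt0Pr => u u0.
  have [d d0 dP] := is_derive_expansion dF u0.
  have d2 : 0 < d / 2 by rewrite divr_gt0.
  have := dP (d / 2); rewrite (gtr0_norm d2) => /(_ ltac:(lra)).
  have := FM (x0 + d / 2) x0; rewrite [x0 + _]addrC addrK (gtr0_norm d2) => h1 h2.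
  rewrite -(ler_pM2r d2) -[in leLHS](gtr0_norm d2) -normrM.
  rewrite (_ : L * (d / 2) = (F (d / 2 + x0) - F x0) - (F (d / 2 + x0) - F x0 - L * (d / 2))); last by ring.
  apply: (le_trans (ler_normB _ _)); lra.
(* Window length relative to the height: the averaging error s^2 M / y becomes s e / 2. *)
pose eta := e / (2 * M).
have eta0 : 0 < eta by rewrite divr_gt0// mulr_gt0.
have etaM : eta * M = e / 2 by rewrite /eta; field; rewrite gt_eqF.
(* Half-width of the box relative to [y]. The summand [1 + C] keeps the cone point inside the box;
   the last one makes the barrier at that point at most s e / 4. *)
pose K := 1 + C + 8 * M * (C ^+ 2 + 2) / e.
have C2 : 0 < C ^+ 2 + 2 by have := sqr_ge0 C; lra.
have K1 : 1 + C <= K by rewrite /K lerDl divr_ge0 ?(ltW e0)// !mulr_ge0 ?(ltW M0) ?(ltW C2).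
have KM : 2 * M * ((C ^+ 2 + 2) / K) <= e / 4.
  have K0 : 0 < K by lra.
  rewrite mulrA ler_pdivrMr//.
  have : e * K = e * (1 + C) + 8 * M * (C ^+ 2 + 2).
    by rewrite /K mulrDr [e * (_ / e)]mulrC divfK// gt_eqF.
  have : 0 <= e * (1 + C) by rewrite mulr_ge0 ?(ltW e0)//; lra.
  lra.
have K0 : 0 < K by lra.
clearbody K eta.
(* Points of the bottom side and their shifts by [s] are within [rho] and [rho + s] of [x0]; the two
   linearization errors then add up to e s / 8. *)
pose e1 := e * eta / (8 * (2 * K + eta)).
have q0 : 0 < 2 * K + eta by lra.
have e10 : 0 < e1 by apply: divr_gt0; apply: mulr_gt0.
have e1E : e1 * (2 * K + eta) = e * eta / 8.
  by rewrite /e1; field; rewrite gt_eqF.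
have [d d0 dP] := is_derive_expansion dF e10.
exists (Num.min (d / (K + eta)) ((x0 - a) / K)).
  by rewrite lt_min !divr_gt0 ?subr_gt0//; lra.
move=> x y /andP[y0]; rewrite lt_min => /andP[yd ya] xC.
have Ke0 : 0 < K + eta by lra.
move: yd ya; rewrite (ltr_pdivlMr _ _ Ke0) (ltr_pdivlMr _ _ K0) => yd ya.
pose s := eta * y; have s0 : 0 < s by rewrite mulr_gt0.
pose rho := K * y; have rho0 : 0 < rho by rewrite mulr_gt0.
(* At this height each of the two replacements of [J] by [F] costs [2 * M * p], at most e s / 16. *)
pose p := Num.min y (e * s / (32 * M)).
have p0 : 0 < p by rewrite lt_min y0 !divr_gt0 ?mulr_gt0.
have py : p <= y by rewrite ge_min lexx.
have pM : M * p <= e * s / 32.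
  have : p <= e * s / (32 * M) by rewrite ge_min lexx orbT.
  by rewrite ler_pdivlMr ?mulr_gt0//; lra.
have yrho : y <= rho by rewrite /rho ler_peMl// ?(ltW y0)//; lra.
have xr : x0 - rho <= x <= x0 + rho.
  by rewrite -ler_distl (le_trans xC)// /rho ler_pM2r// (le_trans _ K1)// lerDr ler01.
have arho : a < x0 - rho by rewrite /rho [K * y]mulrC; lra.
have bot t : x0 - rho <= t <= x0 + rho -> `|J a (t + s) p - J a t p - L * s| <= e * s / 4.
  move=> /andP[tl tr].
  have h1 := JF (t + s) p p0; have h2 := JF t p p0.
  have t1 : `|t - x0| <= rho by rewrite ler_distl tl tr.
  have t2 : `|t + s - x0| <= rho + s.
    by rewrite addrAC (le_trans (ler_normD _ _))// (gtr0_norm s0) lerD2r.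
  have rs : rho + s < d by rewrite /rho /s -mulrDl mulrC.
  have := dP (t - x0); rewrite (le_lt_trans t1) => [/(_ isT)|]; last by lra.
  have := dP (t + s - x0); rewrite (le_lt_trans t2 rs) => /(_ isT).
  rewrite ![x0 + (_ - x0)]addrC !subrK => f1 f2.
  have g1 : e1 * `|t + s - x0| <= e1 * (rho + s) by rewrite ler_pM2l.
  have g2 : e1 * `|t - x0| <= e1 * rho by rewrite ler_pM2l.
  have g3 : e1 * (rho + s) + e1 * rho = e * s / 8.
    by rewrite /rho /s; transitivity (e1 * (2 * K + eta) * y); [ring|rewrite e1E; ring].
  rewrite (_ : J a (t + s) p - J a t p - L * s = (J a (t + s) p - F (t + s)) - (J a t p - F t)
    + ((F (t + s) - F x0 - L * (t + s - x0)) - (F t - F x0 - L * (t - x0)))); last by ring.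
  apply: (le_trans (ler_normD _ _)).
  have := ler_normB (J a (t + s) p - F (t + s)) (J a t p - F t).
  have := ler_normB (F (t + s) - F x0 - L * (t + s - x0)) (F t - F x0 - L * (t - x0)).
  lra.
have es0 : 0 <= e * s / 4 by rewrite !mulr_ge0// ltW.
have := window_estimate arho s0 _ LM es0 bot xr (y := y).
rewrite p0 (le_trans py yrho) py yrho => /(_ isT isT) est.
have avg := @J_avg a x y s ltac:(lra) s0 y0.
have b1 : s ^+ 2 * (M / y) = s * (e / 2).
  by rewrite -etaM /s; field; rewrite gt_eqF.
have b2 : 2 * M * s / rho ^+ 2 * ((x - x0) ^+ 2 - y ^+ 2 + 2 * rho * y) <= s * (e / 4).
  apply: (@le_trans _ _ (s * (2 * M * ((C ^+ 2 + 2) / K)))); last by rewrite ler_pM2l.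
  have -> : s * (2 * M * ((C ^+ 2 + 2) / K)) =
      2 * M * s / rho ^+ 2 * ((C ^+ 2 + 2) * (K * y ^+ 2)).
    by rewrite /rho; field; rewrite !gt_eqF.
  rewrite -subr_ge0 -mulrBr.
  apply: mulr_ge0.
    by apply/ltW/divr_gt0; [apply: mulr_gt0 => //; exact: mulr_gt0|exact: exprn_gt0].
  have : (x - x0) ^+ 2 <= C ^+ 2 * y ^+ 2.
    by rewrite -exprMn -real_normK ?num_real// ler_sqr ?nnegrE// mulr_ge0 ?(ltW C0) ?(ltW y0).
  have : C ^+ 2 * y ^+ 2 <= C ^+ 2 * y ^+ 2 * K.
    rewrite ler_peMr ?(mulr_ge0 (sqr_ge0 C) (sqr_ge0 y))//.
    by rewrite (le_trans _ K1)// lerDl ltW.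
  have := sqr_ge0 y; rewrite /rho; lra.
rewrite -(ler_pM2l s0) -[in leLHS](gtr0_norm s0) -normrM.
rewrite (_ : s * (A x y - L) = (J a (x + s) y - J a x y - L * s) -
   (J a (x + s) y - J a x y - s * A x y)); last by ring.
apply: (le_trans (ler_normB _ _)); lra.
Qed.

Theorem ae_cone_limit a b : a < b ->
  {ae lambda, forall x, a < x < b -> exists L, cone_limit A x L}.
Proof.
move=> ab; have [F FM JF] := J_boundary a.
have := lipschitz_ae_derivable ab FM; apply: ae_mono => x H xab.
exists ('D_1 F x); apply: (@cone_limit_at_derivative a F) => //.
  by case/andP: xab.
by apply: DeriveDef => //; exact: H.
Qed.

End bounded_conjugate_pair.

(** * Upper density of a finite measure *)

Section upper_density.
Context {R : realType}.
Local Notation lambda := (@lebesgue_measure R).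
Variable mu : {finite_measure set (measurableTypeR R) -> \bar R}.

(** Vitali: the balls of radius r <= 1 and measure above (k + 1) r contain disjoint ones whose
    5-fold enlargements cover all of them. An enlargement has length 10 r, and disjointness bounds
    the sum of the measures of the selected balls by the total mass. *)
Lemma large_density_cover (k : nat) :
  exists2 E : set (measurableTypeR R), measurable E /\ (k.+1%:R%:E * lambda E <= 10%:E * mu setT)%E &
  forall x s : R, 0 < s <= 1 -> (k.+1%:R%:E * s%:E < mu (ball x s))%E -> E x.
Proof.
pose I : Type := (R * {posnum R})%type.
pose B (i : I) : set R := ball i.1 i.2%:num.
pose V : set I := [set i | i.2%:num <= 1 /\ (k.+1%:R%:E * i.2%:num%:E < mu (B i))%E].
have ballB i : is_ball (B i) by exact: is_ball_ball.
have radB i : (radius (B i))%:num = i.2%:num.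
  by rewrite radius_ball.
have rad0 i : 0 < (radius (B i))%:num by rewrite radB.
have radV i : V i -> (radius (B i))%:num <= 1 by rewrite radB => -[].
have [D [cD DV tD covD]] := vitali_lemma_infinite_cover ballB rad0 radV.
(* An injection of the countable index set into [nat] turns the selected balls into a sequence;
   [C n] and [E n] are empty when [n] is not a code. *)
have [f finj] : exists f : I -> nat, {in D &, injective f}.
  by move: cD => /countable_injP[f finj]; exists f.
pose C n : set (measurableTypeR R) := \bigcup_(i in [set i | D i /\ f i = n]) B i.
pose E n : set (measurableTypeR R) := \bigcup_(i in [set i | D i /\ f i = n]) closure (scale_ball 5 (B i)).
have CE n : (C n = set0 /\ E n = set0) \/
    exists i, [/\ D i, f i = n, C n = B i & E n = closed_ball i.1 (5 * i.2%:num)].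
  have [[i [Di fi]]|H] := pselect (exists i, D i /\ f i = n); last first.
    left; split; rewrite -subset0 => x [i Di _]; apply: H; by exists i.
  right; exists i.
  have -> : closed_ball i.1 (5 * i.2%:num) = closure (scale_ball 5 (B i)).
    by rewrite scale_ballE// closure_ballE.
  have uniq j : D j /\ f j = n -> j = i.
    by move=> [Dj fj]; apply: finj; rewrite ?inE// fi fj.
  split=> //; apply/seteqP; split => x.
  - by move=> [j /uniq ->].
  - by move=> Bx; exists i.
  - by move=> [j /uniq ->].
  - by move=> Bx; exists i.
have mC n : measurable (C n).
  by have [[-> _]|[i [_ _ -> _]]] := CE n; [exact: measurable0|exact: measurable_ball].
have mE n : measurable (E n).
  by have [[_ ->]|[i [_ _ _ ->]]] := CE n; [exact: measurable0|exact: measurable_closed_ball].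
have tC : trivIset setT C.
  apply/trivIsetP => m n _ _ mn.
  have [[-> _]|[i [Di fi -> _]]] := CE m; first by rewrite set0I.
  have [[-> _]|[j [Dj fj -> _]]] := CE n; first by rewrite setI0.
  have ij : i != j by apply/eqP => ij; move/eqP: mn; rewrite -fi -fj ij.
  have /trivIsetP/(_ i j Di Dj ij) tij := tD.
  rewrite -subset0 -tij; apply: setISS; exact: subset_closure.
have CEle n : (k.+1%:R%:E * lambda (E n) <= 10%:E * mu (C n))%E.
  have [[-> ->]|[i [Di fi -> ->]]] := CE n; first by rewrite !measure0 !mule0.
  have [i1 ki] := DV _ Di.
  rewrite lebesgue_measure_closed_ball ?mulr_ge0//.
  rewrite (_ : (5 * i.2%:num) *+ 2 = 10 * i.2%:num :> R); last by rewrite -mulr_natr; ring.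
  by rewrite EFinM muleCA lee_pmul2l// ltW.
exists (\bigcup_n E n).
  have mUE : measurable (\bigcup_n E n) by exact: bigcup_measurable.
  split => //.
  apply: (@le_trans _ _ (\sum_(n <oo) (k.+1%:R%:E * lambda (E n)))%E).
    rewrite nneseriesZl// lee_pmul2l//.
    exact: measure_sigma_subadditive.
  apply: (@le_trans _ _ (\sum_(n <oo) (10%:E * mu (C n)))%E).
    by apply: lee_nneseries => n _ //; rewrite mule_ge0.
  rewrite nneseriesZl// lee_pmul2l//.
  have -> : (\sum_(n <oo) mu (C n) = mu (\bigcup_n C n))%E.
    rewrite measure_bigcup//.
    by apply: eq_eseriesl => n; rewrite in_setT.
  by apply: le_measure; rewrite ?inE//; exact: bigcup_measurable.
move=> x s /andP[s0 s1] ks.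
have Vx : V (x, PosNum s0) by [].
have : cover D (closure \o scale_ball 5%:R \o B) x.
  apply: covD; exists (x, PosNum s0) => //=.
  by apply: subset_closure; exact: ballxx.
by move=> [i Di xi]; exists (f i) => //; exists i.
Qed.

(** A point where no [K] works lies in every [E k], and the length of the intersection is at most 10
    mu(R) / (k + 1) for all [k], hence zero because [mu] is finite. *)
Lemma ae_finite_upper_density :
  {ae lambda, forall x, exists2 K : R, 0 < K &
    forall s, 0 < s <= 1 -> (mu (ball x s) <= (K * s)%:E)%E}.
Proof.
have /choice[E EP] : forall k, exists E : set (measurableTypeR R),
    [/\ measurable E, (k.+1%:R%:E * lambda E <= 10%:E * mu setT)%E &
    forall x s : R, 0 < s <= 1 -> (k.+1%:R%:E * s%:E < mu (ball x s))%E -> E x].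
  by move=> k; have [E [? ?] ?] := large_density_cover k; exists E; split.
exists (\bigcap_k E k); split.
- by apply: bigcapT_measurable => k; case: (EP k).
- apply/eqP; rewrite eq_le measure_ge0 andbT.
  have mfin : mu setT \is a fin_num by exact: fin_num_measure.
  have mE : measurable (\bigcap_k E k).
    by apply: bigcapT_measurable => k; case: (EP k).
  have H k : (k.+1%:R%:E * lambda (\bigcap_k E k) <= 10%:E * mu setT)%E.
    have [mEk + _] := EP k; apply: le_trans.
    rewrite lee_pmul2l//; apply: le_measure; rewrite ?inE//.
    exact: bigcap_inf.
  have lfin : lambda (\bigcap_k E k) \is a fin_num.
    rewrite ge0_fin_numE//; have := H 0%N; rewrite mul1e => /le_lt_trans; apply.
    by rewrite ltey_eq fin_numM.
  move: H; rewrite -(fineK lfin) -(fineK mfin) => H.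
  have l0 : 0 <= fine (lambda (\bigcap_k E k)) by exact: fine_ge0.
  rewrite lee_fin leNgt; apply/negP => lpos.
  set l := fine _ in lpos l0 H; set m := fine (mu setT) in H.
  have := H (Num.bound (10 * m / l)); rewrite -!EFinM lee_fin.
  apply/negP; rewrite -ltNge -ltr_pdivrMr//.
  have m0 : 0 <= m by exact: fine_ge0.
  apply: (lt_le_trans (archi_boundP _)); last by rewrite ler_nat.
  by rewrite divr_ge0 ?mulr_ge0.
move=> x /= /forall2NP nx k _.
have [_ _ Ek] := EP k; have [|] := nx k.+1%:R; first by rewrite ltr0n.
move=> /existsNP[s /not_implyP[s01 ks]].
apply: (Ek x s) => //; rewrite ltNge; apply/negP.
by rewrite -EFinM.
Qed.

End upper_density.

(** * Continuity and differentiation under an integral against a finite measure *)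

Section measure_integral.
Context {R : realType}.
Variables (mu : {finite_measure set (measurableTypeR R) -> \bar R}) (D : set (measurableTypeR R)).
Hypothesis mD : measurable D.

Lemma integrable_bounded_continuous (g : R -> R) (k : R) : continuous g ->
  (forall t, `|g t| <= k) -> mu.-integrable D (EFin \o g).
Proof.
move=> cg gk; apply: measurable_bounded_integrable => //.
- by rewrite ltey_eq fin_num_measure.
- by apply: measurable_funTS; exact: continuous_measurable_fun.
- exists k; split; first exact: num_real.
  by move=> M kM t _; apply: (le_trans (gk t)); exact: ltW.
Qed.

Lemma is_derive_Rintegral (f f1 : R -> R -> R) (a u v G : R) : u < a < v ->
  (forall z, u < z < v -> mu.-integrable D (EFin \o f z)) ->
  (forall z t : R, u < z < v -> is_derive z (1 : R) (f ^~ t) (f1 z t)) ->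
  (forall z t, u < z < v -> `|f1 z t| <= G) ->
  is_derive a (1 : R) (fun z => \int[mu]_(t in D) f z t) (\int[mu]_(t in D) f1 a t).
Proof.
move=> auv intf df f1G.
have Ia : [set` `]u, v[%R] a by rewrite /= in_itv.
have d1 z t : u < z < v -> partial1of2 f z t = f1 z t.
  by move=> zuv; have ? := df z t zuv; rewrite partial1of2E derive_val.
have h1 z : [set` `]u, v[%R] z -> mu.-integrable D (EFin \o f z).
  by rewrite /= in_itv; exact: intf.
have h2 z (t : measurableTypeR R) : [set` `]u, v[%R] z -> D t -> derivable (f ^~ t) z 1.
  by rewrite /= in_itv/= => zuv _; have ? := df z t zuv; exact: ex_derive.
have G0 (t : measurableTypeR R) : 0 <= G.
  by rewrite (le_trans _ (f1G a t auv)).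
have h3 : mu.-integrable D (EFin \o (fun=> G)).
  by apply: (@integrable_bounded_continuous _ `|G|) => // ?; exact: cvg_cst.
have h4 z (t : measurableTypeR R) : [set` `]u, v[%R] z -> D t -> `|partial1of2 f z t| <= G.
  by rewrite /= in_itv/= => zuv _; rewrite d1//; exact: f1G.
have der := derivable_under_integral mD Ia h1 h2 G0 h3 h4.
have val := differentiation_under_integral mD Ia h1 h2 G0 h3 h4.
apply: DeriveDef; first exact: der.
rewrite -derive1E val.
by apply: eq_Rintegral => t _; rewrite d1.
Qed.

Lemma continuous_Rintegral (f : R -> R -> R) (G : R) :
  (forall z, continuous (f z)) -> (forall t, continuous (f ^~ t)) ->
  (forall z t, `|f z t| <= G) -> continuous (fun z => \int[mu]_(t in D) f z t).
Proof.
move=> cf1 cf2 fG z.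
have cf : {ae mu, forall y, D y -> {in (`]z - 1, z + 1[%classic : set R), continuous (f ^~ y)}}.
  by apply: aeW => t _ s _; exact: cf2.
have h1 s : (`]z - 1, z + 1[%classic : set R) s -> mu.-integrable D (EFin \o f s).
  by move=> _; apply: integrable_bounded_continuous (fG s).
have h2 s : (`]z - 1, z + 1[%classic : set R) s -> {ae mu, forall y, D y -> `|f s y| <= cst G y}.
  by move=> _; apply: aeW => t _; exact: fG.
have G0 : 0 <= G by rewrite (le_trans _ (fG 0 0)).
have h3 : mu.-integrable D (EFin \o cst G).
  by apply: (@integrable_bounded_continuous _ `|G|) => // ?; exact: cvg_cst.
apply: (continuity_under_integral mD h1 cf h3 h2).
by rewrite inE/= in_itv/=; apply/andP; split; rewrite ?ltrBlDr ltrDl.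
Qed.

End measure_integral.

(** * Potentials of a finite measure *)

Section potentials.
Context {R : realType}.
Local Notation lambda := (@lebesgue_measure R).
Variables (mu : {finite_measure set (measurableTypeR R) -> \bar R}) (D : set (measurableTypeR R)).
Hypothesis mD : measurable D.
Implicit Types x y t : R.

Definition pois_pot x y : R := \int[mu]_(t in D) poisK (x - t) y.
Definition conj_pot x y : R := \int[mu]_(t in D) conjK (x - t) y.
Definition dpois_pot x y : R := \int[mu]_(t in D) dpoisK (x - t) y.
Definition dconj_pot x y : R := \int[mu]_(t in D) dconjK (x - t) y.

Lemma continuous_comp_subl (g : R -> R) x : continuous g -> continuous (fun t => g (x - t)).
Proof.
move=> cg t; apply: (@continuous_comp _ _ _ (fun t => x - t) g); last exact: cg.
by apply: cvgB; [exact: cvg_cst|exact: cvg_id].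
Qed.

Lemma continuous_comp_subr (g : R -> R) t : continuous g -> continuous (fun x => g (x - t)).
Proof.
move=> cg x; apply: (@continuous_comp _ _ _ (fun x => x - t) g); last exact: cg.
by apply: cvgB; [exact: cvg_id|exact: cvg_cst].
Qed.

Lemma continuous_poisKx y : 0 < y -> continuous (@poisK R ^~ y).
Proof. by move=> y0; apply: (@is_derive_continuous _ _ (dpoisK ^~ y)) => x; exact: is_derive_poisKx. Qed.

Lemma continuous_conjKx y : 0 < y -> continuous (@conjK R ^~ y).
Proof. by move=> y0; apply: (@is_derive_continuous _ _ (dconjK ^~ y)) => x; exact: is_derive_conjKx. Qed.

Lemma poisK_ub x y : 0 < y -> `|poisK x y| <= sh y / (ch y - 1).
Proof.
move=> y0; rewrite ger0_norm ?poisK_ge0// ler_pM2l ?sh_gt0//.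
exact: denV_le.
Qed.

Lemma conjK_ub x y : 0 < y -> `|conjK x y| <= (ch y - 1)^-1.
Proof.
move=> y0; rewrite normrM normfV (gtr0_norm (den_gt0 _ y0)) -[leRHS]mul1r.
by apply: ler_pM => //; [rewrite invr_ge0 ltW// den_gt0|exact: sin_max|exact: denV_le].
Qed.

Lemma dpoisK_ub x y : 0 < y -> `|dpoisK x y| <= (ch y - 1)^-1.
Proof. by move=> y0; apply: (le_trans (norm_dpoisK_le _ y0)); exact: denV_le. Qed.

Lemma dconjK_ub x y : 0 < y -> `|dconjK x y| <= (ch y - 1)^-1.
Proof. by move=> y0; apply: (le_trans (norm_dconjK_le _ y0)); exact: denV_le. Qed.

(** Domination on a neighbourhood of [y] for differentiating in [y]: ch z - 1 >= z^2 / 8 >= y^2 /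
    32. *)
Lemma chB1V_le y z : 0 < y -> y / 2 < z -> (ch z - 1)^-1 <= 32 / y ^+ 2.
Proof.
move=> y0 yz; have z0 : 0 <= z by rewrite ltW// (lt_trans _ yz)// divr_gt0.
have h := ch_ge z0.
have p : 0 < y ^+ 2 / 32 by rewrite divr_gt0// exprn_gt0.
rewrite -[leRHS]invrK lef_pV2 ?posrE ?invf_div//; first by nra.
nra.
Qed.

Lemma integrable_poisK x y : 0 < y -> mu.-integrable D (EFin \o (fun t => poisK (x - t) y)).
Proof.
move=> y0; apply: (integrable_bounded_continuous mu mD (k := sh y / (ch y - 1))).
  by apply: (continuous_comp_subl (g := @poisK R ^~ y)); exact: continuous_poisKx.
by move=> t; exact: poisK_ub.
Qed.

Lemma integrable_conjK x y : 0 < y -> mu.-integrable D (EFin \o (fun t => conjK (x - t) y)).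
Proof.
move=> y0; apply: (integrable_bounded_continuous mu mD (k := (ch y - 1)^-1)).
  by apply: (continuous_comp_subl (g := @conjK R ^~ y)); exact: continuous_conjKx.
by move=> t; exact: conjK_ub.
Qed.

Lemma integrable_dpoisK x y : 0 < y -> mu.-integrable D (EFin \o (fun t => dpoisK (x - t) y)).
Proof.
move=> y0; apply: (integrable_bounded_continuous mu mD (k := (ch y - 1)^-1)).
  by apply: (continuous_comp_subl (g := @dpoisK R ^~ y)); exact: continuous_dpoisK.
by move=> t; exact: dpoisK_ub.
Qed.

Lemma integrable_dconjK x y : 0 < y -> mu.-integrable D (EFin \o (fun t => dconjK (x - t) y)).
Proof.
move=> y0; apply: (integrable_bounded_continuous mu mD (k := (ch y - 1)^-1)).
  by apply: (continuous_comp_subl (g := @dconjK R ^~ y)); exact: continuous_dconjK.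
by move=> t; exact: dconjK_ub.
Qed.

Lemma near_self_lt (x : R) : x - 1 < x < x + 1.
Proof. by apply/andP; split; rewrite ?ltrBlDr ltrDl. Qed.

Lemma half_lt_self y : 0 < y -> y / 2 < y < y + 1.
Proof. by move=> y0; apply/andP; split; lra. Qed.

Lemma is_derive_pois_potx x y : 0 < y ->
  is_derive x (1 : R) (pois_pot ^~ y) (dpois_pot x y).
Proof.
move=> y0; apply: (is_derive_Rintegral mD (near_self_lt x) (f := fun x t => poisK (x - t) y) (f1 := fun x t => dpoisK (x - t) y) (G := (ch y - 1)^-1)).
- by move=> z _; exact: integrable_poisK.
- move=> z t _; apply: (is_derive1_shift (f := poisK ^~ y)); exact: is_derive_poisKx.
- by move=> z t _; exact: dpoisK_ub.
Qed.

Lemma is_derive_conj_potx x y : 0 < y ->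
  is_derive x (1 : R) (conj_pot ^~ y) (dconj_pot x y).
Proof.
move=> y0; apply: (is_derive_Rintegral mD (near_self_lt x) (f := fun x t => conjK (x - t) y) (f1 := fun x t => dconjK (x - t) y) (G := (ch y - 1)^-1)).
- by move=> z _; exact: integrable_conjK.
- move=> z t _; apply: (is_derive1_shift (f := conjK ^~ y)); exact: is_derive_conjKx.
- by move=> z t _; exact: dconjK_ub.
Qed.

Lemma is_derive_pois_poty x y : 0 < y ->
  is_derive y (1 : R) (pois_pot x) (- dconj_pot x y).
Proof.
move=> y0.
have -> : - dconj_pot x y = \int[mu]_(t in D) - dconjK (x - t) y.
  rewrite -mulN1r -RintegralZl//; last exact: integrable_dconjK.
  by apply: eq_Rintegral => t _; rewrite mulN1r.
have pos z : y / 2 < z < y + 1 -> 0 < z.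
  by move=> /andP[yz _]; rewrite (lt_trans _ yz)// divr_gt0.
apply: (is_derive_Rintegral mD (half_lt_self y0) (f := fun y t => poisK (x - t) y) (f1 := fun z t => - dconjK (x - t) z) (G := 32 / y ^+ 2)).
- by move=> z /pos z0; exact: integrable_poisK.
- by move=> z t /pos z0; exact: is_derive_poisKy.
- move=> z t zy; rewrite normrN (le_trans (dconjK_ub _ (pos _ zy)))//.
  by case/andP: zy => yz _; exact: chB1V_le.
Qed.

Lemma is_derive_conj_poty x y : 0 < y ->
  is_derive y (1 : R) (conj_pot x) (dpois_pot x y).
Proof.
move=> y0.
have pos z : y / 2 < z < y + 1 -> 0 < z.
  by move=> /andP[yz _]; rewrite (lt_trans _ yz)// divr_gt0.
apply: (is_derive_Rintegral mD (half_lt_self y0) (f := fun y t => conjK (x - t) y) (f1 := fun z t => dpoisK (x - t) z) (G := 32 / y ^+ 2)).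
- by move=> z /pos z0; exact: integrable_conjK.
- by move=> z t /pos z0; exact: is_derive_conjKy.
- move=> z t zy; rewrite (le_trans (dpoisK_ub _ (pos _ zy)))//.
  by case/andP: zy => yz _; exact: chB1V_le.
Qed.

Lemma pois_pot_ge0 x y : 0 < y -> 0 <= pois_pot x y.
Proof. by move=> y0; apply: Rintegral_ge0 => t _; exact: poisK_ge0. Qed.

Lemma norm_Rint_le (g : R -> R) x y : 0 < y -> mu.-integrable D (EFin \o g) ->
  (forall t, `|g t| <= (den (x - t) y)^-1) ->
  `|\int[mu]_(t in D) g t| <= 2 / y * pois_pot x y.
Proof.
move=> y0 ig gd; apply: (le_trans (le_normr_Rintegral mD ig)).
rewrite -RintegralZl//; last exact: integrable_poisK.
apply: le_Rintegral => //.
- exact: integrable_norm.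
- have := integrableZl mD (2 / y) (integrable_poisK x y0).
  by [].
- by move=> t _; rewrite (le_trans (gd t))// denV_le_poisK.
Qed.

Lemma dpois_pot_le x y : 0 < y -> `|dpois_pot x y| <= 2 / y * pois_pot x y.
Proof.
move=> y0; apply: norm_Rint_le => //; first exact: integrable_dpoisK.
by move=> t; exact: norm_dpoisK_le.
Qed.

Lemma dconj_pot_le x y : 0 < y -> `|dconj_pot x y| <= 2 / y * pois_pot x y.
Proof.
move=> y0; apply: norm_Rint_le => //; first exact: integrable_dconjK.
by move=> t; exact: norm_dconjK_le.
Qed.

Lemma continuous_dpois_pot y : 0 < y -> continuous (dpois_pot ^~ y).
Proof.
move=> y0; apply: (continuous_Rintegral mD (f := fun x t => dpoisK (x - t) y) (G := (ch y - 1)^-1)).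
- by move=> z; apply: (continuous_comp_subl (g := @dpoisK R ^~ y)); exact: continuous_dpoisK.
- by move=> z; apply: (continuous_comp_subr (g := @dpoisK R ^~ y)); exact: continuous_dpoisK.
- by move=> z t; exact: dpoisK_ub.
Qed.

Lemma continuous_dconj_pot y : 0 < y -> continuous (dconj_pot ^~ y).
Proof.
move=> y0; apply: (continuous_Rintegral mD (f := fun x t => dconjK (x - t) y) (G := (ch y - 1)^-1)).
- by move=> z; apply: (continuous_comp_subl (g := @dconjK R ^~ y)); exact: continuous_dconjK.
- by move=> z; apply: (continuous_comp_subr (g := @dconjK R ^~ y)); exact: continuous_dconjK.
- by move=> z t; exact: dconjK_ub.
Qed.

(* Real and imaginary parts of the bounded analytic function exp (- (u + i v)). *)
Definition expA x y : R := expR (- pois_pot x y) * cos (conj_pot x y).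
Definition expB x y : R := - (expR (- pois_pot x y) * sin (conj_pot x y)).
Definition dexpA x y : R := expR (- pois_pot x y) *
  (- dpois_pot x y * cos (conj_pot x y) - dconj_pot x y * sin (conj_pot x y)).
Definition dexpB x y : R := expR (- pois_pot x y) *
  (dpois_pot x y * sin (conj_pot x y) - dconj_pot x y * cos (conj_pot x y)).

Lemma is_derive_exp_cos (p q : R -> R) (t dp dq : R) : is_derive t (1 : R) p dp ->
  is_derive t (1 : R) q dq ->
  is_derive t (1 : R) (fun s => expR (- p s) * cos (q s))
    (expR (- p t) * (- dp * cos (q t) - dq * sin (q t))).
Proof.
move=> hp hq; have hN : is_derive t (1 : R) (fun s => - p s) (- dp) by exact: is_deriveN.
have h1 : is_derive t (1 : R) (fun s => expR (- p s)) (expR (- p t) * - dp).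
  exact: (@is_derive1_comp _ expR (fun s => - p s) _ _ _ (is_derive_expR _) hN).
have h2 : is_derive t (1 : R) (fun s => cos (q s)) (- sin (q t) * dq).
  exact: (@is_derive1_comp _ cos q _ _ _ (is_derive_cos _) hq).
have := is_deriveM h1 h2; congr is_derive; rewrite /GRing.scale/=; ring.
Qed.

Lemma is_derive_exp_sin (p q : R -> R) (t dp dq : R) : is_derive t (1 : R) p dp ->
  is_derive t (1 : R) q dq ->
  is_derive t (1 : R) (fun s => - (expR (- p s) * sin (q s)))
    (expR (- p t) * (dp * sin (q t) - dq * cos (q t))).
Proof.
move=> hp hq; have hN : is_derive t (1 : R) (fun s => - p s) (- dp) by exact: is_deriveN.
have h1 : is_derive t (1 : R) (fun s => expR (- p s)) (expR (- p t) * - dp).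
  exact: (@is_derive1_comp _ expR (fun s => - p s) _ _ _ (is_derive_expR _) hN).
have h2 : is_derive t (1 : R) (fun s => sin (q s)) (cos (q t) * dq).
  exact: (@is_derive1_comp _ sin q _ _ _ (is_derive_sin _) hq).
have := is_deriveN (is_deriveM h1 h2); congr is_derive; rewrite /GRing.scale/=; ring.
Qed.

(** The gradient of exp (- (u + i v)) carries the factor u exp (- u) / y, and exp (- p) p <= 1
    absorbs the unbounded [p]. This supplies the derivative bounds required by [ae_cone_limit]. *)
Lemma norm_exp_le (p a b c s y : R) : 0 <= p -> 0 < y -> `|a| <= 2 / y * p -> `|b| <= 2 / y * p ->
  `|c| <= 1 -> `|s| <= 1 -> `|expR (- p) * (a * c + b * s)| <= 4 / y.
Proof.
move=> p0 y0 ha hb hc hs; rewrite normrM (ger0_norm (expR_ge0 _)).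
have pe : expR (- p) * p <= 1.
  by rewrite expRN ler_pdivrMl ?expR_gt0// mulr1 (le_trans _ (expR_ge1Dx _))// lerDr.
have h1 : `|a * c + b * s| <= 4 / y * p.
  apply: (le_trans (ler_normD _ _)); rewrite !normrM.
  have := ler_pM (normr_ge0 _) (normr_ge0 _) ha hc.
  have := ler_pM (normr_ge0 _) (normr_ge0 _) hb hs.
  lra.
apply: (@le_trans _ _ (expR (- p) * (4 / y * p))); first by rewrite ler_pM2l ?expR_gt0.
by rewrite mulrCA ler_piMr// divr_ge0// ltW.
Qed.

Lemma ae_cone_limit_exp a b : a < b ->
  {ae lambda, forall x, a < x < b ->
    (exists L, cone_limit expA x L) /\ (exists L, cone_limit expB x L)}.
Proof.
move=> ab.
have eAx x y : 0 < y -> is_derive x (1 : R) (expA ^~ y) (dexpA x y).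
  by move=> y0; apply: is_derive_exp_cos; [exact: is_derive_pois_potx|exact: is_derive_conj_potx].
have eBx x y : 0 < y -> is_derive x (1 : R) (expB ^~ y) (dexpB x y).
  by move=> y0; apply: is_derive_exp_sin; [exact: is_derive_pois_potx|exact: is_derive_conj_potx].
have eAy x y : 0 < y -> is_derive y (1 : R) (expA x) (- dexpB x y).
  move=> y0; have := is_derive_exp_cos (is_derive_pois_poty x y0) (is_derive_conj_poty x y0).
  by congr is_derive; rewrite /dexpB; ring.
have eBy x y : 0 < y -> is_derive y (1 : R) (expB x) (dexpA x y).
  move=> y0; have := is_derive_exp_sin (is_derive_pois_poty x y0) (is_derive_conj_poty x y0).
  by congr is_derive; rewrite /dexpA; ring.
have e1 x y : 0 < y -> `|expR (- pois_pot x y)| <= 1.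
  by move=> y0; rewrite ger0_norm ?expR_ge0// expR_le1 oppr_le0 pois_pot_ge0.
(* The true bound is 1; 4 is used because a single constant must also serve for the derivatives
   below. *)
have eA x y : 0 < y -> `|expA x y| <= 4.
  move=> y0; rewrite normrM; have := e1 x y y0; have := cos_max (conj_pot x y).
  have := normr_ge0 (cos (conj_pot x y)); have := normr_ge0 (expR (- pois_pot x y)).
  nra.
have eB x y : 0 < y -> `|expB x y| <= 4.
  move=> y0; rewrite normrN normrM; have := e1 x y y0; have := sin_max (conj_pot x y).
  have := normr_ge0 (sin (conj_pot x y)); have := normr_ge0 (expR (- pois_pot x y)).
  nra.
have edA x y : 0 < y -> `|dexpA x y| <= 4 / y.
  move=> y0; rewrite /dexpA -mulrN; apply: norm_exp_le => //.
  - exact: pois_pot_ge0.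
  - by rewrite normrN dpois_pot_le.
  - exact: dconj_pot_le.
  - exact: cos_max.
  - by rewrite normrN sin_max.
have edB x y : 0 < y -> `|dexpB x y| <= 4 / y.
  move=> y0; rewrite /dexpB -mulrN; apply: norm_exp_le => //.
  - exact: pois_pot_ge0.
  - exact: dpois_pot_le.
  - exact: dconj_pot_le.
  - exact: sin_max.
  - by rewrite normrN cos_max.
have cp y : 0 < y -> continuous (pois_pot ^~ y).
  by move=> y0; apply: (@is_derive_continuous _ _ (dpois_pot ^~ y)) => x; exact: is_derive_pois_potx.
have cq y : 0 < y -> continuous (conj_pot ^~ y).
  by move=> y0; apply: (@is_derive_continuous _ _ (dconj_pot ^~ y)) => x; exact: is_derive_conj_potx.
have ce y : 0 < y -> continuous (fun x => expR (- pois_pot x y)).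
  move=> y0 x; apply: (@continuous_comp _ _ _ (fun x => - pois_pot x y) expR); last exact: continuous_expR.
  by apply: cvgN; exact: cp.
have cc y : 0 < y -> continuous (fun x => cos (conj_pot x y)).
  by move=> y0 x; apply: (@continuous_comp _ _ _ (conj_pot ^~ y) cos); [exact: cq|exact: continuous_cos].
have cs y : 0 < y -> continuous (fun x => sin (conj_pot x y)).
  by move=> y0 x; apply: (@continuous_comp _ _ _ (conj_pot ^~ y) sin); [exact: cq|exact: continuous_sin].
have cA y : 0 < y -> continuous (dexpA ^~ y).
  move=> y0 x; apply: cvgM; first exact: ce.
  apply: cvgB; apply: cvgM; [apply: cvgN; exact: continuous_dpois_pot|exact: cc|
    exact: continuous_dconj_pot|exact: cs].
have cB y : 0 < y -> continuous (dexpB ^~ y).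
  move=> y0 x; apply: cvgM; first exact: ce.
  apply: cvgB; apply: cvgM; [exact: continuous_dpois_pot|exact: cs|
    exact: continuous_dconj_pot|exact: cc].
have H1 := ae_cone_limit (ltac:(by []) : 0 < 4 :> R) eAx eAy eBx eBy eA eB edA edB cB ab.
(* Multiplication by - i turns the pair into [expB] and [- expA], again conjugate, so the same
   theorem handles the imaginary part. *)
have H2 : {ae lambda, forall x, a < x < b -> exists L, cone_limit expB x L}.
  have f1 (x y : R) : 0 < y -> is_derive y (1 : R) (expB x) (- - dexpA x y).
    by move=> y0; rewrite opprK; exact: eBy.
  have f2 (x y : R) : 0 < y -> is_derive x (1 : R) (fun x => - expA x y) (- dexpA x y).
    by move=> y0; have ? := eAx x y y0; exact: is_deriveN.
  have f3 (x y : R) : 0 < y -> is_derive y (1 : R) (fun y => - expA x y) (dexpB x y).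
    by move=> y0; rewrite -[dexpB x y]opprK; exact: (is_deriveN (eAy x y y0)).
  have f4 x y : 0 < y -> `|- expA x y| <= 4 by rewrite normrN; exact: eA.
  have f5 x y : 0 < y -> `|- dexpA x y| <= 4 / y by rewrite normrN; exact: edA.
  have f6 y : 0 < y -> continuous (fun x => - dexpA x y).
    by move=> y0 x; apply: cvgN; exact: cA.
  exact: (@ae_cone_limit R expB (fun x y => - expA x y) dexpB (fun x y => - dexpA x y) 4
    (ltac:(by []) : 0 < 4 :> R) eBx f1 f2 f3 eB f4 edB f5 f6 a b ab).
have := ae_and H1 H2; apply: ae_mono => x [h1 h2] xab; split; [exact: h1|exact: h2].
Qed.

End potentials.

(** * Boundedness of the Poisson potential in cones at points of finite upper density *)

Section cone_bound.
Context {R : realType}.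
Variables (mu : {finite_measure set (measurableTypeR R) -> \bar R}).

Lemma integral_le_cst (E : set (measurableTypeR R)) (g : R -> R) (k : R) : measurable E ->
  measurable_fun [set: R] g -> (forall t, 0 <= g t) -> (forall t, E t -> g t <= k) -> 0 <= k ->
  (\int[mu]_(t in E) (g t)%:E <= k%:E * mu E)%E.
Proof.
move=> mE mg g0 gk k0; rewrite -integral_cst//; apply: ge0_le_integral => //.
- by move=> t _; rewrite lee_fin.
- by apply/measurable_EFinP; exact: measurable_funTS.
Qed.

Variables (x0 K : R).
Hypothesis K0 : 0 < K.
Hypothesis muK : forall s, 0 < s -> (mu (ball x0 s) <= (K * s)%:E)%E.

(** Dyadic decomposition: the ball of radius [y] contributes at most K, and the annulus between r =
    2^n y and 2 r at most (y / r^2) (2 K r) = 2 K / 2^n. The right-hand side is the partial sum of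
    this geometric series. *)
Lemma poisson_ball_bound (y : R) (n : nat) : 0 < y ->
  (\int[mu]_(t in ball x0 (2 ^+ n * y)) (y / (y ^+ 2 + (t - x0) ^+ 2))%:E <=
   (K + 4 * K * (1 - (2 ^+ n)^-1))%:E)%E.
Proof.
move=> y0; pose g (t : R) := y / (y ^+ 2 + (t - x0) ^+ 2).
have den0 t : 0 < y ^+ 2 + (t - x0) ^+ 2 by rewrite ltr_pwDl ?exprn_gt0 ?sqr_ge0.
have g0 t : 0 <= g t by rewrite divr_ge0// ltW.
have cg : continuous g.
  move=> t; apply: cvgM; first exact: cvg_cst.
  apply: cvgV; first by rewrite gt_eqF.
  apply: cvgD; first exact: cvg_cst.
  by apply: cvgM; apply: cvgB; [exact: cvg_id|exact: cvg_cst|exact: cvg_id|exact: cvg_cst].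
have mg : measurable_fun [set: R] g by exact: continuous_measurable_fun.
elim: n => [|n IH].
  rewrite expr0 mul1r invr1 subrr mulr0 addr0.
  apply: (le_trans (integral_le_cst _ mg g0 (k := y^-1) _ _)).
  - exact: measurable_ball.
  - move=> t _; rewrite /g ler_pdivrMr// mulrC ler_pdivlMr// -expr2 lerDl.
    exact: sqr_ge0.
  - by rewrite invr_ge0 ltW.
  rewrite -[leRHS]mul1e -(@mulVf _ y) ?gt_eqF// -EFinM.
  have -> : (y^-1 * y * K)%R = y^-1 * (K * y) by ring.
  by rewrite EFinM lee_pmul2l ?lte_fin ?invr_gt0//; exact: muK.
pose r := 2 ^+ n * y; have r0 : 0 < r by rewrite mulr_gt0// exprn_gt0.
have rr : 2 ^+ n.+1 * y = 2 * r by rewrite exprS mulrA.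
rewrite rr.
have sub : ball x0 r `<=` ball x0 (2 * r) by apply: le_ball; lra.
have mB s : measurable (ball x0 s : set (measurableTypeR R)) by exact: measurable_ball.
have -> : ball x0 (2 * r) = ball x0 r `|` (ball x0 (2 * r) `\` ball x0 r).
  by rewrite setDUK.
have mBD : measurable (ball x0 (2 * r) `\` ball x0 r : set (measurableTypeR R)).
  exact: measurableD.
have dB : [disjoint ball x0 r & ball x0 (2 * r) `\` ball x0 r].
  by rewrite disj_set2E setDIK.
have mgU : measurable_fun (ball x0 r `|` (ball x0 (2 * r) `\` ball x0 r) : set (measurableTypeR R)) (EFin \o g).
  by apply/measurable_EFinP; exact: measurable_funTS.
rewrite (ge0_integral_setU _ (mB r) mBD mgU _ dB); last by move=> t _; rewrite lee_fin.
have h2 : (\int[mu]_(t in ball x0 (2 * r) `\` ball x0 r) (g t)%:E <= (y / r ^+ 2 * (K * (2 * r)))%:E)%E.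
  apply: (le_trans (integral_le_cst _ mg g0 (k := y / r ^+ 2) _ _)).
  - exact: measurableD.
  - move=> t [_ /=]; rewrite /ball/= => /negP; rewrite -leNgt => rt.
    rewrite /g ler_pM2l// lef_pV2 ?posrE ?exprn_gt0//.
    have : r ^+ 2 <= (t - x0) ^+ 2.
      by rewrite -[leRHS]real_normK ?num_real// distrC ler_sqr ?nnegrE ?(ltW r0).
    by have := sqr_ge0 y; lra.
  - by rewrite divr_ge0 ?exprn_ge0 ?ltW.
  rewrite [leRHS]EFinM lee_pmul2l ?lte_fin ?divr_gt0 ?exprn_gt0//.
  apply: (le_trans _ (muK _)); last by rewrite mulr_gt0.
  by apply: le_measure; rewrite ?inE//; exact: subDsetl.
apply: (le_trans (leeD IH h2)).
rewrite -EFinD lee_fin.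
have -> : y / r ^+ 2 * (K * (2 * r)) = 2 * K * (2 ^+ n)^-1.
  by rewrite /r; field; rewrite !gt_eqF// exprn_gt0.
rewrite exprS invfM; lra.
Qed.

Variable D : set (measurableTypeR R).
Hypothesis mD : measurable D.
Hypothesis D1 : forall t, D t -> `|t - x0| < 1.

(** In the cone, (t - x0)^2 <= 2 (x - t)^2 + 2 C^2 y^2, so moving the centre from [x] to [x0] costs
    a factor 2 (1 + C^2). Then 160 = 16 * 2 * 5, with 16 from [poisK_le] and 5 from the dyadic
    sum. *)
Lemma pois_pot_cone_bound (C x y : R) : 0 < C -> 0 < y <= 2^-1 -> C * y <= 1 ->
  `|x - x0| <= C * y -> pois_pot mu D x y <= 160 * (1 + C ^+ 2) * K.
Proof.
move=> C0 /andP[y0 y2] Cy xC.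
(* The dyadic ball has radius at least 1 and therefore contains [D]. *)
have [n yn] : exists n, 1 <= 2 ^+ n * y.
  have := archi_boundP (ltW (divr_gt0 ltr01 y0)); set n := Num.bound _ => yn.
  exists n; rewrite -ler_pdivrMr//; apply: (le_trans (ltW yn)).
  by rewrite -natrX ler_nat ltnW// ltn_expl.
pose g (t : R) := y / (y ^+ 2 + (t - x0) ^+ 2).
have den0 t : 0 < y ^+ 2 + (t - x0) ^+ 2 by rewrite ltr_pwDl ?exprn_gt0 ?sqr_ge0.
have g0 t : 0 <= g t by rewrite divr_ge0// ltW.
have cg : continuous g.
  move=> t; apply: cvgM; first exact: cvg_cst.
  apply: cvgV; first by rewrite gt_eqF.
  apply: cvgD; first exact: cvg_cst.
  by apply: cvgM; apply: cvgB; [exact: cvg_id|exact: cvg_cst|exact: cvg_id|exact: cvg_cst].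
have mg : measurable_fun [set: R] g by exact: continuous_measurable_fun.
have Pg t : D t -> poisK (x - t) y <= 32 * (1 + C ^+ 2) * g t.
  move=> /D1 t1.
  have xt : `|x - t| <= 2.
    rewrite (_ : x - t = (x - x0) - (t - x0)); last by ring.
    by apply: (le_trans (ler_normB _ _)); lra.
  apply: (le_trans (poisK_le xt _)); first by rewrite y0.
  rewrite /g mulrA ler_pdivlMr// mulrAC ler_pdivrMr; last first.
    by rewrite ltr_pwDl ?exprn_gt0 ?sqr_ge0.
  have : (t - x0) ^+ 2 <= 2 * (x - t) ^+ 2 + 2 * (C ^+ 2 * y ^+ 2).
    have : (x - x0) ^+ 2 <= C ^+ 2 * y ^+ 2.
      by rewrite -exprMn -real_normK ?num_real// ler_sqr ?nnegrE// mulr_ge0 ?(ltW C0) ?(ltW y0).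
    have := sqr_ge0 ((x - t) + (x - x0)).
    rewrite (_ : t - x0 = (x - x0) - (x - t)); last by ring.
    by set a := x - t; set b := x - x0; lra.
  move=> h.
  have h2 : y ^+ 2 + (t - x0) ^+ 2 <= 2 * (1 + C ^+ 2) * (y ^+ 2 + (x - t) ^+ 2).
    have := sqr_ge0 (x - t); have := sqr_ge0 y; have := sqr_ge0 C.
    have := mulr_ge0 (sqr_ge0 C) (sqr_ge0 (x - t)). lra.
  have := ler_wpM2l (_ : 0 <= 16 * y) h2; rewrite mulr_ge0 ?(ltW y0)// => /(_ isT).
  lra.
have c0 : 0 < 32 * (1 + C ^+ 2) by rewrite mulr_gt0// ltr_pwDl// sqr_ge0.
rewrite /pois_pot /Rintegral -lee_fin fineK; last first.
  by apply: integrable_fin_num => //; exact: integrable_poisK.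
apply: (@le_trans _ _ (\int[mu]_(t in ball x0 (2 ^+ n * y)) (32 * (1 + C ^+ 2) * g t)%:E)%E).
  apply: (@le_trans _ _ (\int[mu]_(t in D) (32 * (1 + C ^+ 2) * g t)%:E)%E).
    apply: ge0_le_integral => //.
    - by move=> t _; rewrite lee_fin poisK_ge0.
    - by have /integrableP[] := integrable_poisK mu mD x y0.
    - by apply/measurable_EFinP/measurable_funM => //; exact: measurable_funTS.
  apply: ge0_subset_integral => //.
  - exact: measurable_ball.
  - by apply/measurable_EFinP/measurable_funM => //; exact: measurable_funTS.
  - by move=> t _; rewrite lee_fin mulr_ge0// ltW.
  - by move=> t /D1 t1; rewrite /ball/= distrC (lt_le_trans t1).
under eq_integral do rewrite EFinM.
rewrite ge0_integralZl//; first last.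
- by rewrite lee_fin ltW.
- by move=> t _; rewrite lee_fin.
- by apply/measurable_EFinP; exact: measurable_funTS.
- exact: measurable_ball.
apply: (@le_trans _ _ ((32 * (1 + C ^+ 2))%:E * (5 * K)%:E)%E).
  rewrite lee_pmul2l//; apply: (le_trans (poisson_ball_bound n y0)).
  rewrite lee_fin; have : 0 < K * (2 ^+ n)^-1 by rewrite mulr_gt0// invr_gt0 exprn_gt0.
  lra.
by rewrite -EFinM lee_fin; lra.
Qed.

End cone_bound.

(** * Limits of the argument *)

Section lifting.
Context {R : realType}.
Local Notation lambda := (@lebesgue_measure R).

(** A continuous function whose increment reached [e] would attain |f s - f a| = e exactly, where
    the cosine is at most 1 - e^2 / 8. Thus closeness modulo 2 pi becomes closeness along a path. *)
Lemma cos_near1_small_increment (f : R -> R) (a b e : R) : a <= b -> 0 < e <= 2 ->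
  {within `[a, b], continuous f} ->
  (forall s, a <= s <= b -> 1 - e ^+ 2 / 8 < cos (f s - f a)) -> `|f b - f a| < e.
Proof.
move=> ab /andP[e0 e2] cf fc; rewrite ltNge; apply/negP => ef.
have cg : {within `[a, b], continuous (fun s => `|f s - f a|)}.
  move=> s; apply: (@continuous_comp _ _ _ (fun s : subspace `[a, b] => f s - f a) Num.norm).
    by apply: cvgB; [exact: cf|exact: cvg_cst].
  exact: norm_continuous.
have [|s] := IVT (v := e) ab cg.
  by rewrite subrr normr0 minEle maxEle normr_ge0 (ltW e0) ef.
rewrite in_itv/= => /fc + fs.
rewrite -cos_norm fs ltNge => /negP; apply.
by have := @sqr_le_1Bcos R e; rewrite (gtr0_norm e0) => /(_ e2); lra.
Qed.

Lemma cauchy_at0 (f : R -> R) :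
  (forall e, 0 < e -> exists2 d, 0 < d & forall y z, 0 < y < d -> 0 < z < d -> `|f y - f z| <= e) ->
  exists L, forall e, 0 < e -> exists2 d, 0 < d & forall y, 0 < y < d -> `|f y - L| <= e.
Proof.
move=> fC.
have : cvg (f @ 0^'+).
  apply/cauchy_cvgP/cauchy_exP => e e0.
  have [d d0 dP] := fC (e / 2) ltac:(lra).
  exists (f (d / 2)); rewrite /fmap/=; near=> y.
  rewrite /ball/= (le_lt_trans (dP (d / 2) y _ _))//; last by lra.
  - by apply/andP; split; lra.
  - by apply/andP; split; near: y; [exact: nbhs_right_gt|exact: nbhs_right_lt].
move=> /cvg_ex[L fL]; exists L => e e0.
move: fL => /cvgrPdist_le /(_ e e0).
rewrite /at_right near_withinE => /nbhs_ballP[d /= d0 H].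
exists d => // y /andP[y0 yd]; rewrite distrC; apply: H => //.
by rewrite /ball/= sub0r normrN gtr0_norm.
Unshelve. all: by end_near. Qed.

Variables (u v v1 v2 : R -> R -> R).
Hypothesis dvx : forall x y : R, 0 < y -> is_derive x (1 : R) (v ^~ y) (v1 x y).
Hypothesis dvy : forall x y : R, 0 < y -> is_derive y (1 : R) (v x) (v2 x y).

(** The limit of exp (- (u + i v)) determines [v] only modulo 2 pi. The ambiguity is removed along
    paths inside the cone: horizontally to the axis above [x0], then vertically along the axis. *)
Lemma cone_limit_lift (x0 : R) :
  (exists L, cone_limit (fun x y => expR (- u x y) * cos (v x y)) x0 L) ->
  (exists L, cone_limit (fun x y => - (expR (- u x y) * sin (v x y))) x0 L) ->
  (forall C : R, 0 < C -> exists U d : R, 0 < d /\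
     forall x y, 0 < y < d -> `|x - x0| <= C * y -> u x y <= U) ->
  exists L, cone_limit v x0 L.
Proof.
move=> [LA hA] [LB hB] ub.
(* cos (v p - v q) is close to 1 on the cone: polarization of |h p - h q|^2, h = exp (- u - i v) *)
have cosP C e : 0 < C -> 0 < e -> exists2 d, 0 < d & forall x y x' y',
    0 < y < d -> 0 < y' < d -> `|x - x0| <= C * y -> `|x' - x0| <= C * y' ->
    1 - e < cos (v x y - v x' y').
  move=> C0 e0; have [U [dU [dU0 uU]]] := ub C C0.
  (* Tolerance for the two limits: the squared distance of two values is at most 8 w^2, and dividing
     by the moduli costs at most exp (2 U). The minimum with 1 gives w^2 <= w. *)
  pose w := Num.min 1 (e / (8 * expR (2 * U))).
  have w0 : 0 < w by rewrite lt_min ltr01 divr_gt0// mulr_gt0// expR_gt0.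
  have w1 : w <= 1 by rewrite ge_min lexx.
  have wU : 8 * expR (2 * U) * w <= e.
    have : w <= e / (8 * expR (2 * U)) by rewrite ge_min lexx orbT.
    by rewrite ler_pdivlMr ?mulr_gt0 ?expR_gt0// mulrC.
  have [dA dA0 HA] := hA C w C0 w0; have [dB dB0 HB] := hB C w C0 w0.
  exists (Num.min dU (Num.min dA dB)); first by rewrite !lt_min dU0 dA0 dB0.
  move=> x y x' y' /andP[y0] + /andP[y0'].
  rewrite !lt_min => /andP[yU /andP[yA yB]] /andP[yU' /andP[yA' yB']] xC xC'.
  have := HA x y; rewrite y0 yA => /(_ isT xC).
  have := HA x' y'; rewrite y0' yA' => /(_ isT xC').
  have := HB x y; rewrite y0 yB => /(_ isT xC).
  have := HB x' y'; rewrite y0' yB' => /(_ isT xC').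
  have := uU x y; rewrite y0 yU => /(_ isT xC).
  have := uU x' y'; rewrite y0' yU' => /(_ isT xC').
  rewrite cosB.
  have := cos2Dsin2 (v x y); have := cos2Dsin2 (v x' y').
  have := expR_gt0 (- u x y); have := expR_gt0 (- u x' y').
  have := expRxMexpNx_1 (u x y); have := expRxMexpNx_1 (u x' y').
  have := expR_gt0 (u x y); have := expR_gt0 (u x' y').
  have eU p : p <= U -> expR p <= expR U by rewrite ler_expR.
  have EU : expR (2 * U) = expR U * expR U by rewrite -expRD; congr expR; lra.
  move: wU; rewrite EU.
  set c := cos (v x y); set s := sin (v x y); set c' := cos (v x' y'); set s' := sin (v x' y').
  move=> wU q0' q0 qp' qp p0' p0 cs' cs /eU Q' /eU Q.
  move: q0' q0 qp' qp p0' p0 Q' Q.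
  set q := expR (u x y); set q' := expR (u x' y').
  set p := expR (- u x y); set p' := expR (- u x' y').
  move=> q0' q0 qp' qp p0' p0 Q' Q.
  rewrite !ler_norml => /andP[b1 b2] /andP[b3 b4] /andP[a1 a2] /andP[a3 a4].
  have dd : (p * c - p' * c') ^+ 2 + (p * s - p' * s') ^+ 2 <= 8 * w ^+ 2.
    have : (p * c - p' * c') ^+ 2 <= (2 * w) ^+ 2.
      rewrite -real_normK ?num_real// ler_sqr ?nnegrE//; last by rewrite mulr_ge0 ?(ltW w0).
      by clear -a1 a2 a3 a4 b1 b2 b3 b4; rewrite ler_norml; apply/andP; split; lra.
    have : (p * s - p' * s') ^+ 2 <= (2 * w) ^+ 2.
      rewrite -real_normK ?num_real// ler_sqr ?nnegrE//; last by rewrite mulr_ge0 ?(ltW w0).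
      by clear -a1 a2 a3 a4 b1 b2 b3 b4; rewrite ler_norml; apply/andP; split; lra.
    lra.
  have qq : q * q' <= expR U * expR U by apply: ler_pM => //; exact: ltW.
  have key : c * c' + s * s' = q * q' * ((p ^+ 2 * (c ^+ 2 + s ^+ 2) + p' ^+ 2 * (c' ^+ 2 + s' ^+ 2)
      - ((p * c - p' * c') ^+ 2 + (p * s - p' * s') ^+ 2)) / 2).
    transitivity ((q * p) * (q' * p') * (c * c' + s * s')); first by rewrite qp qp' !mul1r.
    by field.
  rewrite key cs cs' !mulr1.
  have h1 : 1 <= q * q' * ((p ^+ 2 + p' ^+ 2) / 2).
    have h : q * q' * (p * p') = 1 by rewrite mulrACA qp qp' mulr1.
    have h2 : q * q' * (p * p') <= q * q' * ((p ^+ 2 + p' ^+ 2) / 2).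
      by rewrite ler_pM2l ?mulr_gt0//; have := sqr_ge0 (p - p'); lra.
    by rewrite h in h2.
  have ww : w ^+ 2 <= w by rewrite expr2 ler_piMl// ltW.
  have EE : 0 < expR U * expR U by rewrite mulr_gt0 ?expR_gt0.
  have h2 : q * q' * (((p * c - p' * c') ^+ 2 + (p * s - p' * s') ^+ 2) / 2) <=
     expR U * expR U * (4 * w).
    apply: ler_pM => //; [by rewrite mulr_ge0// ltW|by rewrite divr_ge0// addr_ge0 ?sqr_ge0|].
    move: dd ww; clear; set r := _ ^+ 2 + _ ^+ 2; lra.
  have h3 : 0 < expR U * expR U * w by rewrite mulr_gt0.
  move: h1 h2 h3 wU; clear; set r := _ ^+ 2 + _ ^+ 2; lra.
(* Horizontal leg: points between [x0] and [x] at height [y] are closer to the axis than [x], so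
   they stay in the cone. *)
have legx C e : 0 < C -> 0 < e <= 2 -> exists2 d, 0 < d & forall x y,
    0 < y < d -> `|x - x0| <= C * y -> `|v x y - v x0 y| <= e.
  move=> C0 /andP[e0 e2]; have [d d0 dP] := cosP C (e ^+ 2 / 8) C0 ltac:(by rewrite divr_gt0// exprn_gt0).
  exists d => // x y yd xC; have y0 : 0 < y by case/andP: yd.
  have Cy : 0 <= C * y by rewrite mulr_ge0// ltW.
  have cv : continuous (v ^~ y).
    by apply: (@is_derive_continuous _ _ (v1 ^~ y)) => t; exact: dvx.
  have [xx|xx] := leP x0 x.
    apply/ltW/(cos_near1_small_increment (f := v ^~ y) xx); first by rewrite e0.
      exact: continuous_subspaceT.
    move=> s /andP[s0 sx]; apply: dP => //; last by rewrite subrr normr0.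
    by rewrite (le_trans _ xC)// !ger0_norm ?subr_ge0// lerB.
  rewrite distrC.
  apply/ltW/(cos_near1_small_increment (f := v ^~ y) (ltW xx)); first by rewrite e0.
    exact: continuous_subspaceT.
  move=> s /andP[s0 sx]; apply: dP => //.
  apply: (le_trans _ xC); rewrite ![`|_ - x0|]distrC !ger0_norm ?subr_ge0 ?(ltW xx)//.
  by rewrite lerB.
have [|L HL] := @cauchy_at0 (v x0).
  move=> e e0; pose e' := Num.min e 2.
  have e'0 : 0 < e' by rewrite lt_min e0 ltr0n.
  have e'2 : e' <= 2 by rewrite ge_min lexx orbT.
  have e'e : e' <= e by rewrite ge_min lexx.
  (* Vertical leg: the axis lies in every cone, so aperture 1 is enough. *)
  have [d d0 dP] := cosP 1 (e' ^+ 2 / 8) ltr01 ltac:(by rewrite divr_gt0// exprn_gt0).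
  exists d => // y z; wlog yz : y z / z <= y.
    move=> H yd zd; have [/H|/ltW/H] := leP z y; first exact.
    by rewrite distrC; exact.
  move=> yd zd; have z0 : 0 < z by case/andP: zd.
  have pos t : z <= t <= y -> 0 < t by move=> /andP[zt _]; exact: lt_le_trans zt.
  have cv : {within `[z, y], continuous (v x0)}.
    apply: derivable_within_continuous => t; rewrite in_itv/= => /pos t0.
    by have ? := dvy x0 t0; exact: ex_derive.
  apply: le_trans e'e; apply/ltW/(cos_near1_small_increment yz) => //; first by rewrite e'0.
  move=> s /[dup] zs /pos s0; apply: dP => //.
  - by rewrite s0 /=; case/andP: zs => _ sy; case/andP: yd => _; exact: le_lt_trans.
  - by rewrite subrr normr0 mul1r ltW.
  - by rewrite subrr normr0 mul1r ltW.
exists L => C e C0 e0; pose e' := Num.min (e / 2) 2.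
have e'0 : 0 < e' by rewrite lt_min divr_gt0 ?ltr0n.
have e'2 : e' <= 2 by rewrite ge_min lexx orbT.
have e'e : e' <= e / 2 by rewrite ge_min lexx.
have [d1 d10 H1] := legx C e' C0 ltac:(by rewrite e'0).
have [d2 d20 H2] := HL e' e'0.
exists (Num.min d1 d2); first by rewrite lt_min d10.
move=> x y /andP[y0]; rewrite lt_min => /andP[yd1 yd2] xC.
have := H1 x y; rewrite y0 yd1 => /(_ isT xC) h1.
have := H2 y; rewrite y0 yd2 => /(_ isT) h2.
rewrite (_ : v x y - L = (v x y - v x0 y) + (v x0 y - L)); last by ring.
apply: (le_trans (ler_normD _ _)); lra.
Qed.

End lifting.

Section conjugate_potential.
Context {R : realType}.
Local Notation lambda := (@lebesgue_measure R).

Theorem ae_cone_limit_conj_pot (mu : {finite_measure set (measurableTypeR R) -> \bar R}) (c d : R) :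
  c < d -> d - c <= 1 ->
  {ae lambda, forall x, c < x < d -> exists L, cone_limit (conj_pot mu `]c, d]%classic) x L}.
Proof.
move=> cd cd1.
pose D : set (measurableTypeR R) := `]c, d]%classic.
have mD : measurable D by exact: measurable_itv.
have := ae_and (ae_cone_limit_exp mu mD cd) (ae_finite_upper_density mu).
apply: ae_mono => x [H [K K0 HK]] xcd.
have [hA hB] := H xcd.
apply: (@cone_limit_lift _ (pois_pot mu D) (conj_pot mu D) (dconj_pot mu D) (dpois_pot mu D)) => //.
- by move=> s y y0; exact: is_derive_conj_potx.
- by move=> s y y0; exact: is_derive_conj_poty.
move=> C C0.
have mfin : mu setT \is a fin_num by exact: fin_num_measure.
(* The density bound is known for radii up to 1 only. Adding the total mass extends it to all radii,
   since mu(R) <= mu(R) s for s >= 1. *)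
pose K' := K + fine (mu setT).
have m0 : 0 <= fine (mu setT) by exact: fine_ge0.
have K'0 : 0 < K' by rewrite ltr_pwDl.
have HK' s : 0 < s -> (mu (ball x s) <= (K' * s)%:E)%E.
  move=> s0; have [s1|s1] := leP s 1.
    apply: (le_trans (HK s _)); first by rewrite s0.
    by rewrite lee_fin ler_pM2r// lerDl.
  apply: (@le_trans _ _ (mu setT)).
    by apply: le_measure; rewrite ?inE//; exact: measurable_ball.
  rewrite -(fineK mfin) lee_fin.
  apply: (@le_trans _ _ (fine (mu setT) * s)); first by rewrite ler_peMr// ltW.
  by rewrite ler_pM2r// lerDr ltW.
have D1 t : D t -> `|t - x| < 1.
  rewrite /D/= in_itv/= => /andP[ct td]; case/andP: xcd => cx xd.
  by rewrite ltr_norml; apply/andP; split; lra.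
exists (160 * (1 + C ^+ 2) * K'), (Num.min 2^-1 C^-1); split.
  by rewrite lt_min !invr_gt0 ltr0n.
move=> s y /andP[y0]; rewrite lt_min => /andP[y2 yC] sC.
apply: (pois_pot_cone_bound K'0 HK' mD D1 C0 _ _ sC).
  by rewrite y0 ltW.
by rewrite mulrC -ler_pdivlMr// mul1r ltW.
Qed.

End conjugate_potential.

(** * Riemann-Stieltjes integration by parts *)

Section oscillation.
Context {R : realType}.
Local Notation lambda := (@lebesgue_measure R).
Implicit Types (F : R -> R) (s t r k : R).

Definition ball_sup F r s : R := sup [set F t | t in ball s r].

Lemma ball_sup_has_sup F k r s : (forall t, `|F t| <= k) -> 0 < r ->
  has_sup [set F t | t in ball s r].
Proof.
move=> Fk r0; split; first by exists (F s), s => //; exact: ballxx.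
by exists k => _ [t _ <-]; rewrite (le_trans (ler_norm _)).
Qed.

Lemma le_ball_sup F k r s t : (forall t, `|F t| <= k) -> 0 < r -> ball s r t -> F t <= ball_sup F r s.
Proof.
move=> Fk r0 st; apply: ub_le_sup; last by exists t.
by case: (ball_sup_has_sup s Fk r0).
Qed.

Lemma ball_sup_le F k r s e : (forall t, `|F t| <= k) -> 0 < r ->
  (forall t, ball s r t -> F t <= e) -> ball_sup F r s <= e.
Proof.
move=> Fk r0 H; apply: ge_sup; first by case: (ball_sup_has_sup s Fk r0).
by move=> _ [t /H + <-].
Qed.

(** The balls are open, so the supremum is lower semicontinuous in the centre, even for a bounded
    [F] not known to be measurable. *)
Lemma measurable_ball_sup F k r : (forall t, `|F t| <= k) -> 0 < r ->
  measurable_fun [set: R] (ball_sup F r).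
Proof.
move=> Fk r0; apply/measurable_EFinP; apply: lower_semicontinuous_measurable.
move=> s a; rewrite lte_fin => aS.
have [_ [t st <-] aF] := sup_gt (proj1 (ball_sup_has_sup s Fk r0)) aS.
exists (ball t r); first by apply: open_nbhs_nbhs; split; [exact: ball_open|exact: ball_sym].
move=> s' ts'; rewrite lte_fin (lt_le_trans aF)//.
by apply: (le_ball_sup Fk r0); exact: ball_sym.
Qed.

(** Supremum minus infimum over the ball, the infimum being written as minus the supremum of
    [- F]. *)
Definition ball_osc F r s : R := ball_sup F r s + ball_sup (fun t => - F t) r s.

Variables (Phi : R -> R) (B : R) (N : set R).
Hypothesis PhiB : forall t, `|Phi t| <= B.
Hypothesis cN : countable N.
Hypothesis cPhi : forall t, ~ N t -> {for t, continuous Phi}.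

Let NPhiB t : `|- Phi t| <= B. Proof. by rewrite normrN. Qed.

Lemma ball_osc_ge r s t : 0 < r -> ball s r t -> `|Phi t - Phi s| <= ball_osc Phi r s.
Proof.
move=> r0 st; have ss : ball s r s by exact: ballxx.
have h1 := le_ball_sup PhiB r0 st; have h2 := le_ball_sup PhiB r0 ss.
have h3 := le_ball_sup NPhiB r0 st; have h4 := le_ball_sup NPhiB r0 ss.
by rewrite ler_norml /ball_osc; apply/andP; split; lra.
Qed.

Lemma ball_osc_ge0 r s : 0 < r -> 0 <= ball_osc Phi r s.
Proof. by move=> r0; rewrite (le_trans _ (ball_osc_ge r0 (ballxx s r0))). Qed.

Lemma ball_osc_le r s : 0 < r -> ball_osc Phi r s <= 2 * B.
Proof.
move=> r0; have h1 : ball_sup Phi r s <= B.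
  by apply: (ball_sup_le PhiB r0) => t _; rewrite (le_trans (ler_norm _)).
have h2 : ball_sup (fun t => - Phi t) r s <= B.
  by apply: (ball_sup_le NPhiB r0) => t _; rewrite (le_trans (ler_norm _)).
rewrite /ball_osc; lra.
Qed.

Lemma measurable_ball_osc r : 0 < r -> measurable_fun [set: R] (ball_osc Phi r).
Proof.
by move=> r0; apply: measurable_funD; [exact: measurable_ball_sup PhiB r0|exact: measurable_ball_sup NPhiB r0].
Qed.

Lemma ball_osc_small s e : ~ N s -> 0 < e -> exists2 d : R, 0 < d &
  forall r, 0 < r <= d -> ball_osc Phi r s <= e.
Proof.
move=> /cPhi cs e0; have e2 : 0 < e / 2 by rewrite divr_gt0.
move: cs => /cvgrPdist_le /(_ _ e2)/nbhs_ballP[d /= d0 H].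
exists d => // r /andP[r0 rd].
have H' t : ball s r t -> `|Phi s - Phi t| <= e / 2 by move=> st; apply: H; exact: le_ball st.
have h1 : ball_sup Phi r s <= Phi s + e / 2.
  by apply: (ball_sup_le PhiB r0) => t /H'; rewrite ler_norml => /andP[? ?]; lra.
have h2 : ball_sup (fun t => - Phi t) r s <= - Phi s + e / 2.
  by apply: (ball_sup_le NPhiB r0) => t /H'; rewrite ler_norml => /andP[? ?]; lra.
rewrite /ball_osc; lra.
Qed.

Let mN : measurable N.
Proof. by apply: countable_measurable => // t; exact: measurable_set1. Qed.

(** Off [N] the function is the pointwise limit of the measurable [ball_sup] with radii 1 / (n + 1);
    on the countable [N] every function is measurable. *)
Lemma measurable_countable_discontinuity : measurable_fun [set: R] Phi.
Proof.
rewrite -(setUv N); apply/measurable_funU => //; first exact: measurableC.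
split.
  move=> _ Y mY; apply: countable_measurable; first by move=> t; exact: measurable_set1.
  by apply: sub_countable cN; apply: subset_card_le; exact: subIsetl.
have H n : measurable_fun (~` N) (ball_sup Phi n.+1%:R^-1).
  by apply: measurable_funTS; apply: (measurable_ball_sup PhiB); rewrite invr_gt0 ltr0n.
apply: (measurable_fun_cvg H) => s Ns.
apply/cvgrPdist_le => e e0.
have [d d0 dP] := ball_osc_small Ns e0.
near=> n.
have rn : 0 < n.+1%:R^-1 :> R by rewrite invr_gt0 ltr0n.
have rd : n.+1%:R^-1 <= d.
  near: n; by apply: filterS (near_infty_natSinv_lt (PosNum d0)) => n; exact: ltW.
have := dP _ (introT andP (conj rn rd)).
have h1 := le_ball_sup PhiB rn (ballxx s rn).
have h2 := le_ball_sup NPhiB rn (ballxx s rn).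
rewrite /ball_osc distrC ger0_norm ?subr_ge0//; lra.
Unshelve. all: by end_near. Qed.

Lemma integrable_bounded (f : R -> R) (k a b : R) : measurable_fun [set: R] f ->
  (forall t, `|f t| <= k) -> lambda.-integrable `[a, b] (EFin \o f).
Proof.
move=> mf fk; apply: measurable_bounded_integrable => //.
- by rewrite /= lebesgue_measure_itv; case: ifP => _; rewrite ?ltry.
- exact: measurable_funTS.
- exists k; split; first exact: num_real.
  by move=> M kM t _; apply: (le_trans (fk t)); exact: ltW.
Qed.

Lemma osc_norm_le r s : 0 < r -> `|ball_osc Phi r s| <= 2 * B.
Proof. by move=> r0; rewrite ger0_norm ?ball_osc_ge0// ball_osc_le. Qed.

(** Lebesgue's integrability criterion in integrated form: the oscillation is at most [2 * B] and
    tends to 0 off the null set [N], so dominated convergence applies. *)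
Lemma integral_osc_small (a b e : R) : 0 < e -> exists2 r : R, 0 < r &
  intv (ball_osc Phi r) a b < e.
Proof.
move=> e0; pose r (n : nat) : R := n.+1%:R^-1.
have r0 n : 0 < r n by rewrite invr_gt0 ltr0n.
suff H : intv (ball_osc Phi (r n)) a b @[n --> \oo] --> 0.
  have /cvgrPdist_lt/(_ e e0)[n _ /(_ n (leqnn n)) Hn] := H.
  exists (r n) => //; move: Hn; rewrite sub0r normrN; exact: le_lt_trans (ler_norm _).
have mab : measurable (`[a, b]%classic : set (measurableTypeR R)) by exact: measurable_itv.
have := @dominated_convergence _ _ _ lambda `[a, b]%classic mab
  (fun n s => (ball_osc Phi (r n) s)%:E) (cst 0%E) (fun=> (2 * B)%:E).
case.
- move=> n; apply/measurable_EFinP; apply: measurable_funTS; exact: measurable_ball_osc.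
- exact: measurable_cst.
- exists N; split => //; first exact: countable_lebesgue_measure0.
  move=> s /= /not_implyP[_ ns]; apply: contrapT => Ns; apply: ns.
  apply: cvg_EFin; first exact: nearW.
  apply/cvgrPdist_le => u u0; have [d d0 dP] := ball_osc_small Ns u0.
  near=> n; rewrite sub0r normrN /= ger0_norm ?ball_osc_ge0//; apply: dP; rewrite r0/=.
  near: n; by apply: filterS (near_infty_natSinv_lt (PosNum d0)) => n; exact: ltW.
- by have := @integrable_bounded (cst (2 * B)) `|2 * B| a b (measurable_cst _) (fun=> lexx _).
- by apply: aeW => s n _; rewrite lee_fin osc_norm_le.
move=> _ _ /=; rewrite integral_cst// mul0e => H.
exact: fine_cvg H.
Unshelve. all: by end_near. Qed.

Variables (g g1 : R -> R) (k : R).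
Hypothesis dg : forall s, is_derive s (1 : R) g (g1 s).
Hypothesis cg1 : continuous g1.
Hypothesis g1k : forall s, `|g1 s| <= k.

Let mPhi := measurable_countable_discontinuity.

Let k0 : 0 <= k. Proof. exact: (le_trans (normr_ge0 _) (g1k 0)). Qed.

Lemma integrable_Phi_g1 a b : lambda.-integrable `[a, b] (EFin \o (fun s => Phi s * g1 s)).
Proof.
apply: (@integrable_bounded _ (B * k)).
  by apply: measurable_funM => //; exact: continuous_measurable_fun.
by move=> t; rewrite normrM ler_pM.
Qed.

Let integrable_osc r a b : 0 < r -> lambda.-integrable `[a, b] (EFin \o ball_osc Phi r).
Proof. by move=> r0; apply: (integrable_bounded _ _ (measurable_ball_osc r0)) => t; exact: osc_norm_le. Qed.

Let piece_estimate a b c r : a <= b -> 0 < r -> (forall s, a <= s <= b -> ball s r c) ->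
  `|Phi c * (g b - g a) - intv (fun s => Phi s * g1 s) a b| <= k * intv (ball_osc Phi r) a b.
Proof.
move=> ab r0 sc.
have ig1 : lambda.-integrable `[a, b] (EFin \o g1) by exact: integrable_continuous.
have ig1' : lambda.-integrable `[a, b] (EFin \o (fun s => Phi c * g1 s)).
  by apply: integrable_continuous => s; apply: cvgM; [exact: cvg_cst|exact: cg1].
rewrite -(intv_FTC2 ab cg1 dg) /intv -RintegralZl// -RintegralB//; last exact: integrable_Phi_g1.
have id : lambda.-integrable `[a, b] (EFin \o (fun s => Phi c * g1 s - Phi s * g1 s)).
  apply: (@integrable_bounded _ (2 * B * k)).
    apply: measurable_funB; apply: measurable_funM => //; exact: continuous_measurable_fun.
  move=> t; rewrite -mulrBl normrM ler_pM//.
  by apply: (le_trans (ler_normB _ _)); have := PhiB c; have := PhiB t; lra.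
apply: (le_trans (le_normr_Rintegral _ id)) => //.
rewrite -RintegralZl//; last exact: integrable_osc.
apply: le_Rintegral => //.
- exact: integrable_norm.
- apply: (@integrable_bounded (fun s => k * ball_osc Phi r s) (k * (2 * B))).
    by apply: measurable_funM => //; exact: measurable_ball_osc.
  by move=> t; rewrite normrM (ger0_norm k0) ler_wpM2l// osc_norm_le.
- move=> s; rewrite /= in_itv/= => sab; rewrite -mulrBl normrM mulrC.
  by apply: ler_pM => //; exact/ball_osc_ge/sc.
Qed.

(** Abel summation with each interval cut at its tag [tau]: the Stieltjes sum becomes the boundary
    terms minus a sum that takes [Phi] at the left end on [t k, tau k] and at the right end on
    [tau k, t k.+1]. Replacing [Phi] by these values costs [k] times the integral of its
    oscillation, so no variation of [Phi] enters. *)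
Theorem is_RS_integral_by_parts a b : a <= b ->
  is_RS_integral g Phi a b (g b * Phi b - g a * Phi a - intv (fun s => Phi s * g1 s) a b).
Proof.
move=> ab e e0.
have [|r r0 re] := @integral_osc_small a b (e / (k + 1)); first by rewrite divr_gt0// ltr_wpDl.
exists r => // p t tau t0 tp ttau tr.
have tS i : (i < p)%N -> t i <= t i.+1.
  by move=> ip; have /andP[h1 h2] := ttau i ip; exact: le_trans h2.
have ta n : (n <= p)%N -> a <= t n.
  elim: n => [|n IH] np; first by rewrite t0.
  exact: le_trans (IH (ltnW np)) (tS _ np).
have add (f : R -> R) n : (forall c d, lambda.-integrable `[c, d] (EFin \o f)) -> (n < p)%N ->
    intv f a (t n.+1) = intv f a (t n) + intv f (t n) (tau n) + intv f (tau n) (t n.+1).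
  move=> intf np; have /andP[h1 h2] := ttau n np.
  have an := ta n (ltnW np).
  rewrite -(intvB (intf a (t n.+1)) (le_trans an h1) h2).
  rewrite -(intvB (intf a (tau n)) an h1); ring.
have key n : (n <= p)%N ->
   `|\sum_(i < n) g (tau i) * (Phi (t i.+1) - Phi (t i)) -
     (g (t n) * Phi (t n) - g a * Phi a - intv (fun s => Phi s * g1 s) a (t n))|
   <= k * intv (ball_osc Phi r) a (t n).
  elim: n => [|n IH] np.
    by rewrite big_ord0 t0 /intv set_itv1 !Rintegral_set1 mulr0 !subrr normr0.
  rewrite big_ord_recr/= (add _ n (integrable_Phi_g1) np).
  rewrite (add _ n (fun c d => integrable_osc c d r0) np).
  have /andP[h1 h2] := ttau n np; have hr := tr n np.
  have p1 := @piece_estimate (t n) (tau n) (t n) r h1 r0.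
  have p2 := @piece_estimate (tau n) (t n.+1) (t n.+1) r h2 r0.
  have {}p1 := p1 ltac:(by move=> s /andP[s1 s2]; rewrite /ball/= ger0_norm ?subr_ge0//; lra).
  have {}p2 := p2 ltac:(by move=> s /andP[s1 s2]; rewrite /ball/= ler0_norm ?subr_le0//; lra).
  have {}IH := IH (ltnW np).
  move: IH p1 p2.
  set S := \sum_(i < n) _; set I0 := intv _ a (t n); set I1 := intv _ (t n) (tau n).
  set I2 := intv _ (tau n) (t n.+1).
  set O0 := intv _ a (t n); set O1 := intv _ (t n) (tau n); set O2 := intv _ (tau n) (t n.+1).
  move=> IH p1 p2.
  have -> : S + g (tau n) * (Phi (t n.+1) - Phi (t n)) -
     (g (t n.+1) * Phi (t n.+1) - g a * Phi a - (I0 + I1 + I2)) =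
     (S - (g (t n) * Phi (t n) - g a * Phi a - I0)) -
     ((Phi (t n) * (g (tau n) - g (t n)) - I1) +
      (Phi (t n.+1) * (g (t n.+1) - g (tau n)) - I2)) by ring.
  apply: (le_trans (ler_normB _ _)).
  have := ler_normD (Phi (t n) * (g (tau n) - g (t n)) - I1)
      (Phi (t n.+1) * (g (t n.+1) - g (tau n)) - I2).
  lra.
have := key p (leqnn p); rewrite tp => /le_lt_trans; apply.
move: re; rewrite ltr_pdivlMr ?ltr_wpDl//.
have : 0 <= intv (ball_osc Phi r) a b by apply: Rintegral_ge0 => s _; exact: ball_osc_ge0.
lra.
Qed.

End oscillation.

Lemma countable_setU T (A B : set T) : countable A -> countable B -> countable (A `|` B).
Proof.
move=> cA cB; rewrite -bigcup2inE; apply: bigcup_countable; first exact: countableP.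
by move=> [|[|n]] _.
Qed.

(** * Monotone functions and bounded variation *)

Section monotone_functions.
Context {R : realType}.
Implicit Types (f : R -> R).

(** One-sided limits exist everywhere and, where they agree, squeeze [f x]. Every discontinuity is
    therefore a jump, and jumps are counted on the intervals ]-n, n[. *)
Lemma nondecreasing_countable_discontinuities f : {homo f : x y / x <= y} ->
  countable [set x | ~ {for x, continuous f}].
Proof.
move=> ndf.
have ndf' a b : {in `[a, b]%R &, nondecreasing_fun f} by move=> x y _ _; exact: ndf.
have cD (n : nat) := discontinuity_countable (ndf' (- n%:R) n%:R).
have cU : countable (\bigcup_(n : nat)
    [set x | x \in (`](- n%:R), n%:R[)%R /\ discontinuity f x]).
  by apply: bigcup_countable => //; exact: countableP.
apply: (sub_countable _ cU).
apply: subset_card_le => x /= ncf.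
have xn : `|x| < (Num.bound x)%:R by have := archi_boundP (normr_ge0 x); rewrite /Num.bound/= normr_id.
have xI : x \in (`](- (Num.bound x)%:R), (Num.bound x)%:R[)%R.
  by rewrite in_itv/= -ltr_norml.
exists (Num.bound x) => //=; split => //.
have cl : cvg (f t @[t --> x^'-]).
  apply: nondecreasing_at_left_is_cvgr; near=> s; first by move=> ? ? _ _; exact: ndf.
  by exists (f x) => _ [t /= + <-]; rewrite in_itv/= => /andP[_ /ltW]; exact: ndf.
have cr : cvg (f t @[t --> x^'+]).
  apply: nondecreasing_at_right_is_cvgr; near=> s; first by move=> ? ? _ _; exact: ndf.
  by exists (f x) => _ [t /= + <-]; rewrite in_itv/= => /andP[/ltW + _]; exact: ndf.
split => //; apply/eqP => lr; apply: ncf.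
have h1 : lim (f t @[t --> x^'-]) <= f x.
  by apply: limr_le => //; near=> t; apply: ndf; exact/ltW.
have h2 : f x <= lim (f t @[t --> x^'+]).
  by apply: limr_ge => //; near=> t; apply: ndf; exact/ltW.
have e1 : lim (f t @[t --> x^'-]) = f x by apply/eqP; rewrite eq_le h1/= lr.
apply/left_right_continuousP; split; first by rewrite -e1.
by rewrite -e1 lr.
Unshelve. all: by end_near. Qed.

(** For nondecreasing [f] this is f(x+), the right-continuous modification needed to define a
    Stieltjes measure; it differs from [f] only at discontinuities. *)
Definition right_limit f (x : R) : R := inf [set f t | t in [set t | x < t]].

Section right_limit.
Variables (f : R -> R) (k : R).
Hypothesis ndf : {homo f : x y / x <= y}.
Hypothesis fk : forall x, `|f x| <= k.

Lemma right_limit_has_inf x : has_inf [set f t | t in [set t | x < t]].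
Proof.
split; first by exists (f (x + 1)), (x + 1) => //=; rewrite ltrDl.
by exists (- k) => _ [t _ <-]; have := fk t; rewrite ler_norml => /andP[].
Qed.

Lemma right_limit_le x t : x < t -> right_limit f x <= f t.
Proof. by move=> xt; apply: ge_inf; [case: (right_limit_has_inf x)|exists t]. Qed.

Lemma le_right_limit x c : (forall t, x < t -> c <= f t) -> c <= right_limit f x.
Proof.
move=> H; apply: lb_le_inf; first by case: (right_limit_has_inf x).
by move=> _ [t /= xt <-]; exact: H.
Qed.

Lemma le_id_right_limit x : f x <= right_limit f x.
Proof. by apply: le_right_limit => t xt; apply: ndf; exact: ltW. Qed.

Lemma norm_right_limit_le x : `|right_limit f x| <= k.
Proof.
have := le_id_right_limit x; have := right_limit_le (ltac:(by rewrite ltrDl) : x < x + 1).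
have := fk x; have := fk (x + 1); rewrite !ler_norml => /andP[? ?] /andP[? ?] ? ?.
by apply/andP; split; lra.
Qed.

Lemma nondecreasing_right_limit : {homo right_limit f : x y / x <= y}.
Proof.
move=> x y xy; apply: le_right_limit => t yt; apply: right_limit_le.
exact: le_lt_trans yt.
Qed.

Lemma right_continuous_right_limit : right_continuous (right_limit f).
Proof.
move=> x; apply/cvgrPdist_le => e e0.
have [_ [t /= xt <-] ft] := inf_adherent e0 (right_limit_has_inf x).
near=> s.
have xs : x <= s by apply: ltW; near: s; exact: nbhs_right_gt.
have st : s < t by near: s; exact: nbhs_right_lt.
rewrite distrC ger0_norm ?subr_ge0 ?nondecreasing_right_limit//.
have := right_limit_le st; move: ft; rewrite /right_limit; lra.
Unshelve. all: by end_near. Qed.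

Lemma right_limit_continuous x : {for x, continuous f} -> right_limit f x = f x.
Proof.
move=> cf; apply/eqP; rewrite eq_le le_id_right_limit andbT.
apply/ler_addgt0Pr => e e0.
move: cf => /cvgrPdist_le /(_ _ e0)/nbhs_ballP[d /= d0 H].
have d2 : 0 < d / 2 by rewrite divr_gt0.
have xd : x < x + d / 2 by rewrite ltrDl.
have := H (x + d / 2); rewrite /ball/= opprD addNKr normrN gtr0_norm//.
move=> /(_ ltac:(lra)); have := right_limit_le xd.
rewrite ler_norml => ? /andP[? ?]; lra.
Qed.

End right_limit.

(** Composing with it extends a function from [c, d] to the line by its end values and keeps
    monotonicity. *)
Definition clamp (c d x : R) : R := Num.max c (Num.min d x).

Lemma clamp_id c d x : c <= x <= d -> clamp c d x = x.
Proof. by move=> /andP[cx xd]; rewrite /clamp min_r// max_r. Qed.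

Lemma clamp_itv c d x : c <= d -> c <= clamp c d x <= d.
Proof. by move=> cd; rewrite /clamp le_max lexx ge_max cd ge_min lexx. Qed.

Lemma nondecreasing_clamp c d : {homo clamp c d : x y / x <= y}.
Proof. by move=> x y xy; rewrite /clamp ge_max !le_max !le_min !ge_min !lexx xy ?orbT. Qed.

Lemma nondecreasing_comp_clamp f c d : c <= d -> {in `[c, d]%R &, nondecreasing_fun f} ->
  {homo (f \o clamp c d) : x y / x <= y}.
Proof.
move=> cd ndf x y xy /=; apply: ndf; rewrite ?in_itv/= ?clamp_itv//.
exact: nondecreasing_clamp.
Qed.

(** Jordan decomposition into positive and negative variations on the compact [c, d], frozen outside
    so that both parts are bounded and monotone on the whole line. *)
Lemma bounded_variation_oo_decomposition (Phi : R -> R) (a b c d : R) :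
  bounded_variation_oo a b Phi -> a < c -> c < d -> d < b ->
  exists f1 f2 : R -> R, exists k : R,
    [/\ {homo f1 : x y / x <= y}, {homo f2 : x y / x <= y},
        (forall x, `|f1 x| <= k), (forall x, `|f2 x| <= k) &
        forall x, c <= x <= d -> Phi x = f1 x - f2 x].
Proof.
move=> [M HM] ac cd db.
have bv : bounded_variation c d Phi.
  by exists M => _ [s cds <-]; exact: HM.
have bvN := bounded_variationN bv.
have cd' := ltW cd.
pose f1 := (fine \o pos_tv c Phi) \o clamp c d.
pose f2 := (fine \o neg_tv c Phi) \o clamp c d.
have n1 : {homo f1 : x y / x <= y}.
  by apply: nondecreasing_comp_clamp => //; exact: fine_neg_tv_nondecreasing bvN.
have n2 : {homo f2 : x y / x <= y}.
  by apply: nondecreasing_comp_clamp => //; exact: fine_neg_tv_nondecreasing bv.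
have bd (h : R -> R) : {homo h \o clamp c d : x y / x <= y} ->
    forall x, `|(h \o clamp c d) x| <= `|h c| + `|h d|.
  move=> nh x.
  have cE : clamp c d c = c by apply: clamp_id; rewrite lexx.
  have dE : clamp c d d = d by apply: clamp_id; rewrite lexx andbT.
  have /andP[cx xd] := clamp_itv x cd'.
  have cl : clamp c d (clamp c d x) = clamp c d x by apply: clamp_id; rewrite cx.
  have := nh _ _ cx; have := nh _ _ xd; rewrite /= cE dE cl => h1 h2.
  have := ler_norm (h d); have := ler_norm (- h c); rewrite normrN.
  have := normr_ge0 (h c); have := normr_ge0 (h d).
  by rewrite ler_norml => *; apply/andP; split; lra.
exists f1, f2.
exists (`|(fine \o pos_tv c Phi) c| + `|(fine \o pos_tv c Phi) d| +
       (`|(fine \o neg_tv c Phi) c| + `|(fine \o neg_tv c Phi) d|)).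
split => //.
- by move=> x; rewrite (le_trans (bd _ n1 x))// lerDl addr_ge0.
- by move=> x; rewrite (le_trans (bd _ n2 x))// lerDr addr_ge0.
- move=> x xcd; rewrite /f1 /f2 /= clamp_id//.
  by apply: (bounded_variation_pos_neg_tvE bv); rewrite in_itv.
Qed.

(** Each interval is exhausted by countably many compact ones, on which [Phi] is a difference of
    monotone functions; the countable complement of the intervals is simply added. *)
Lemma countably_bounded_variation_discontinuities (Phi : R -> R) :
  countably_bounded_variation Phi -> countable [set x | ~ {for x, continuous Phi}].
Proof.
move=> [a [b [ab _ bv cC]]].
pose U := ~` \bigcup_n `]a n, b n[%classic.
pose c n (m : nat) := a n + m.+1%:R^-1; pose d n (m : nat) := b n - m.+1%:R^-1.
(* Strict inequalities, so that the decomposition on the closed interval is valid in a neighbourhood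
   of [x]. *)
pose E n m : set R := [set x | c n m < x < d n m /\ ~ {for x, continuous Phi}].
have cE n m : countable (E n m).
  have mp : 0 < m.+1%:R^-1 :> R by rewrite invr_gt0 ltr0n.
  have [cd|dc] := ltP (c n m) (d n m); last first.
    rewrite (_ : E n m = set0) //; rewrite -subset0 => x [/andP[cx xd] _].
    by have := lt_trans cx xd; rewrite ltNge dc.
  have ac : a n < c n m by rewrite ltrDl.
  have db : d n m < b n by rewrite ltrBlDr ltrDl.
  have [f1 [f2 [k [n1 n2 _ _ fE]]]] := bounded_variation_oo_decomposition (bv n) ac cd db.
  apply: sub_countable (countable_setU (nondecreasing_countable_discontinuities n1)
     (nondecreasing_countable_discontinuities n2)).
  apply: subset_card_le => x [/andP[cx xd] ncP].
  apply: contrapT => /not_orP[/= /contrapT c1 /contrapT c2]; apply: ncP.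
  have c12 : {for x, continuous (fun t => f1 t - f2 t)} by apply: cvgB; [exact: c1|exact: c2].
  have Px : Phi x = f1 x - f2 x by apply: fE; rewrite !ltW.
  rewrite /prop_for /continuous_at Px.
  apply: cvg_trans c12; apply: near_eq_cvg; near=> t.
  rewrite fE//; apply/andP; split; apply: ltW; near: t.
    exact: lt_nbhsr.
  exact: lt_nbhsl.
have cB : countable (U `|` \bigcup_n \bigcup_m E n m).
  apply: countable_setU => //; apply: bigcup_countable => [|n _]; first exact: countableP.
  by apply: bigcup_countable => [|m _] //; exact: countableP.
apply: sub_countable cB; apply: subset_card_le => x /= ncx.
have [[n _ /=]|xU] := pselect ((\bigcup_n `]a n, b n[%classic) x); last by left.
rewrite in_itv/= => /andP[ax xb]; right; exists n => //.
pose e := Num.min (x - a n) (b n - x).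
have e0 : 0 < e by rewrite lt_min !subr_gt0 ax.
have [m me] : exists m : nat, m.+1%:R^-1 < e.
  by have [m _ /(_ m (leqnn m))] := near_infty_natSinv_lt (PosNum e0); exists m.
exists m => //; split => //; move: me; rewrite lt_min /c /d => /andP[? ?].
by rewrite ltrBrDl addrC -ltrBrDl -ltrBrDl; apply/andP; split; rewrite // ltrBrDl addrC -ltrBrDl.
Unshelve. all: by end_near. Qed.

End monotone_functions.

Lemma exists_fine_partition {R : realType} (c d m : R) : c < d -> 0 < m ->
  exists (p : nat) (t : nat -> R), [/\ t 0%N = c, t p = d,
    forall i, t i <= t i.+1 & forall i, t i.+1 - t i < m].
Proof.
move=> cd m0.
have [p p0 pm] : exists2 p : nat, (0 < p)%N & (d - c) / p%:R < m.
  have := archi_boundP (ltW (divr_gt0 (_ : 0 < d - c) m0)); rewrite subr_gt0 => /(_ cd).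
  set q := Num.bound _ => qP; exists q.+1 => //.
  rewrite ltr_pdivrMr ?ltr0n// mulrC -ltr_pdivrMr//.
  by rewrite (lt_trans qP)// ltr_nat.
pose t (i : nat) := c + i%:R * ((d - c) / p%:R).
have u0 : 0 < (d - c) / p%:R by rewrite divr_gt0 ?subr_gt0 ?ltr0n.
have tS i : t i.+1 = t i + (d - c) / p%:R by rewrite /t -natr1 mulrDl mul1r addrA.
have pn0 : p%:R != 0 :> R by rewrite pnatr_eq0 -lt0n.
exists p, t; split => [||i|i].
- by rewrite /t mul0r addr0.
- by rewrite /t [p%:R * _]mulrC (divfK pn0) addrC subrK.
- by rewrite tS lerDl ltW.
- by rewrite tS addrC addKr.
Qed.

Lemma is_RS_integral_unique {R : realType} (g f : R -> R) (a b l l' : R) : a < b ->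
  is_RS_integral g f a b l -> is_RS_integral g f a b l' -> l = l'.
Proof.
move=> ab RS RS'; apply/eqP; rewrite -subr_eq0 -normr_le0; apply/ler_addgt0Pr => e e0.
have e2 : 0 < e / 2 by rewrite divr_gt0.
have [d d0 H] := RS _ e2; have [d' d'0 H'] := RS' _ e2.
have m0 : 0 < Num.min d d' by rewrite lt_min d0.
have [p [t [t0 tp tle tm]]] := exists_fine_partition ab m0.
have tm1 i : t i.+1 - t i < d by have := tm i; rewrite lt_min => /andP[].
have tm2 i : t i.+1 - t i < d' by have := tm i; rewrite lt_min => /andP[].
have tt (k : nat) : (k < p)%N -> t k <= t k <= t k.+1 by rewrite lexx tle.
have h := H p t t t0 tp tt (fun k _ => tm1 k).
have h' := H' p t t t0 tp tt (fun k _ => tm2 k).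
move: h h'; set S := \sum_(k < p) _ => h h'.
rewrite (_ : l - l' = (S - l') - (S - l)); last by ring.
by apply: (le_trans (ler_normB _ _)); lra.
Qed.

(** * Integrals against a Stieltjes measure as Riemann-Stieltjes integrals *)

Section stieltjes_RS.
Context {R : realType}.
Variables (nu : {finite_measure set (measurableTypeR R) -> \bar R}) (h : R -> R) (c d : R).
Hypothesis cd : c < d.
Hypothesis nuE : forall a b, c <= a -> a <= b -> b <= d -> nu `]a, b]%classic = (h b - h a)%:E.
Variables (g g1 : R -> R) (k : R).
Hypothesis dg : forall s, is_derive s (1 : R) g (g1 s).
Hypothesis g1k : forall s, `|g1 s| <= k.

Let cg : continuous g. Proof. exact: is_derive_continuous dg. Qed.

Let integrable_g (a b : R) : nu.-integrable (`]a, b]%classic : set (measurableTypeR R)) (EFin \o g).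
Proof.
have [M gM] : exists M, forall t, t \in `[a, b]%R -> `|g t| <= M.
  have [ab|ba] := leP a b; last first.
    by exists 0 => t; rewrite in_itv/= => /andP[h1 h2]; have := le_trans h1 h2; rewrite leNgt ba.
  have cn : {within `[a, b], continuous (fun t => `|g t|)}.
    apply: continuous_subspaceT => t.
    by apply: (@continuous_comp _ _ _ g Num.norm); [exact: cg|exact: norm_continuous].
  by have [s _ sM] := EVT_max ab cn; exists `|g s|.
apply: measurable_bounded_integrable => //.
- by rewrite ltey_eq fin_num_measure//; exact: measurable_itv.
- by apply: measurable_funTS; exact: continuous_measurable_fun.
- exists M; split; first exact: num_real.
  move=> M' MM' t /=; rewrite in_itv/= => /andP[at' tb].
  by rewrite (le_trans (gM t _)) ?ltW// in_itv/= (ltW at').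
Qed.

Let piece (a b s e : R) : c <= a -> a <= b -> b <= d -> (forall t, a < t <= b -> `|g t - g s| <= e) ->
  `|g s * (h b - h a) - \int[nu]_(t in `]a, b]) g t| <= e * (h b - h a).
Proof.
move=> ca ab bd ge.
have mab : measurable (`]a, b]%classic : set (measurableTypeR R)) by exact: measurable_itv.
have cst_int r : \int[nu]_(t in `]a, b]) cst r t = r * (h b - h a).
  by rewrite Rintegral_cst//= nuE.
have icst r : nu.-integrable (`]a, b]%classic : set (measurableTypeR R)) (EFin \o cst r).
  apply: (integrable_bounded_continuous nu mab (k := `|r|)) => // ?; exact: cvg_cst.
rewrite -!cst_int -RintegralB//.
have ib : nu.-integrable (`]a, b]%classic : set (measurableTypeR R)) (EFin \o (fun t => cst (g s) t - g t)).
  have := integrableB mab (icst (g s)) (integrable_g a b).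
  by [].
apply: (le_trans (le_normr_Rintegral mab ib)).
apply: le_Rintegral => //; first exact: integrable_norm.
by move=> t; rewrite /= in_itv/= => /ge; rewrite distrC.
Qed.

(** Existence of the Riemann-Stieltjes integral is assumed, so a single choice of partition and tags
    identifies its value; [g] is [k]-Lipschitz, hence nearly constant on each piece. *)
Lemma stieltjes_integral_RS l : is_RS_integral g h c d l ->
  \int[nu]_(t in `]c, d]) g t = l.
Proof.
move=> RS; apply/eqP; rewrite -subr_eq0 -normr_le0; apply/ler_addgt0Pr => e e0; rewrite add0r.
have e2 : 0 < e / 2 by rewrite divr_gt0.
have k0 : 0 <= k by exact: (le_trans (normr_ge0 _) (g1k 0)).
have hcd : 0 <= h d - h c.
  by rewrite -lee_fin -nuE// ?ltW.
have [dl dl0 RSd] := RS _ e2.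
pose H := (k + 1) * (h d - h c + 1).
have H0 : 0 < H by rewrite mulr_gt0// ltr_wpDl.
pose m := Num.min dl (e / 2 / H).
have m0 : 0 < m by rewrite lt_min dl0 divr_gt0.
have mH : m * H <= e / 2.
  have : m <= e / 2 / H by rewrite ge_min lexx orbT.
  by rewrite ler_pdivlMr.
have mdl : m <= dl by rewrite ge_min lexx.
have [p [t [t0 tp tle tm]]] := exists_fine_partition cd m0.
have tmono : {homo t : i j / (i <= j)%N >-> i <= j}.
  by apply: homo_leq => //; exact: le_trans.
have tc i : c <= t i by rewrite -t0; exact: tmono.
have td i : (i <= p)%N -> t i <= d by move=> ip; rewrite -tp; exact: tmono.
(* Tags at the right ends, which belong to the half-open pieces that the measure sees. *)
have := RSd p t (t \o S) t0 tp.
move=> /(_ _ _)/wrap[||].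
- by move=> i _; rewrite /= tle lexx.
- by move=> i _; rewrite (lt_le_trans (tm i)).
have key n : (n <= p)%N -> `|\sum_(i < n) g (t i.+1) * (h (t i.+1) - h (t i)) -
    \int[nu]_(s in `]c, (t n)]) g s| <= k * m * (h (t n) - h c).
  elim: n => [|n IH] np.
    by rewrite big_ord0 t0 set_itvoc0 Rintegral_set0 !subrr normr0 mulr0.
  rewrite big_ord_recr/=.
  have mI (a b : R) : measurable (`]a, b]%classic : set (measurableTypeR R)) by exact: measurable_itv.
  have U : (`]c, t n.+1]%classic : set R) = `]c, t n] `|` `]t n, t n.+1].
    by rewrite -itv_bndbnd_setU ?bnd_simp ?tc ?tle.
  have -> : \int[nu]_(s in `]c, (t n.+1)]) g s =
      \int[nu]_(s in `]c, (t n)]) g s + \int[nu]_(s in `](t n), (t n.+1)]) g s.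
    rewrite U Rintegral_setU//; first by rewrite -U; exact: integrable_g.
    apply/disj_set2P; rewrite -subset0 => s [] /=; rewrite !in_itv/= => /andP[_ h1] /andP[h2 _].
    by have := le_lt_trans h1 h2; rewrite ltxx.
  have P := @piece (t n) (t n.+1) (t n.+1) (k * m) (tc n) (tle n) (td _ np) _.
  have {}P : `|g (t n.+1) * (h (t n.+1) - h (t n)) - \int[nu]_(t in `](t n), (t n.+1)]) g t| <=
     k * m * (h (t n.+1) - h (t n)).
    apply: P => s /andP[s1 s2].
    apply: (le_trans (le_norm_lip _ _ dg g1k)); rewrite ler_wpM2l//.
    rewrite distrC ger0_norm ?subr_ge0//.
    by have := tm n; lra.
  have {}IH := IH (ltnW np).
  move: IH P; set S := \sum_(i < n) _; set X := g _ * _; set I1 := Rintegral _ _ _.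
  set I2 := Rintegral _ _ _ => IH P.
  rewrite (_ : S + X - (I1 + I2) = (S - I1) + (X - I2)); last by ring.
  apply: (le_trans (ler_normD _ _)); lra.
have := key p (leqnn p); rewrite tp /=.
set S := \sum_(i < p) _; set I := Rintegral _ _ _ => h1 h2.
rewrite (_ : I - l = (S - l) - (S - I)); last by ring.
apply: (le_trans (ler_normB _ _)).
have h3 : k * m * (h d - h c) <= m * H.
  rewrite /H [k * m]mulrC -mulrA ler_pM2l//.
  have := mulr_ge0 k0 hcd; lra.
lra.
Qed.

End stieltjes_RS.

Section cone_limit_theory.
Context {R : realType}.
Implicit Types (f g : R -> R -> R) (L M : R).

Lemma cone_limitD f g x0 L M : cone_limit f x0 L -> cone_limit g x0 M ->
  cone_limit (fun x y => f x y + g x y) x0 (L + M).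
Proof.
move=> fL gM C e C0 e0; have e2 : 0 < e / 2 by rewrite divr_gt0.
have [d1 d10 H1] := fL C _ C0 e2; have [d2 d20 H2] := gM C _ C0 e2.
exists (Num.min d1 d2); first by rewrite lt_min d10.
move=> x y /andP[y0]; rewrite lt_min => /andP[y1 y2] xC.
rewrite (_ : _ - _ = (f x y - L) + (g x y - M)); last by ring.
apply: (le_trans (ler_normD _ _)).
have := H1 x y; rewrite y0 y1 => /(_ isT xC).
have := H2 x y; rewrite y0 y2 => /(_ isT xC).
lra.
Qed.

Lemma cone_limitZ f x0 L (k : R) : cone_limit f x0 L -> cone_limit (fun x y => k * f x y) x0 (k * L).
Proof.
move=> fL C e C0 e0.
have k1 : 0 < `|k| + 1 by rewrite ltr_pwDr.
have [d d0 H] := fL C (e / (`|k| + 1)) C0 (divr_gt0 e0 k1).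
exists d => // x y yd xC; have := H x y yd xC.
rewrite -mulrBr normrM ler_pdivlMr// mulrDr mulr1.
have := normr_ge0 (f x y - L); lra.
Qed.

Lemma eq_cone_limit f g x0 L : (forall x y, 0 < y -> f x y = g x y) ->
  cone_limit f x0 L -> cone_limit g x0 L.
Proof.
move=> fg fL C e C0 e0; have [d d0 H] := fL C e C0 e0.
by exists d => // x y /[dup] yd /andP[y0 _] xC; rewrite -fg//; exact: H.
Qed.

Lemma continuous_cone_limit (f : R -> R -> R) (x0 : R) :
  {for (x0, 0 : R), continuous (fun z : R * R => f z.1 z.2)} -> cone_limit f x0 (f x0 0).
Proof.
move=> cf C e C0 e0.
move: cf => /cvgrPdist_le /(_ _ e0)/nbhs_ballP[r /= r0 H].
exists (Num.min (r / C) r); first by rewrite lt_min r0 divr_gt0.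
move=> x y /andP[y0]; rewrite lt_min => /andP[yC yr] xC.
rewrite distrC; apply: (H (x, y)); split; rewrite /ball/=.
  by rewrite distrC (le_lt_trans xC)// mulrC -ltr_pdivlMr.
by rewrite sub0r normrN gtr0_norm.
Qed.

End cone_limit_theory.

(** * Localization *)

Section far_piece.
Context {R : realType}.
Local Notation lambda := (@lebesgue_measure R).

Lemma ch_le (y : R) : 0 <= y <= 2^-1 -> ch y <= 1 + 2 * y.
Proof.
move=> yy; have := sh_le yy; have : expR (- y) <= 1 by rewrite expR_le1 oppr_le0; case/andP: yy.
have : ch y = sh y + expR (- y) by rewrite /ch /sh; field.
lra.
Qed.

(** [- (1 - cos T0)^-1] is the boundary value of [dconjK] at (T0, 0). In the common fraction the
    numerator is linear in cos T - cos T0 and ch y - 1 up to bounded factors (2 and 7, the latter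
    with ch y - 1 <= 2 y), and the denominator is at least (m / 2)^2 m. *)
Lemma dconjK_near (T T0 y m : R) : 0 < m -> m <= 1 - cos T0 -> `|T - T0| <= m / 2 ->
  0 < y <= 2^-1 ->
  `|dconjK T y + (1 - cos T0)^-1| <= 4 / m ^+ 3 * (2 * `|T - T0| + 14 * y).
Proof.
move=> m0 mT0 TT /andP[y0 y2].
have hc := le_trans (dist_cos T T0) TT.
have hc' := dist_cos T T0.
have cy := @ch_le y ltac:(by rewrite (ltW y0)).
have cy1 := ch_ge1 y.
have := cos_le1 T; have := cos_geN1 T; have := cos_le1 T0; have := cos_geN1 T0.
move: hc hc' mT0; rewrite /dconjK /den.
set c := cos T; set c0 := cos T0; set C := ch y; rewrite -/C in cy cy1.
move=> hc hc' mT0 c01 c02 c1 c2.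
have D0 : m / 2 <= C - c by move: hc; rewrite ler_norml => /andP[? ?]; lra.
have D1 : 0 < C - c by lra.
have E0 : 0 < 1 - c0 by lra.
have -> : (c * C - 1) / (C - c) ^+ 2 + (1 - c0)^-1 =
  (- ((1 - c) * (c - c0)) + (C - 1) * (c * (1 - c0) + 2 * (1 - c) + (C - 1))) /
    ((C - c) ^+ 2 * (1 - c0)) by field; rewrite !gt_eqF.
have p0 : 0 < (C - c) ^+ 2 * (1 - c0) by rewrite mulr_gt0// exprn_gt0.
rewrite normrM normfV (gtr0_norm p0) ler_pdivrMr//.
have q0 : m ^+ 3 / 4 <= (C - c) ^+ 2 * (1 - c0).
  have : (m / 2) ^+ 2 <= (C - c) ^+ 2 by rewrite ler_sqr ?nnegrE//; lra.
  move=> s0; have := ler_pM (sqr_ge0 (m / 2)) (ltW m0) s0 mT0.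
  by rewrite (_ : (m / 2) ^+ 2 * m = m ^+ 3 / 4); last by field.
have n1 : `|- ((1 - c) * (c - c0)) + (C - 1) * (c * (1 - c0) + 2 * (1 - c) + (C - 1))| <=
   2 * `|T - T0| + 14 * y.
  apply: (le_trans (ler_normD _ _)); rewrite normrN !normrM; apply: lerD.
    by apply: ler_pM => //; rewrite ler_norml; apply/andP; split; lra.
  have -> : 14 * y = (2 * y) * 7 by ring.
  apply: ler_pM => //; first by rewrite ger0_norm; lra.
  rewrite ler_norml; apply/andP; split; nra.
apply: (le_trans n1).
have tt : 0 <= 2 * `|T - T0| + 14 * y by rewrite addr_ge0// mulr_ge0// ltW.
rewrite mulrAC -[leLHS]mul1r ler_wpM2r//.
rewrite mulrAC ler_pdivlMr ?exprn_gt0//; lra.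
Qed.

Lemma one_sub_cos_ge (p q : R) : 0 < p -> q < 2 * pi ->
  exists2 m : R, 0 < m & forall T, p <= T <= q -> m <= 1 - cos T.
Proof.
move=> p0 q2; have [pq|qp] := leP p q; last first.
  exists 1 => // T /andP[h1 h2]; have := le_trans h1 h2; by rewrite leNgt qp.
have c1 : {within `[p, q], continuous (fun T : R => 1 - cos T)}.
  by apply: continuous_subspaceT => T; apply: cvgB; [exact: cvg_cst|exact: continuous_cos].
have [c] := EVT_min pq c1; rewrite in_itv/= => /andP[pc cq] H.
exists (1 - cos c); last by move=> T Tpq; apply: H; rewrite in_itv.
have -> : cos c = cos (c / 2) ^+ 2 *+ 2 - 1.
  by rewrite -cos_mulr2n; congr cos; rewrite -mulr_natr; field.
have : 0 < sin (c / 2) by apply: sin_gt0_pi; apply/andP; split; lra.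
have := cos2Dsin2 (c / 2); nra.
Qed.

Variables (Phi : R -> R) (B : R).
Hypothesis mPhi : measurable_fun [set: R] Phi.
Hypothesis PhiB : forall t, `|Phi t| <= B.

Let integrable_Phi_K (K : R -> R) (k a b : R) : continuous K -> (forall t, `|K t| <= k) ->
  lambda.-integrable `[a, b] (EFin \o (fun t => Phi t * K t)).
Proof.
move=> cK Kk; apply: (@integrable_bounded _ _ (B * k)).
  by apply: measurable_funM => //; exact: continuous_measurable_fun.
by move=> t; rewrite normrM ler_pM.
Qed.

Lemma integrable_Phi_dconjK (x y a b : R) : 0 < y ->
  lambda.-integrable `[a, b] (EFin \o (fun t => Phi t * dconjK (x - t) y)).
Proof.
move=> y0; apply: (integrable_Phi_K (k := (ch y - 1)^-1)).
  by apply: (continuous_comp_subl (g := @dconjK R ^~ y)); exact: continuous_dconjK.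
by move=> t; exact: dconjK_ub.
Qed.

(** The bound by [m] keeps [x0] away from [a, b] modulo 2 pi, so in a cone the kernel converges to
    its boundary value at rate O(y), uniformly in [t]. *)
Lemma cone_limit_far (x0 a b m : R) : a <= b -> 0 < m ->
  (forall t, a <= t <= b -> m <= 1 - cos (x0 - t)) ->
  exists L, cone_limit (fun x y => intv (fun t => Phi t * dconjK (x - t) y) a b) x0 L.
Proof.
move=> ab m0 Hm.
have B0 : 0 <= B := le_trans (normr_ge0 _) (PhiB 0).
(* truncated at m so that it is bounded and continuous on the whole line *)
pose K0 (t : R) := - (Num.max m (1 - cos (x0 - t)))^-1.
have mx t : m <= Num.max m (1 - cos (x0 - t)) by rewrite le_max lexx.
have mx0 t : 0 < Num.max m (1 - cos (x0 - t)) by rewrite (lt_le_trans m0).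
have cK0 : continuous K0.
  move=> t; apply: cvgN; apply: cvgV; first by rewrite gt_eqF.
  apply: (@continuous_max _ _ (cst m) (fun t => 1 - cos (x0 - t))); first exact: cvg_cst.
  apply: cvgB; first exact: cvg_cst.
  exact: (continuous_comp_subl (g := @cos R) (x := x0) (@continuous_cos R)).
have K0b t : `|K0 t| <= m^-1.
  by rewrite normrN normfV gtr0_norm// lef_pV2 ?posrE.
exists (intv (fun t => Phi t * K0 t) a b) => C e C0 e0.
pose G := (B + 1) * (4 / m ^+ 3 * (2 * C + 14)) * (b - a + 1).
have c14 : 0 < 2 * C + 14 by rewrite addr_gt0// mulr_gt0.
have G1 : 0 < (B + 1) * (4 / m ^+ 3 * (2 * C + 14)).
  by rewrite !mulr_gt0// ?invr_gt0 ?exprn_gt0// ltr_wpDl.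
have G0 : 0 < G by rewrite mulr_gt0// ltr_wpDl// subr_ge0.
exists (Num.min 2^-1 (Num.min (m / 2 / C) (e / G))).
  by rewrite !lt_min invr_gt0 ltr0n !divr_gt0.
move=> x y /andP[y0]; rewrite !lt_min => /andP[y2 /andP[yC yG]] xC.
have i1 := integrable_Phi_dconjK x a b y0.
have i2 : lambda.-integrable `[a, b] (EFin \o (fun t => Phi t * K0 t)).
  exact: integrable_Phi_K cK0 K0b.
rewrite /intv -RintegralB//.
rewrite -/(intv (fun t => Phi t * dconjK (x - t) y - Phi t * K0 t) a b).
have yC' : C * y <= m / 2 by rewrite mulrC -ler_pdivlMr// ltW.
apply: (@le_trans _ _ ((B + 1) * (4 / m ^+ 3 * (2 * C + 14)) * y * (b - a))).
  apply: intv_norm_le => //.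
    apply: (@integrable_bounded _ _ (B * (ch y - 1)^-1 + B * m^-1)).
      apply: measurable_funB; apply: measurable_funM => //; apply: continuous_measurable_fun => //.
      by apply: (continuous_comp_subl (g := @dconjK R ^~ y)); exact: continuous_dconjK.
    move=> t; apply: (le_trans (ler_normB _ _)).
    by apply: lerD; rewrite (normrM (Phi t)); apply: ler_pM => //; exact: dconjK_ub.
  move=> t tab; rewrite -mulrBr (normrM (Phi t)) -(mulrA (B + 1)); apply: ler_pM => //.
    by rewrite (le_trans (PhiB t))// lerDl.
  rewrite /K0 opprK max_r; last exact: Hm.
  have TT : (x - t) - (x0 - t) = x - x0 by ring.
  apply: (le_trans (dconjK_near m0 (Hm t tab) _ _)).
  - by rewrite TT (le_trans xC).
  - by rewrite y0 ltW.
  by rewrite TT -[leRHS]mulrA ler_pM2l ?divr_gt0 ?exprn_gt0//; lra.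
move: yG; rewrite ltr_pdivlMr// /G => yG.
have : 0 <= (B + 1) * (4 / m ^+ 3 * (2 * C + 14)) * y by rewrite mulr_ge0// ltW.
move: yG; set g := (B + 1) * _ => yG; have := mulr_gt0 G1 y0; rewrite -/g; lra.
Qed.

End far_piece.

Section near_piece.
Context {R : realType}.
Local Notation lambda := (@lebesgue_measure R).

(** Serves for the boundary terms of the integration by parts: away from its pole the kernel is
    continuous up to [y = 0]. *)
Lemma cone_limit_conjK (x0 d : R) : 0 < 1 - cos (x0 - d) ->
  exists L, cone_limit (fun x y => conjK (x - d) y) x0 L.
Proof.
move=> H; exists (conjK (x0 - d) 0); apply: (@continuous_cone_limit _ (fun x y => conjK (x - d) y)).
have cs (f : R -> R) : continuous f -> {for (x0, 0 : R), continuous (fun z : R * R => f (z.1 - d))}.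
  move=> cf; apply: (@continuous_comp _ _ _ (fun z : R * R => z.1 - d) f); last exact: cf.
  by apply: cvgB; [exact: cvg_fst|exact: cvg_cst].
apply: cvgM; first by apply: cs; exact: continuous_sin.
apply: cvgV.
  by rewrite /den /ch /= oppr0 expR0 -[1 + 1]/(2%:R) divff// gt_eqF.
apply: cvgB; last by apply: cs; exact: continuous_cos.
apply: (@continuous_comp _ _ _ (fun z : R * R => z.2) ch); first exact: cvg_snd.
by apply: (@is_derive_continuous _ _ sh) => t; exact: is_derive_ch.
Qed.

(** Integration by parts run backwards. The measure is built from the right-continuous modification
    [h], which equals [f] a.e.; the integral is then a conjugate potential plus kernels with poles
    at [c] and [d], which are regular inside. *)
Lemma ae_cone_limit_monotone (f : R -> R) (k c d : R) : c < d -> d - c <= 1 ->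
  {homo f : x y / x <= y} -> (forall x, `|f x| <= k) ->
  {ae lambda, forall x, c < x < d -> exists L,
    cone_limit (fun x y => intv (fun t => f t * dconjK (x - t) y) c d) x L}.
Proof.
move=> cd cd1 ndf fk.
pose h := right_limit f.
have ndh : {homo h : x y / x <= y} := nondecreasing_right_limit fk.
have hk : forall x, `|h x| <= k by move=> x; exact: norm_right_limit_le ndf fk x.
have rch : right_continuous h := right_continuous_right_limit fk.
have [mu [muE _]] := exists_stieltjes_measure ndh rch.
pose D := `]c, d]%classic : set (measurableTypeR R).
have mD : measurable D by exact: measurable_itv.
have muD : (mu D < +oo)%E by rewrite muE ?(ltW cd)// ltry.
pose nu : {finite_measure set (measurableTypeR R) -> \bar R} := mfrestr mD muD.
have nuE a b : c <= a -> a <= b -> b <= d -> nu `]a, b]%classic = (h b - h a)%:E.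
  move=> ca ab bd; rewrite /nu /= /mfrestr /mrestr (_ : _ `&` D = `]a, b]%classic) ?muE//.
  apply/setIidl => t /=; rewrite /D/= !in_itv/= => /andP[at' tb].
  by rewrite (le_lt_trans ca at') (le_trans tb bd).
have cNf := nondecreasing_countable_discontinuities ndf.
have cNh := nondecreasing_countable_discontinuities ndh.
have cf t : ~ [set x | ~ {for x, continuous f}] t -> {for t, continuous f} by move=> /= /contrapT.
have ch' t : ~ [set x | ~ {for x, continuous h}] t -> {for t, continuous h} by move=> /= /contrapT.
have mf := measurable_countable_discontinuity fk cNf cf.
have mh := measurable_countable_discontinuity hk cNh ch'.
have E x y : 0 < y -> intv (fun t => f t * dconjK (x - t) y) c d =
    conj_pot nu D x y + (- h d * conjK (x - d) y + h c * conjK (x - c) y).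
  move=> y0.
  have -> : intv (fun t => f t * dconjK (x - t) y) c d = intv (fun t => h t * dconjK (x - t) y) c d.
    rewrite /intv /Rintegral; congr fine; apply: ae_eq_integral => //.
    - by case/integrableP: (integrable_Phi_dconjK mf fk x c d y0).
    - by case/integrableP: (integrable_Phi_dconjK mh hk x c d y0).
    - exists [set x | ~ {for x, continuous f}]; split.
      + by apply: countable_measurable => // t; exact: measurable_set1.
      + exact: countable_lebesgue_measure0.
      + move=> t /= /not_implyP[_ ne] cft; apply: ne.
        by rewrite /h (right_limit_continuous ndf fk cft).
  have dg s : is_derive s (1 : R) (fun t => conjK (x - t) y) (- dconjK (x - s) y).
    have h1 : is_derive s (1 : R) (fun t : R => x - t) (- 1).
      by apply: is_derive_eq; rewrite /GRing.scale/=; ring.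
    have := @is_derive1_comp _ (conjK ^~ y) (fun t => x - t) _ _ _ (is_derive_conjKx (x - s) y0) h1.
    by rewrite mulrN1.
  have cg1 : continuous (fun s => - dconjK (x - s) y).
    by move=> s; apply: cvgN; apply: (continuous_comp_subl (g := @dconjK R ^~ y)); exact: continuous_dconjK.
  have g1k s : `|- dconjK (x - s) y| <= (ch y - 1)^-1 by rewrite normrN; exact: dconjK_ub.
  have RS := is_RS_integral_by_parts hk cNh ch' dg cg1 g1k (ltW cd).
  have := stieltjes_integral_RS cd nuE dg g1k RS.
  rewrite -/D -/(conj_pot nu D x y) => ->.
  have -> : intv (fun s => h s * - dconjK (x - s) y) c d = - intv (fun t => h t * dconjK (x - t) y) c d.
    rewrite -mulN1r /intv -RintegralZl//; last exact: integrable_Phi_dconjK.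
    by apply: eq_Rintegral => t _; rewrite mulrN mulN1r.
  ring.
have := ae_cone_limit_conj_pot nu cd cd1; apply: ae_mono => x H xcd.
have [L HL] := H xcd; case/andP: xcd => cx xd.
have pos r : r != 0 -> `|r| <= 2 -> 0 < 1 - cos r.
  by move=> r0 r2; apply: lt_le_trans (sqr_le_1Bcos r2); rewrite divr_gt0// exprn_even_gt0.
have [Ld HLd] : exists L, cone_limit (fun x y => conjK (x - d) y) x L.
  apply: cone_limit_conjK; apply: pos; first by rewrite subr_eq0 lt_eqF.
  by rewrite ler_norml; apply/andP; split; lra.
have [Lc HLc] : exists L, cone_limit (fun x y => conjK (x - c) y) x L.
  apply: cone_limit_conjK; apply: pos; first by rewrite subr_eq0 gt_eqF.
  by rewrite ler_norml; apply/andP; split; lra.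
exists (L + (- h d * Ld + h c * Lc)).
apply: eq_cone_limit (cone_limitD HL (cone_limitD (cone_limitZ (- h d) HLd) (cone_limitZ (h c) HLc))).
by move=> s y y0; rewrite -E.
Qed.

End near_piece.

(** * Almost everywhere cone limits over a full period *)

Section strip.
Context {R : realType}.
Local Notation lambda := (@lebesgue_measure R).

(** Translation invariance of Lebesgue measure, by uniqueness of the measure with prescribed values
    on half-open intervals. *)
Lemma negligible_shift (N : set R) (s : R) : lambda.-negligible N ->
  lambda.-negligible [set x | N (x + s)].
Proof.
move=> [A [mA A0 NA]].
pose sh : measurableTypeR R -> measurableTypeR R := fun x => x + s.
have msh : measurable_fun setT sh.
  by apply: continuous_measurable_fun => x; apply: cvgD; [exact: cvg_id|exact: cvg_cst].
exists (sh @^-1` A); split.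
- by rewrite -[X in measurable X]setTI; exact: msh.
- pose mu' : {measure set (measurableTypeR R) -> \bar R} := pushforward lambda sh.
  have E : forall X, ocitv X -> lebesgue_stieltjes_measure idfun X = mu' msh X.
    move=> X /ocitvP[->|[[a b] /= ab ->]]; first by rewrite !measure0.
    rewrite -/(@lebesgue_measure R) /mu'/= /pushforward.
    rewrite (_ : _ @^-1` _ = `]a - s, b - s]%classic).
      rewrite !lebesgue_measure_itv/= !lte_fin ltrD2r ab -!EFinB; congr EFin; ring.
    by apply/seteqP; split => x; rewrite /= /sh !in_itv/= ltrBlDr lerBrDr.
  have := lebesgue_stieltjes_measure_unique E mA.
  rewrite -/(@lebesgue_measure R) => H.
  by move: A0; rewrite /= H.
- by move=> x /= /NA.
Qed.

Lemma ae_countType_forall (I : countType) (P : I -> R -> Prop) :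
  (forall i, {ae lambda, forall x, P i x}) -> {ae lambda, forall x, forall i, P i x}.
Proof.
move=> H; pose Q n x := forall i, unpickle n = Some i -> P i x.
have : {ae lambda, forall x, forall n, Q n x}.
  apply: ae_countable_forall => n; rewrite /Q; case: (unpickle n) => [i|].
    by apply: ae_mono (H i) => x Px j [<-].
  exact: aeW.
by apply: ae_mono => x Qx i; apply: (Qx (pickle i)); exact: pickleK.
Qed.

(** The translates of the open period miss only the points T / 2 + k T, a countable set; any other
    point is moved into the period by the integer part [k]. *)
Lemma ae_periodic (T : R) (P : R -> Prop) : 0 < T -> (forall x, P x -> P (x + T)) ->
  (forall x, P x -> P (x - T)) ->
  {ae lambda, forall x, - (T / 2) < x < T / 2 -> P x} -> {ae lambda, forall x, P x}.
Proof.
move=> T0 PD PB H.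
have PZ (k : int) x : P (x + k%:~R * T) -> P x.
  elim: k x => [|n IH|n IH] x; first by rewrite mul0r addr0.
    rewrite intS rmorphD/= mulrDl mul1r addrA => /IH/PB.
    by rewrite addrK.
  rewrite intS opprD rmorphD/= [(- 1)%:~R]rmorphN mulrDl mulN1r addrA.
  by move=> /IH/PD; rewrite subrK.
have h1 k : {ae lambda, forall x, - (T / 2) < x + k%:~R * T < T / 2 -> P x}.
  have := negligible_shift (k%:~R * T) H; apply: negligibleS => x /= nP.
  by apply: contra_not nP => h xk; exact/(PZ k)/h.
have h2 : {ae lambda, forall x, forall k : int, x + k%:~R * T <> T / 2}.
  apply: ae_countType_forall => k.
  exists [set T / 2 - k%:~R * T]; split; first exact: measurable_set1.
    exact: lebesgue_measure_set1.
  by move=> x /= /contrapT <-; rewrite addrK.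
have := ae_and (ae_countType_forall h1) h2; apply: ae_mono => x [Hx nx].
pose k := Num.floor ((x + T / 2) / T).
have := floor_itv ((x + T / 2) / T); rewrite -/k rmorphD/=.
rewrite ler_pdivlMr// ltr_pdivrMr// => /andP[k1 k2].
apply: (Hx (- k)); rewrite mulrNz mulNr.
have := nx (- k + 1); rewrite rmorphD/= mulrNz mulrDl mul1r mulNr => nx'.
apply/andP; split; last by lra.
rewrite lt_neqAle; apply/andP; split; last by lra.
by apply/eqP => e; apply: nx'; lra.
Qed.

Variables (Phi : R -> R) (B : R).
Hypothesis PhiB : forall t, `|Phi t| <= B.
Hypothesis cbv : countably_bounded_variation Phi.

(** In strip coordinates this is 2 pi times the conjugate Poisson-Stieltjes integral, when [Phi] is
    periodic: the boundary terms of the integration by parts cancel. *)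
Definition conj_strip (x y : R) : R := intv (fun t => Phi t * dconjK (x - t) y) (- pi) pi.

Let cN := countably_bounded_variation_discontinuities cbv.

Let cPhi t : ~ [set x | ~ {for x, continuous Phi}] t -> {for t, continuous Phi}.
Proof. by move=> /= /contrapT. Qed.

Let mPhi := measurable_countable_discontinuity PhiB cN cPhi.

(** The period is cut at [c] and [d]. The outer pieces stay away from [x] modulo 2 pi because x - t
    remains within compact parts of ]0, 2 pi[ and ]-2 pi, 0[; the middle piece is a difference of
    two monotone ones. *)
Let ae_local (a b c d : R) : bounded_variation_oo a b Phi -> a < c -> c < d -> d < b ->
  - pi < c -> d < pi -> d - c <= 1 ->
  {ae lambda, forall x, c < x < d -> exists L, cone_limit conj_strip x L}.
Proof.
move=> bv ac cd db pc dp cd1.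
have [f1 [f2 [k [n1 n2 b1 b2 fE]]]] := bounded_variation_oo_decomposition bv ac cd db.
have := ae_and (ae_cone_limit_monotone cd cd1 n1 b1) (ae_cone_limit_monotone cd cd1 n2 b2).
apply: ae_mono => x [H1 H2] xcd.
have [L1 HL1] := H1 xcd; have [L2 HL2] := H2 xcd; case/andP: xcd => cx xd.
have [ml ml0 Hl] := @one_sub_cos_ge _ (x - c) (x + pi) ltac:(lra) ltac:(lra).
have [mr mr0 Hr] := @one_sub_cos_ge _ (d - x) (pi - x) ltac:(lra) ltac:(lra).
have [|t|L3 HL3] := @cone_limit_far _ Phi B mPhi PhiB x (- pi) c ml _ ml0; first exact: ltW.
  by move=> /andP[t1 t2]; apply: Hl; apply/andP; split; lra.
have [|t|L4 HL4] := @cone_limit_far _ Phi B mPhi PhiB x d pi mr _ mr0; first exact: ltW.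
  by move=> /andP[t1 t2]; rewrite -cosN opprB; apply: Hr; apply/andP; split; lra.
exists (L1 + (-1 * L2) + (L3 + L4)).
apply: eq_cone_limit (cone_limitD (cone_limitD HL1 (cone_limitZ (-1) HL2)) (cone_limitD HL3 HL4)) => s y y0.
have mono (f : R -> R) (n : {homo f : x y / x <= y}) (fb : forall x, `|f x| <= k) p q :
    lambda.-integrable `[p, q] (EFin \o (fun t => f t * dconjK (s - t) y)).
  apply: (@integrable_Phi_dconjK _ f k) => //.
  apply: (measurable_countable_discontinuity fb (nondecreasing_countable_discontinuities n)).
  by move=> t /= /contrapT.
have iP p q := @integrable_Phi_dconjK _ Phi B mPhi PhiB s y p q y0.
have -> : intv (fun t => f1 t * dconjK (s - t) y) c d + -1 * intv (fun t => f2 t * dconjK (s - t) y) c d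
   = intv (fun t => Phi t * dconjK (s - t) y) c d.
  rewrite mulN1r /intv -RintegralB//; [|exact: mono n1 b1 _ _|exact: mono n2 b2 _ _].
  apply: eq_Rintegral => t; rewrite inE/= in_itv/= => tcd.
  by rewrite (fE t tcd); ring.
rewrite /conj_strip -(intvB (iP (- pi) d) (ltW pc) (ltW cd)).
have pd : - pi <= d by lra.
rewrite -(intvB (iP (- pi) pi) pd (ltW dp)); ring.
Qed.

Lemma ae_cone_limit_conj_strip :
  {ae lambda, forall x, - pi < x < pi -> exists L, cone_limit conj_strip x L}.
Proof.
have [a [b [ab _ bv cC]]] := cbv.
(* Rational end points leave countably many local statements, hence one null set. The side
   conditions are premises, so that indices violating them hold trivially. *)
pose P (i : nat * (rat * rat)) (x : R) := a i.1 < ratr i.2.1 -> ratr i.2.1 < ratr i.2.2 :> R ->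
  ratr i.2.2 < b i.1 -> - pi < ratr i.2.1 :> R -> ratr i.2.2 < pi :> R ->
  ratr i.2.2 - ratr i.2.1 <= 1 :> R -> ratr i.2.1 < x < ratr i.2.2 ->
  exists L, cone_limit conj_strip x L.
have H1 : {ae lambda, forall x, forall i, P i x}.
  apply: ae_countType_forall => -[n [p q]]; rewrite /P/=.
  have [h1|h1] := pselect (a n < ratr p); last by apply: aeW => x /h1.
  have [h2|h2] := pselect (ratr p < ratr q :> R); last by apply: aeW => x _ /h2.
  have [h3|h3] := pselect (ratr q < b n); last by apply: aeW => x _ _ /h3.
  have [h4|h4] := pselect (- pi < ratr p :> R); last by apply: aeW => x _ _ _ /h4.
  have [h5|h5] := pselect (ratr q < pi :> R); last by apply: aeW => x _ _ _ _ /h5.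
  have [h6|h6] := pselect (ratr q - ratr p <= 1 :> R); last by apply: aeW => x _ _ _ _ _ /h6.
  by apply: ae_mono (ae_local (bv n) h1 h2 h3 h4 h5 h6) => x Hx _ _ _ _ _ _.
have H2 : {ae lambda, forall x, (\bigcup_n `]a n, b n[%classic) x}.
  exists (~` \bigcup_n `]a n, b n[%classic); split => //.
  - by apply: countable_measurable => // t; exact: measurable_set1.
  - exact: countable_lebesgue_measure0.
have := ae_and H1 H2; apply: ae_mono => x [Hx [n _ /=]]; rewrite in_itv/= => /andP[ax xb] /andP[px xp].
(* Margins of 1/2 on both sides of [x] force the rational interval to have length at most 1. *)
pose l := Num.max (Num.max (a n) (- pi)) (x - 2^-1).
pose r := Num.min (Num.min (b n) pi) (x + 2^-1).
have lx : l < x by rewrite !gt_max ax px/= ltrBlDr ltrDl.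
have xr : x < r by rewrite !lt_min xb xp/= ltrDl.
have [p] := rat_in_itvoo lx; rewrite in_itv/= => /andP[lp px'].
have [q] := rat_in_itvoo xr; rewrite in_itv/= => /andP[xq qr].
move: lp qr; rewrite !gt_max !lt_min => /andP[/andP[p1 p2] p3] /andP[/andP[q1 q2] q3].
apply: (Hx (n, (p, q))) => //=.
- exact: lt_trans xq.
- lra.
- by rewrite px'.
Qed.

End strip.

(** * Polar coordinates and Stolz angles *)

Section polar_coordinates.
Context {R : realType}.
Implicit Types (z zeta : R[i]).

Lemma cabsE (a b : R) : cabs (Complex a b) = Num.sqrt (a ^+ 2 + b ^+ 2).
Proof. by rewrite /cabs normc_def. Qed.

Lemma cabs_polar (r x : R) : 0 <= r -> cabs (Complex (r * cos x) (r * sin x)) = r.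
Proof. by move=> r0; rewrite cabsE !exprMn -mulrDr cos2Dsin2 mulr1 sqrtr_sqr ger0_norm. Qed.

Lemma expi_scale (r x : R) : r%:C%C * expi x = Complex (r * cos x) (r * sin x).
Proof. by rewrite /expi; simpc. Qed.

Lemma arg_exists (a b : R) : exists t, Complex a b = (cabs (Complex a b))%:C%C * expi t.
Proof.
rewrite cabsE; set r := Num.sqrt _.
have r2 : r ^+ 2 = a ^+ 2 + b ^+ 2 by rewrite sqr_sqrtr// addr_ge0 ?sqr_ge0.
have [r0|r0] := eqVneq r 0.
  exists 0; rewrite expi_scale r0 !mul0r.
  have a0 : a ^+ 2 = 0 by move: r2; rewrite r0 expr0n/=; have := sqr_ge0 a; have := sqr_ge0 b; lra.
  have b0 : b ^+ 2 = 0 by move: r2; rewrite r0 expr0n/=; have := sqr_ge0 a; have := sqr_ge0 b; lra.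
  by move/eqP: a0; rewrite sqrf_eq0 => /eqP ->; move/eqP: b0; rewrite sqrf_eq0 => /eqP ->.
have rp : 0 < r by rewrite lt_neqAle eq_sym r0 sqrtr_ge0.
have pq : (a / r) ^+ 2 + (b / r) ^+ 2 = 1.
  by rewrite !expr_div_n -mulrDl -r2 divff// expf_neq0.
have p1 : -1 <= a / r <= 1.
  by rewrite -ler_norml -(ler_pXn2r (n := 2)) ?nnegrE// expr1n real_normK ?num_real//;
    have := sqr_ge0 (b / r); lra.
have ct : cos (acos (a / r)) = a / r by apply: acosK; rewrite in_itv.
have st : sin (acos (a / r)) = `|b / r|.
  by rewrite sin_acos// -sqrtr_sqr; congr Num.sqrt; lra.
have [q0|q0] := leP 0 (b / r).
  exists (acos (a / r)); rewrite expi_scale ct st ger0_norm//.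
  by rewrite ![r * _]mulrC !divfK.
exists (- acos (a / r)); rewrite expi_scale cosN sinN ct st ltr0_norm// opprK.
by rewrite ![r * _]mulrC !divfK.
Qed.

Lemma argE z : z = (cabs z)%:C%C * expi (arg z).
Proof.
rewrite /arg; case: xgetP => [t _ //|H].
by case: z H => a b H; have [t Ht] := arg_exists a b; case: (H t).
Qed.

(* Points of a Stolz angle in the strip coordinates [z = exp (- y + i x)]. *)
Lemma stolz_polar (t0 tau s kappa : R) : 0 < kappa -> cos (tau - t0) <= - kappa ->
  0 < s <= 4^-1 -> s <= kappa ->
  exists x y, [/\ 0 < y, y <= 2 * s, `|x - t0| <= 8 / kappa * y,
    cos t0 + s * cos tau = expR (- y) * cos x & sin t0 + s * sin tau = expR (- y) * sin x].
Proof.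
move=> k0 ck /andP[s0 s4] sk.
pose c := cos (tau - t0); pose d := sin (tau - t0).
have cd : c ^+ 2 + d ^+ 2 = 1 by exact: cos2Dsin2.
(* Rotation by - t0 moves the point to p + i q near 1, with modulus [r] and small argument [sg]. *)
pose p := 1 + s * c; pose q := s * d.
pose r := Num.sqrt (p ^+ 2 + q ^+ 2).
have pq0 : 0 <= p ^+ 2 + q ^+ 2 by rewrite addr_ge0 ?sqr_ge0.
have r2 : r ^+ 2 = p ^+ 2 + q ^+ 2 by rewrite sqr_sqrtr.
have r2E : r ^+ 2 = 1 + 2 * s * c + s ^+ 2.
  by rewrite r2 /p /q; transitivity (1 + 2 * s * c + s ^+ 2 * (c ^+ 2 + d ^+ 2)); [ring|rewrite cd mulr1].
have r0 : 0 <= r by exact: sqrtr_ge0.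
have cN1 : -1 <= c by exact: cos_geN1.
have p1 : 1 - s <= p by rewrite /p; nra.
have rp : 1 - s <= r by nra.
(* 1 - r^2 = - 2 s c - s^2 is at least 2 kappa s - s^2, and [s <= kappa] leaves kappa s. This yields
   s <= 2 y / kappa below. *)
have rk : kappa * s <= 1 - r ^+ 2.
  have h1 : s * (c + kappa) <= 0 by rewrite pmulr_rle0//; move: ck; rewrite -/c; lra.
  have h2 : 0 <= s * (kappa - s) by rewrite mulr_ge0 ?subr_ge0// ltW.
  by rewrite r2E; lra.
have r1 : r < 1 by nra.
have r0' : 0 < r by lra.
pose y := - ln r.
have Ey : expR (- y) = r by rewrite opprK lnK.
have y1 : 1 - r <= y by have := expR_ge1Dx (- y); rewrite Ey; lra.
have y0 : 0 < y by lra.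
have ks : kappa * s <= 2 * y by nra.
have y2 : y <= 2 * s.
  have := expR_ge1Dx y; have e := expRxMexpNx_1 y; rewrite Ey in e.
  have := expR_gt0 y; nra.
have w2 : `|q / r| <= 2 * s.
  rewrite normrM normfV (gtr0_norm r0') ler_pdivrMr// /q normrM (gtr0_norm s0).
  have : `|d| <= 1 by exact: sin_max.
  have := normr_ge0 d; nra.
have w12 : `|q / r| <= 2^-1 by lra.
have s1 : 2^-1 <= sin 1 :> R by have := @half_le_sin R 1; rewrite ler01 lexx => /(_ isT); lra.
have cs : {within `[(-1 : R), 1], continuous (@sin R)}.
  by apply: continuous_subspaceT; exact: continuous_sin.
(* Searching the argument in [-1, 1] makes its cosine positive, which singles out p / r among the
   two roots. It also gives |sg| <= 2 |sin sg| <= 4 s <= (8 / kappa) y. *)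
have [||sg] := IVT (v := q / r) _ cs; first by lra.
  have m1 : - sin 1 <= sin 1 :> R by lra.
  rewrite sinN (min_idPl m1) (max_idPr m1); move: w12; rewrite ler_norml => /andP[w1 w1'].
  by apply/andP; split; lra.
rewrite in_itv/= => sg1 sgE.
have sgn : `|sg| <= 1 by rewrite ler_norml.
have csg : cos sg = p / r.
  have c0 : 0 < cos sg.
    rewrite lt_neqAle cos_ge0_pihalf ?andbT; last first.
      by have := pihalf_ge1 R; case/andP: sg1 => *; apply/andP; split; lra.
    apply/eqP => e; have := cos2Dsin2 sg; rewrite sgE -e expr0n/= add0r => h.
    have : (q / r) ^+ 2 <= (2^-1) ^+ 2 by rewrite -real_normK ?num_real// ler_sqr ?nnegrE.
    by rewrite h; lra.
  have p0 : 0 < p / r by rewrite divr_gt0//; lra.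
  apply/eqP; rewrite -(eqrXn2 (n := 2)) ?(ltW c0) ?(ltW p0)// cos2sin2 sgE.
  rewrite !expr_div_n; apply/eqP.
  have -> : 1 = r ^+ 2 / r ^+ 2 by rewrite divff// expf_neq0// gt_eqF.
  by rewrite -mulrBl r2 addrK.
exists (t0 + sg), y; split => //.
- rewrite [t0 + sg]addrC addrK.
  have h := half_norm_le_sin sgn; rewrite sgE in h.
  have : s <= 2 / kappa * y by rewrite mulrAC ler_pdivlMr// mulrC.
  have -> : 8 / kappa * y = 4 * (2 / kappa * y) by field; rewrite gt_eqF.
  lra.
- rewrite Ey cosD csg sgE.
  have -> : r * (cos t0 * (p / r) - sin t0 * (q / r)) = cos t0 * p - sin t0 * q by field; rewrite gt_eqF.
  rewrite /p /q /c /d.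
  have -> : cos tau = cos (t0 + (tau - t0)) by congr cos; ring.
  rewrite cosD; ring.
- rewrite Ey sinD csg sgE.
  have -> : r * (sin t0 * (p / r) + cos t0 * (q / r)) = sin t0 * p + cos t0 * q by field; rewrite gt_eqF.
  rewrite /p /q /c /d.
  have -> : sin tau = sin (t0 + (tau - t0)) by congr sin; ring.
  rewrite sinD; ring.
Qed.

End polar_coordinates.

(** * Return to the disc *)

Section conjugate_poisson_stieltjes.
Context {R : realType}.
Variables (Phi : R -> R) (B : R).
Hypothesis PhiB : forall t, `|Phi t| <= B.
Hypothesis cbv : countably_bounded_variation Phi.
Hypothesis Phi_periodic : periodic Phi (2 * pi).

Lemma conj_poisson_kernelE (T y : R) : 0 < y -> conj_poisson_kernel (expR (- y)) T = conjK T y.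
Proof.
move=> y0; rewrite /conj_poisson_kernel /conjK /den /ch.
have e0 := expR_gt0 y; have d0 := den_gt0 T y0.
rewrite expRN; set e := expR y in e0 *.
have : (e + e^-1) / 2 - cos T != 0.
  by move: d0; rewrite /den /ch expRN -/e => d0; rewrite gt_eqF.
have -> : (e + e^-1) / 2 - cos T = (1 - 2 * e^-1 * cos T + e^-1 ^+ 2) * e / 2.
  by field; rewrite gt_eqF.
rewrite !mulf_eq0 !negb_or => /andP[/andP[h _] _].
set q := 1 - _ + _ in h *; move: q h => q h.
by field; rewrite h gt_eqF.
Qed.

(** [Phi] and the kernel each take equal values at - pi and pi, so the boundary terms cancel. *)
Lemma is_RS_integral_conjK (x y : R) : 0 < y ->
  is_RS_integral (fun t => conjK (x - t) y) Phi (- pi) pi (conj_strip Phi x y).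
Proof.
move=> y0.
have cN := countably_bounded_variation_discontinuities cbv.
have cPhi t : ~ [set x | ~ {for x, continuous Phi}] t -> {for t, continuous Phi} by move=> /= /contrapT.
have mPhi := measurable_countable_discontinuity PhiB cN cPhi.
have dg s : is_derive s (1 : R) (fun t => conjK (x - t) y) (- dconjK (x - s) y).
  have h1 : is_derive s (1 : R) (fun t : R => x - t) (- 1).
    by apply: is_derive_eq; rewrite /GRing.scale/=; ring.
  have := @is_derive1_comp _ (conjK ^~ y) (fun t => x - t) _ _ _ (is_derive_conjKx (x - s) y0) h1.
  by rewrite mulrN1.
have cg1 : continuous (fun s => - dconjK (x - s) y).
  by move=> s; apply: cvgN; apply: (continuous_comp_subl (g := @dconjK R ^~ y)); exact: continuous_dconjK.
have g1k s : `|- dconjK (x - s) y| <= (ch y - 1)^-1 by rewrite normrN; exact: dconjK_ub.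
have pp : - pi <= pi :> R by have := @pi_gt0 R; lra.
have := is_RS_integral_by_parts PhiB cN cPhi dg cg1 g1k pp.
have -> : Phi pi = Phi (- pi).
  by rewrite -[RHS]Phi_periodic; congr Phi; ring.
have -> : conjK (x - - pi) y = conjK (x - pi) y.
  have e : x - - pi = (x - pi) + pi *+ 2 by rewrite mulr2n; ring.
  by rewrite /conjK /den e cosD2pi sinD2pi.
rewrite subrr sub0r.
have -> : intv (fun s => Phi s * - dconjK (x - s) y) (- pi) pi = - conj_strip Phi x y.
  rewrite -[RHS]mulN1r /conj_strip /intv -RintegralZl//; last exact: integrable_Phi_dconjK mPhi PhiB _ _ _ _ y0.
  by apply: eq_Rintegral => t _; rewrite mulrN mulN1r.
by rewrite opprK.
Qed.

Lemma conj_poisson_stieltjes_existsT (z : R[i]) : disc z -> conj_poisson_stieltjes_exists Phi z.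
Proof.
rewrite /disc/= => z1; rewrite /conj_poisson_stieltjes_exists.
have z0 : 0 <= cabs z by case: z {z1} => a b; rewrite cabsE sqrtr_ge0.
(* The centre has no strip coordinates; there the kernel vanishes and all sums are 0. *)
have [->|zn0] := eqVneq (cabs z) 0.
  exists 0 => e e0; exists 1 => // p t tau _ _ _ _.
  rewrite big1 ?subr0 ?normr0// => i _.
  by rewrite /conj_poisson_kernel !(mulr0, mul0r).
have zp : 0 < cabs z by rewrite lt_neqAle eq_sym zn0.
pose y := - ln (cabs z).
have y0 : 0 < y by rewrite oppr_gt0 ln_lt0// zp.
have E : cabs z = expR (- y) by rewrite opprK lnK.
exists (conj_strip Phi (arg z) y); rewrite E.
have := is_RS_integral_conjK (arg z) y0.
by congr is_RS_integral; apply/funext => t; rewrite conj_poisson_kernelE.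
Qed.

(** The kernel sees [x] only through its cosine and sine. This gives periodicity and independence of
    the chosen argument. *)
Lemma conj_strip_eq (x x' y : R) : cos x = cos x' -> sin x = sin x' ->
  conj_strip Phi x y = conj_strip Phi x' y.
Proof.
move=> cx sx; apply: eq_Rintegral => t _.
by rewrite /dconjK /den !cosB cx sx.
Qed.

Lemma conj_poisson_stieltjesE (x y : R) : 0 < y ->
  conj_poisson_stieltjes Phi (Complex (expR (- y) * cos x) (expR (- y) * sin x)) =
  (2 * pi)^-1 * conj_strip Phi x y.
Proof.
move=> y0; rewrite /conj_poisson_stieltjes; congr (_ * _).
set z := Complex _ _.
have zE : cabs z = expR (- y) by rewrite cabs_polar// expR_ge0.
have en0 : expR (- y) != 0 by rewrite gt_eqF// expR_gt0.
have [cx sx] : cos x = cos (arg z) /\ sin x = sin (arg z).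
  have := argE z; rewrite zE expi_scale => h.
  split; apply: (mulfI en0).
    exact: (congr1 (@complex.Re R) h).
  exact: (congr1 (@complex.Im R) h).
rewrite /RS_integral zE.
have -> : (fun t => conj_poisson_kernel (expR (- y)) (arg z - t)) = (fun t => conjK (arg z - t) y).
  by apply/funext => t; rewrite conj_poisson_kernelE.
have H := is_RS_integral_conjK (arg z) y0.
rewrite (conj_strip_eq y cx sx).
have pp : - pi < pi :> R by have := @pi_gt0 R; lra.
apply: (is_RS_integral_unique pp _ H).
(* The default 0 of [RS_integral] is not reached, since the integral exists; uniqueness then
   identifies the chosen value. *)
by apply: (@xgetPex _ 0 (is_RS_integral _ Phi (- pi) pi)); exists (conj_strip Phi (arg z) y).
Qed.

Lemma disc_path_near (gamma : R -> R[i]^o) (zeta : R[i]) (e : R) : disc_path_to zeta gamma -> 0 < e ->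
  \forall t \near 1^'-, [/\ 0 <= t, t < 1 & cabs (gamma t - zeta) < e].
Proof.
move=> [cg _ g1] e0.
have e0' : 0 < e%:C%C :> R[i] by rewrite ltcR.
have h : gamma t @[t --> within `[0, 1]%classic (nbhs (1 : R))] --> gamma 1.
  by have /subspace_continuousP/(_ 1) := cg; apply; rewrite /= in_itv/= ler01 lexx.
have : \forall t \near within `[0, 1]%classic (nbhs (1 : R)), `|gamma 1 - gamma t| < e%:C%C.
  by move/cvgrPdist_lt : h; apply.
rewrite near_withinE => H.
rewrite /at_left near_withinE.
near=> t => t1.
have t0 : 0 <= t by apply: ltW; near: t; apply: lt_nbhsr; exact: ltr01.
split => //.
have : `|gamma 1 - gamma t| < e%:C%C.
  by apply: (near H t) => //; rewrite /= in_itv/= t0 ltW.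
by rewrite g1 distrC ltcE/= /cabs => /andP[].
Unshelve. all: by end_near. Qed.

(** The squared modulus of the point at distance s in direction [tau] is 1 + s (2 cos (tau - t0) +
    s). Being below 1 for all s < delta, it forces a bound on the cosine that is uniform over the
    open range of directions. *)
Lemma angle_cos_le (t0 alpha beta delta tau : R) : 0 < delta -> alpha < tau < beta ->
  (forall z, angle (expi t0) alpha beta z -> cabs (z - expi t0) < delta -> disc z) ->
  cos (tau - t0) <= - (delta / 2).
Proof.
move=> d0 tab H; rewrite leNgt; apply/negP => ck.
pose s := (Num.max 0 (- 2 * cos (tau - t0)) + delta) / 2.
have m0 : 0 <= Num.max 0 (- 2 * cos (tau - t0)) by rewrite le_max lexx.
have m1 : - 2 * cos (tau - t0) <= Num.max 0 (- 2 * cos (tau - t0)) by rewrite le_max lexx orbT.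
have m2 : Num.max 0 (- 2 * cos (tau - t0)) < delta by rewrite gt_max d0/=; lra.
have s0 : 0 < s by rewrite /s; lra.
have sd : s < delta by rewrite /s; lra.
have sc : - 2 * cos (tau - t0) <= s by rewrite /s; lra.
have := H (expi t0 + s%:C%C * expi tau).
move=> /(_ _)/wrap[|]; first by exists s, tau.
rewrite addrC addKr expi_scale cabs_polar ?(ltW s0)// => /(_ sd).
rewrite /disc/= /expi; simpc; rewrite cabsE.
have -> : (cos t0 + s * cos tau) ^+ 2 + (sin t0 + s * sin tau) ^+ 2 = 1 + s * (2 * cos (tau - t0) + s).
  rewrite cosB.
  transitivity (s ^+ 2 * (cos tau ^+ 2 + sin tau ^+ 2) + (cos t0 ^+ 2 + sin t0 ^+ 2) +
     2 * s * (cos tau * cos t0 + sin tau * sin t0)); first by ring.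
  by rewrite !cos2Dsin2; ring.
apply/negP; rewrite -leNgt -[leLHS]sqrtr1 ler_sqrt ?ltr01//.
  by rewrite lerDl mulr_ge0 ?(ltW s0)//; lra.
by rewrite addr_ge0// mulr_ge0 ?(ltW s0)//; lra.
Qed.

Lemma angular_limit_of_cone_limit (t0 L : R) : cone_limit (conj_strip Phi) t0 L ->
  angular_limit (conj_poisson_stieltjes Phi) (expi t0) ((2 * pi)^-1 * L).
Proof.
move=> HL gamma path [alpha [beta [delta [d0 Hdisc Hang]]]].
apply/cvgrPdist_le => e e0.
pose kappa := delta / 2.
have k0 : 0 < kappa by rewrite divr_gt0.
have C0 : 0 < 8 / kappa by rewrite divr_gt0.
have p0 : 0 < 2 * pi :> R by rewrite mulr_gt0// pi_gt0.
have pe0 : 0 < 2 * pi * e by rewrite mulr_gt0.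
have [d dd0 HC] := HL _ _ C0 pe0.
(* [delta] puts the path in the angle, 1/4 and [kappa] are the ranges of [stolz_polar], and d / 2
   ensures y <= 2 s < d. *)
pose m := Num.min (Num.min delta 4^-1) (Num.min kappa (d / 2)).
have m0 : 0 < m by rewrite !lt_min d0 invr_gt0 ltr0n k0 divr_gt0.
have := disc_path_near path m0; apply: filterS => t [t0' t1].
rewrite !lt_min => /andP[/andP[gd g4] /andP[gk gd2]].
have [|s [tau [s0 tab gE]]] := Hang t _ gd; first by rewrite t0'.
have sE : cabs (gamma t - expi t0) = s.
  by rewrite gE addrC addKr expi_scale cabs_polar// ltW.
rewrite sE in gd g4 gk gd2.
have ck := angle_cos_le d0 tab Hdisc.
have [|x [y [y0 y2 xC E1 E2]]] := stolz_polar k0 ck _ (ltW gk); first by rewrite s0 ltW.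
have -> : gamma t = Complex (expR (- y) * cos x) (expR (- y) * sin x).
  by rewrite gE expi_scale /expi -E1 -E2; simpc.
rewrite conj_poisson_stieltjesE// -mulrBr normrM gtr0_norm ?invr_gt0//.
rewrite ler_pdivrMl// distrC; apply: HC => //.
by rewrite y0/=; lra.
Qed.

End conjugate_poisson_stieltjes.

Theorem corollary6 (R : realType) (Phi : R -> R)
  (Phi_periodic : periodic Phi (2 * pi))
  (Phi_bounded : bounded_fun Phi)
  (Phi_CBV : countably_bounded_variation Phi) :
  (forall z : R[i], disc z -> conj_poisson_stieltjes_exists Phi z) /\
  exists phi : R[i] -> R,
    ae_circle (fun zeta : R[i] =>
      angular_limit (conj_poisson_stieltjes Phi) zeta (phi zeta)).
Proof.
have [B PhiB] : exists B, forall t, `|Phi t| <= B.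
  have [M [_ HM]] := Phi_bounded; exists (M + 1) => t.
  by apply: HM => //; rewrite ltrDl.
split; first by move=> z; exact: conj_poisson_stieltjes_existsT PhiB Phi_CBV Phi_periodic z.
(* The boundary function is picked by choice; the default 0 occurs only where there is no angular
   limit. *)
exists (fun zeta => xget 0 [set l | angular_limit (conj_poisson_stieltjes Phi) zeta l]).
have p0 : 0 < 2 * pi :> R by rewrite mulr_gt0// pi_gt0.
have H : {ae (@lebesgue_measure R), forall x, exists L, cone_limit (conj_strip Phi) x L}.
  have per x y : conj_strip Phi (x + 2 * pi) y = conj_strip Phi x y.
    by apply: conj_strip_eq; rewrite mulr_natl ?cosD2pi ?sinD2pi.
  apply: (ae_periodic p0).
  - move=> x [L HL]; exists L => C e C0 e0; have [d d0 Hd] := HL C e C0 e0.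
    exists d => // s y yd sC; rewrite -[s](subrK (2 * pi)) per; apply: Hd => //.
    by move: sC; rewrite opprD addrA addrAC.
  - move=> x [L HL]; exists L => C e C0 e0; have [d d0 Hd] := HL C e C0 e0.
    exists d => // s y yd sC; rewrite -per; apply: Hd => //.
    by move: sC; rewrite opprB addrA.
  - rewrite (_ : 2 * pi / 2 = pi); last by rewrite mulrAC divff ?mul1r.
    exact: ae_cone_limit_conj_strip PhiB Phi_CBV.
rewrite /ae_circle; apply: ae_mono H => t [L HL].
by apply: xgetPex; exists ((2 * pi)^-1 * L); exact: angular_limit_of_cone_limit PhiB Phi_CBV Phi_periodic _ _ HL.
Qed.
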